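(* Let $P$ be a probability distribution on $\mathfrak S^\infty$ for a coherent sequence of permutations $(\pi_n)$, let $P_n$ denote the law of $\pi_n$ under $P$, and let $\ell=\ell(\pi_n)$, $u=u(\pi_n)$ denote the numbers of proper lower and proper upper records of $\pi_n$. Suppose that under $P$ the law of $\pi_n$, for every $n=1,2,\dots$, is uniform conditionally given the value of a statistic $\mathrm{stat}$. Then the following assertions are true: (i) for $\mathrm{stat}=\ell$, the distribution $P$ is a unique mixture of $P^{(\theta,1)}$ $(\theta\in[0,\infty))$ and $P^{(1\infty,0\infty)}$; (ii) for $\mathrm{stat}=u$, the distribution $P$ is a unique mixture of $P^{(1,\zeta)}$ $(\zeta\in[0,\infty))$ and $P^{(0\infty,1\infty)}$; (iii) for $\mathrm{stat}=\ell+u$, the distribution $P$ is a unique mixture of $P^{(\theta,\theta)}$ $(\theta\in(0,\infty))$, $P^{(\frac12 0,\frac12 0)}$ and $P^{(\frac12\infty,\frac12\infty)}$; (iv) for $\mathrm{stat}=(\ell,u)$, the distribution $P$ is a unique mixture of the nondegenerate distributions $P^{(\theta,\zeta)}$ $(\theta,\zeta\in(0,\infty))$, the degenerate distributions $P^{(\theta,0)}$ and $P^{(0,\zeta)}$ $(\theta,\zeta\in(0,\infty))$, and the further degenerate distributions $P^{(1\cdot0,0\cdot0)}$, $P^{(0\cdot0,1\cdot0)}$ and $P^{(p\infty,(1-p)\infty)}$ $(p\in[0,1])$. The degenerate distributions do not enter the mixture provided $P_3>0$, that is, provided $P_3(\pi_3)>0$ for every $\pi_3\in\mathfrak S_3$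.
   Context: Permutations of $[n]=\{1,\dots,n\}$ are written $\pi_n=(\pi_{n1},\dots,\pi_{nn})$, and $\mathfrak S_n$ is the set of all of them. The entry $\pi_{nj}$ is a lower record if $\pi_{nj}=\min(\pi_{n1},\dots,\pi_{nj})$ and an upper record if $\pi_{nj}=\max(\pi_{n1},\dots,\pi_{nj})$; records with $j\ge2$ are called proper. A sequence $(\pi_n)_{n\ge1}$ with $\pi_n\in\mathfrak S_n$ is coherent if for all $m\le n$ the ranking permutation of $(\pi_{n1},\dots,\pi_{nm})$ (each entry replaced by its rank in increasing order) is $\pi_m$. $\mathfrak S^\infty$ is the space of all coherent sequences (the projective limit of the $\mathfrak S_n$). The initial rank $i_j\in\{1,\dots,j\}$ is the rank in increasing order of $\pi_{nj}$ among $\pi_{n1},\dots,\pi_{nj}$ (for any $n\ge j$). The map $(\pi_n)\mapsto(i_1,i_2,\dots)$ identifies $\mathfrak S^\infty$ with $[1]\times[2]\times\cdots$, endowed with the product topology and Borel $\sigma$-algebra. ''Uniform conditionally given the value of $\mathrm{stat}$'' means that any two permutations in $\mathfrak S_n$ with the same value of $\mathrm{stat}$ have the same probability. ''Unique mixture'' of a listed family means that there is a unique probability measure on the index set of the family such that $P$ is the integral of the members of the family with respect to it. All distributions below make $i_1,i_2,\dots$ independent, with $i_1=1$. - For $\theta,\zeta\ge0$ not both zero, $P^{(\theta,\zeta)}$: for $j\ge2$, $i_j=1$ with probability $\theta/(\theta+\zeta+j-2)$, $i_j=j$ with probability $\zeta/(\theta+\zeta+j-2)$, and $i_j=r$ with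 probability $1/(\theta+\zeta+j-2)$ for each $r=2,\dots,j-1$. - For $p\in[0,1]$, $P^{(p\infty,(1-p)\infty)}$: for $j\ge2$, $i_j=1$ with probability $p$ and $i_j=j$ with probability $1-p$. - For $p\in[0,1]$, $P^{(p0,(1-p)0)}$ (also written $P^{(p\cdot0,(1-p)\cdot0)}$): $i_2=1$ with probability $p$ and $i_2=2$ with probability $1-p$; for $j\ge3$, $i_j$ is uniform on $\{2,\dots,j-1\}$. A distribution $P$ on $\mathfrak S^\infty$ is degenerate if $P_n(\pi_n)=0$ for some $n$ and some $\pi_n\in\mathfrak S_n$; otherwise it is nondegenerate.
   Formalization: In (iv), the last sentence is false for P itself (e.g. ½P^{(1,1)}+½P^{(1∞,0∞)} has P_3>0); instead, positivity of the law of π_3 is required of almost every member of the mixture, and then the degenerate distributions have mixing mass 0. *)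

(* Defs.v *)
From HB Require Import structures.
From mathcomp Require Import all_boot all_order all_fingroup all_algebra.
From mathcomp Require Import all_classical all_reals all_analysis.

Set Implicit Arguments.
Unset Strict Implicit.
Unset Printing Implicit Defensive.
Import Order.TTheory GRing.Theory Num.Theory.
Import numFieldNormedType.Exports.

Local Open Scope classical_set_scope.
Local Open Scope ring_scope.

(* Positions and entries of s : 'S_n are 0-based: s j is the (j+1)-st entry
   minus 1.  "Proper" means that the position is not the first one. *)
Definition proper_lower_records n (s : 'S_n) : nat :=
  #|[pred j : 'I_n | (0 < j)%N && [forall k : 'I_n, (k <= j)%N ==> (s j <= s k)%N]]|.

Definition proper_upper_records n (s : 'S_n) : nat :=
  #|[pred j : 'I_n | (0 < j)%N && [forall k : 'I_n, (k <= j)%N ==> (s k <= s j)%N]]|.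

(* The 0-based rank of the j-th entry among the first m entries of pi n is the
   number of smaller ones; the term pi 0 is the only element of 'S_0 and carries
   no information. *)
Definition is_coherent (pi : forall n, 'S_n) : Prop :=
  forall (m n : nat) (le_mn : (m <= n)%N) (j : 'I_m),
    #|[pred k : 'I_m | (pi n (widen_ord le_mn k) < pi n (widen_ord le_mn j))%N]|
    = pi m j.

Record coherent_perm := CoherentPerm {
  perm_at :> forall n, 'S_n;
  perm_at_coherent : is_coherent perm_at }.

Lemma is_coherent1 : is_coherent (fun n => 1%g : 'S_n).
Proof.
move=> m n le_mn j; rewrite [in RHS]perm1.
have le_jm : (j <= m)%N by exact: ltnW.
have inj_w : injective (widen_ord le_jm).
  by move=> i k /(congr1 val) /= /val_inj.
rewrite -[RHS]card_ord -(card_codom inj_w).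
apply: eq_card => k; rewrite !inE !perm1 /=.
apply/idP/codomP => [kj|[i ->] /=]; last exact: ltn_ord.
by exists (Ordinal kj); apply: val_inj.
Qed.

HB.instance Definition _ := gen_eqMixin coherent_perm.
HB.instance Definition _ := gen_choiceMixin coherent_perm.
HB.instance Definition _ :=
  isPointed.Build coherent_perm (CoherentPerm is_coherent1).

(* [initial_rank pi j] is i_(j+1), with values in 1, .., j+1. *)
Definition initial_rank (pi : coherent_perm) (j : nat) : nat :=
  #|[pred k : 'I_j.+1 | (pi j.+1 k <= pi j.+1 ord_max)%N]|.

(* The initial ranks are coordinates identifying coherent_perm with the product
   of the finite sets [1], [2], ..; the sigma-algebra they generate is the Borel
   sigma-algebra of the product topology. *)
Definition rank_cylinders : set (set coherent_perm) :=
  [set A | exists j r, A = [set pi | initial_rank pi j = r]].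

HB.instance Definition _ :=
  Measurable.copy coherent_perm (g_sigma_algebraType rank_cylinders).

Definition perm_law (R : realType) (P : probability coherent_perm R)
    (n : nat) (s : 'S_n) : \bar R :=
  P [set pi : coherent_perm | pi n = s].

Definition conditionally_uniform (R : realType)
    (P : probability coherent_perm R) (T : Type) (stat : forall n, 'S_n -> T)
    : Prop :=
  forall n (s t : 'S_n), stat n s = stat n t -> perm_law P s = perm_law P t.

Definition degenerate (R : realType) (P : probability coherent_perm R) : Prop :=
  exists n, exists s : 'S_n, perm_law P s = 0%E.

(* The parameters of the distributions: (Finite, (a, b)) stands for the
   superscript (a, b), (Zero, (a, b)) for (a 0, b 0) and (Infinite, (a, b)) for
   (a oo, b oo); in the last two cases a + b = 1. *)
Variant regime := Finite | Zero | Infinite.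

HB.instance Definition _ := gen_eqMixin regime.
HB.instance Definition _ := gen_choiceMixin regime.
HB.instance Definition _ := isPointed.Build regime Finite.
HB.instance Definition _ := @isMeasurable.Build default_measure_display
  regime discrete_measurable discrete_measurable0
  discrete_measurableC discrete_measurableU.

(* The index sets below are Borel subsets of this space, regime being discrete;
   they carry the trace of its sigma-algebra. *)
Definition record_param (R : realType) : Type :=
  (regime * (measurableTypeR R * measurableTypeR R))%type.

(* The probability that i_j = r, for j >= 1. *)
Definition rank_prob (R : realType) (x : record_param R) (j r : nat) : R :=
  let: (t, (a, b)) := x in
  if (j <= 1)%N then (r == 1%N)%:R else
  match t with
  | Finite =>
      (if r == 1%N then a else if r == j then b else (1 < r < j)%N%:R)
      / (a + b + (j - 2)%N%:R)
  | Zero =>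
      if j == 2%N then
        (if r == 1%N then a else if r == 2%N then b else 0)
      else (1 < r < j)%N%:R / (j - 2)%N%:R
  | Infinite =>
      if r == 1%N then a else if r == j then b else 0
  end.

Definition independent_ranks (R : realType)
    (P : probability coherent_perm R) : Prop :=
  forall (n : nat) (B : nat -> set nat),
    P [set pi | forall j, (j < n)%N -> B j (initial_rank pi j)]
    = (\prod_(j < n) P [set pi | B j (initial_rank pi j)])%E.

(* [record_distribution x P]: P is the distribution with superscript x. *)
Definition record_distribution (R : realType) (x : record_param R)
    (P : probability coherent_perm R) : Prop :=
  independent_ranks P /\
  forall j r, P [set pi | initial_rank pi j = r] = (rank_prob x j.+1 r)%:E.

(* A probability measure on the index set D is a probability measure on
   record_param R carried by D.  For x in D the distribution M x is determined
   by x, its values on finite-dimensional events being prescribed. *)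
Definition mixing_measure (R : realType) (P : probability coherent_perm R)
    (D : set (record_param R)) (mu : probability (record_param R) R) : Prop :=
  mu D = 1%E /\
  exists M : record_param R -> probability coherent_perm R,
    (forall x, D x -> record_distribution x (M x)) /\
    (forall A, measurable A -> P A = \int[mu]_(x in D) M x A)%E.

Definition unique_mixture (R : realType) (P : probability coherent_perm R)
    (D : set (record_param R)) : Prop :=
  exists mu, mixing_measure P D mu /\
    forall nu, mixing_measure P D nu ->
      forall A, measurable A -> nu A = mu A.

Definition lower_family (R : realType) : set (record_param R) :=
  [set (Finite, (a, 1)) | a in `[0, +oo[ ] `|` [set (Infinite, (1, 0))].

Definition upper_family (R : realType) : set (record_param R) :=
  [set (Finite, (1, b)) | b in `[0, +oo[ ] `|` [set (Infinite, (0, 1))].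

Definition total_family (R : realType) : set (record_param R) :=
  [set (Finite, (a, a)) | a in `]0, +oo[ ]
  `|` [set (Zero, (2^-1, 2^-1))] `|` [set (Infinite, (2^-1, 2^-1))].

Definition nondegenerate_family (R : realType) : set (record_param R) :=
  [set (Finite, (a, b)) | a in `]0, +oo[ & b in `]0, +oo[ ].

Definition degenerate_family (R : realType) : set (record_param R) :=
  [set (Finite, (a, 0)) | a in `]0, +oo[ ]
  `|` [set (Finite, (0, b)) | b in `]0, +oo[ ]
  `|` [set (Zero, (1, 0))] `|` [set (Zero, (0, 1))]
  `|` [set (Infinite, (p, 1 - p)) | p in `[0, 1] ].

Definition positive_law3 (R : realType) (P : probability coherent_perm R) : Prop :=
  forall s : 'S_3, (0 < perm_law P s)%E.

Arguments lower_family R : clear implicits.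
Arguments upper_family R : clear implicits.
Arguments total_family R : clear implicits.
Arguments nondegenerate_family R : clear implicits.
Arguments degenerate_family R : clear implicits.

(* Main.v *)
(* A position is a lower record, an upper record or of neither type.  Under the
   hypotheses the types are exchangeable once each position is weighted by the
   inverse of the number of ranks of its type there.  Let S^c(N) be the weighted
   number of positions of type c below N.  Interchanging the types of a fixed
   position i and of a later one, and summing over the latter, gives
     E[1(i_i = r) S^c'(N) g] ~ E[1(i_i = s) S^c(N) g]
   for ranks r, s of types c, c' at i and bounded slowly varying g.  Divided by
   their sum, which is at least a harmonic sum, the S^c(N) are therefore Cauchy in
   L^2, at a rate that does not depend on the law, and the identity passes to the
   limit: conditionally on the limiting frequencies the ranks are independent and
   distributed as in the member of the family with parameters proportional to
   these frequencies.  The mixing measure is the law of this random parameter.  It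
   is unique because, under each member of the family, the random parameter equals
   the parameter of that member almost surely. *)

From HB Require Import structures.
Require Import Defs.
From mathcomp Require Import all_boot all_order all_fingroup all_algebra.
From mathcomp Require Import all_classical all_reals all_analysis.
From mathcomp Require Import measurable_realfun.
From mathcomp Require Import zify ring lra.

Set Implicit Arguments.
Unset Strict Implicit.
Unset Printing Implicit Defensive.
Import Order.TTheory GRing.Theory Num.Theory.
Import numFieldNormedType.Exports.

(** * Permutations and initial ranks *)

(** Two positions, counted from 0, are exceptional. At position 2 the ranks are 1, 2 and 3, one of
    each type, so no normalization occurs and the indicator of a rank is compared with a frequency
    directly. Testing this comparison against the difference of two frequencies bounds its L^2 norm;
    the same position yields the limiting frequencies under a member. At position 1 there is no rank
    of the third type. One has to divide by the sum of the two record frequencies, which may vanish: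
    this is the origin of the zero regime, where the frequencies are (0, 0, 1) and say nothing about
    the second rank. On that event the second rank is described by an extra pair, either the
    observed rank itself or (1/2, 1/2) when symmetry forces it. The infinite regime arises when the
    third type has frequency 0. Exchange is exact only against factors that ignore both positions.
    Functions of the frequencies move by O(1 / log N) when one rank changes, so the two coordinates
    are frozen and this error is paid. Almost sure convergence is taken along levels where the
    harmonic sum reaches 8^k, which makes the errors summable. *)

Definition perm_nat n (s : 'S_n) (k : nat) : nat :=
  oapp (fun i : 'I_n => val (s i)) 0%N (insub k).

Lemma perm_natE n (s : 'S_n) (i : 'I_n) : perm_nat s i = s i.
Proof. by rewrite /perm_nat valK. Qed.

Lemma perm_nat_inj n (s : 'S_n) k l :
  (k < n)%N -> (l < n)%N -> perm_nat s k = perm_nat s l -> k = l.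
Proof.
move=> kn ln; rewrite (perm_natE s (Ordinal kn)) (perm_natE s (Ordinal ln)).
by move=> /val_inj /perm_inj [].
Qed.

Definition rank_at (f : nat -> nat) (j : nat) : nat :=
  count (fun k => f k <= f j)%N (iota 0 j.+1).

Lemma iota_last m n : iota m n.+1 = rcons (iota m n) (m + n)%N.
Proof. by rewrite -addn1 iotaD cats1. Qed.

Lemma rank_at_bounds f j : (0 < rank_at f j <= j.+1)%N.
Proof.
rewrite /rank_at; apply/andP; split; last first.
  by apply: leq_trans (count_size _ _) _; rewrite size_iota.
by rewrite -has_count; apply/hasP; exists j; rewrite ?mem_iota ?leqnn.
Qed.

(* By induction: for k < n one has f k < f n iff at most rank_at f n - 1 of the
   first n values are <= f k. *)
Lemma rank_at_order n (f g : nat -> nat) :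
  {in gtn n &, injective f} -> {in gtn n &, injective g} ->
  (forall j, (j < n)%N -> rank_at f j = rank_at g j) ->
  forall k l, (k < n)%N -> (l < n)%N -> (f k < f l)%N = (g k < g l)%N.
Proof.
elim: n => [//|n IHn] finj ginj fg.
have sub k : (k < n)%N -> (k < n.+1)%N by move=> /ltnW.
have {}IHn : forall k l, (k < n)%N -> (l < n)%N -> (f k < f l)%N = (g k < g l)%N.
  apply: IHn => [x y xn yn|x y xn yn|j jn]; last by apply: fg; exact: sub.
  - by apply: finj; apply: sub.
  - by apply: ginj; apply: sub.
have key (h : nat -> nat) : {in gtn n.+1 &, injective h} -> forall k, (k < n)%N ->
    (h k < h n)%N = (count (fun l => h l <= h k)%N (iota 0 n) < rank_at h n)%N.
  move=> hinj k kn; rewrite /rank_at iota_last add0n -cats1 count_cat /= leqnn addn0 addn1 ltnS.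
  have E : count (fun l => h l <= h n)%N (iota 0 n)
        = count (fun l => h l < h n)%N (iota 0 n).
    apply: eq_in_count => l; rewrite mem_iota add0n => /andP[_ ln].
    rewrite ltn_neqAle; case: eqP => //= e.
    by have := hinj l n (sub _ ln) (ltnSn n) e; lia.
  rewrite E; apply/idP/idP => [hkn|].
    by apply: sub_count => l /= /leq_ltn_trans; exact.
  apply: contraTT; rewrite -leqNgt -ltnNge leq_eqVlt => /orP[/eqP e|hnk].
    by have := hinj n k (ltnSn n) (sub _ kn) e; lia.
  rewrite -2!sum1_count.
  (* The index [k] is counted on the larger side only, which makes the inequality strict. *)
  have kI : k \in iota 0 n by rewrite mem_iota.
  rewrite [X in (_ < X)%N](big_rem k) //= leqnn add1n ltnS.
  rewrite [X in (X <= _)%N](big_rem k) //= (_ : (h k < h n)%N = false) ?add0n; last by lia.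
  rewrite !sum1_count; apply: sub_count => l /= hln.
  exact: ltnW (ltn_trans hln hnk).
have fn k : (k < n)%N -> (f k < f n)%N = (g k < g n)%N.
  move=> kn; rewrite key // key // fg //; congr (_ < _)%N.
  apply: eq_in_count => l; rewrite mem_iota add0n => /andP[_ ln].
  by rewrite leqNgt IHn // -leqNgt.
have nf k : (k < n)%N -> (f n < f k)%N = (g n < g k)%N.
  move=> kn.
  have flip (h : nat -> nat) : {in gtn n.+1 &, injective h} ->
      (h n < h k)%N = ~~ (h k < h n)%N.
    move=> hinj; rewrite -leqNgt ltn_neqAle; case: eqP => //= e.
    by have := hinj n k (ltnSn n) (sub _ kn) e; lia.
  by rewrite flip // fn // -flip.
move=> k l; rewrite !ltnS [(k <= n)%N]leq_eqVlt [(l <= n)%N]leq_eqVlt.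
move=> /orP[/eqP->|kn] /orP[/eqP->|ln]; rewrite ?ltnn //; [exact: nf|exact: fn|exact: IHn].
Qed.

Definition perm_rank n (s : 'S_n) : nat -> nat := rank_at (perm_nat s).

Lemma perm_card_pred n (s : 'S_n) (p : pred 'I_n) : #|[pred k | p (s k)]| = #|p|.
Proof.
rewrite -(card_imset _ (@perm_inj _ s)); apply: eq_card => k.
apply/imsetP/idP => [[i + ->]|pk]; first by rewrite inE.
by exists (s^-1%g k); rewrite ?inE permKV.
Qed.

Lemma perm_card_lt n (s : 'S_n) (j : 'I_n) : #|[pred k : 'I_n | (s k < s j)%N]| = s j.
Proof.
rewrite (perm_card_pred s [pred k : 'I_n | (k < s j)%N]) -[RHS]card_ord.
have lej : (s j <= n)%N by exact: ltnW.
rewrite -(card_codom (f := widen_ord lej)); last by move=> i k /(congr1 val) /= /val_inj.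
apply: eq_card => k; rewrite !inE; apply/idP/codomP => [kj|[i ->] /=]; last exact: ltn_ord.
by exists (Ordinal kj); apply: val_inj.
Qed.

Lemma perm_nat_injin n (s : 'S_n) : {in gtn n &, injective (perm_nat s)}.
Proof. by move=> k l kn ln; apply: perm_nat_inj. Qed.

(** An entry equals the number of smaller entries, hence depends only on the relative order, which
    the ranks determine. *)
Lemma perm_rank_inj n (s t : 'S_n) :
  (forall j, (j < n)%N -> perm_rank s j = perm_rank t j) -> s = t.
Proof.
move=> st; apply/permP => j; apply: val_inj; rewrite /= -[LHS]perm_card_lt -[RHS]perm_card_lt.
apply: eq_card => k; rewrite !inE -!perm_natE.
by apply: (@rank_at_order n) => //; apply: perm_nat_injin.
Qed.

(** By coherence the entries of [pi m] are the sizes of lower sets for the order given by [pi n],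
    and such sets are nested. *)
Lemma coherent_lt (pi : coherent_perm) m n (mn : (m <= n)%N) (k l : 'I_m) :
  (pi m k < pi m l)%N = (pi n (widen_ord mn k) < pi n (widen_ord mn l))%N.
Proof.
have c := @perm_at_coherent pi m n mn.
apply/idP/idP => [|kl].
  apply: contraTT; rewrite -!leqNgt => lk; rewrite -!c.
  by apply: subset_leq_card; apply/fintype.subsetP => i; rewrite !inE => /leq_trans; apply.
rewrite -!c; apply: proper_card; apply/properP; split.
  by apply/fintype.subsetP => i; rewrite !inE => /ltn_trans; apply.
by exists k; rewrite !inE ?ltnn.
Qed.

Lemma count_ord n (p : pred nat) : count p (iota 0 n) = #|[pred k : 'I_n | p k]|.
Proof. by rewrite cardE size_filter -enumT /= -val_enum_ord count_map. Qed.

Lemma initial_rankE (pi : coherent_perm) n j : (j < n)%N ->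
  initial_rank pi j = perm_rank (pi n) j.
Proof.
move=> jn; rewrite /initial_rank /perm_rank /rank_at count_ord.
apply: eq_card => k; rewrite !inE.
have -> : val k = widen_ord jn k by [].
rewrite (perm_natE (pi n) (widen_ord jn k)).
have -> : perm_nat (pi n) j = pi n (widen_ord jn ord_max).
  by rewrite -perm_natE.
by rewrite leqNgt (coherent_lt pi jn) -leqNgt.
Qed.

Lemma initial_rank_bounds (pi : coherent_perm) j : (0 < initial_rank pi j <= j.+1)%N.
Proof. by rewrite (@initial_rankE pi j.+1) // rank_at_bounds. Qed.

(** Inverse of the coding by ranks: the last entry gets the 0-based value [(w n').-1], and earlier
    entries at least that large are shifted up by one. Values out of range are absorbed by [inord],
    so every [w] is accepted. *)
Fixpoint rank_perm (w : nat -> nat) (n : nat) : 'S_n :=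
  match n with
  | 0 => 1%g
  | n'.+1 => lift_perm ord_max (inord (w n').-1) (rank_perm w n')
  end.

Lemma lift_lt n (h : 'I_n.+1) (k l : 'I_n) : (lift h k < lift h l)%N = (k < l)%N.
Proof. rewrite /= /bump; lia. Qed.

Lemma rank_perm_lt w m n (mn : (m <= n)%N) (k l : 'I_m) :
  (rank_perm w n (widen_ord mn k) < rank_perm w n (widen_ord mn l))%N
  = (rank_perm w m k < rank_perm w m l)%N.
Proof.
elim: n mn => [|n IHn] mn.
  by have := ltn_ord k; lia.
have [mn'|] := leqP m n; last first.
  move=> nm; have e : m = n.+1 by lia.
  by subst m; congr (_ < _)%N; congr (val (fun_of_perm _ _)); apply: val_inj.
have w1 i : widen_ord mn i = lift ord_max (widen_ord mn' i).
  by apply: val_inj; rewrite /= /bump leqNgt (leq_trans (ltn_ord i)).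
by rewrite !w1 /= !lift_perm_lift lift_lt IHn.
Qed.

Lemma rank_perm_coherent w : is_coherent (rank_perm w).
Proof.
move=> m n mn j; rewrite -[RHS]perm_card_lt.
by apply: eq_card => k; rewrite !inE rank_perm_lt.
Qed.

Definition coherent_of_ranks (w : nat -> nat) : coherent_perm :=
  CoherentPerm (rank_perm_coherent w).

Lemma initial_rank_of_ranks w j : (0 < w j <= j.+1)%N ->
  initial_rank (coherent_of_ranks w) j = w j.
Proof.
move=> /andP[w0 wj]; rewrite /initial_rank /= lift_perm_id inordK; last by lia.
rewrite (perm_card_pred (rank_perm w j.+1) [pred k : 'I_j.+1 | (k <= (w j).-1)%N]).
rewrite -(count_ord j.+1 (fun k => k <= (w j).-1)%N) -[j.+1](subnKC wj) iotaD count_cat /=.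
rewrite (@eq_in_count _ _ xpredT) ?count_predT ?size_iota; last first.
  by move=> i; rewrite mem_iota; lia.
rewrite (@eq_in_count _ _ xpred0) ?count_pred0 ?addn0 //.
by move=> i; rewrite mem_iota; lia.
Qed.

(** This turns the event of a prescribed [pi n] into a cylinder of initial ranks, the form in which
    laws are computed. *)
Lemma perm_at_eq (pi : coherent_perm) n (s : 'S_n) :
  pi n = s <-> forall j, (j < n)%N -> initial_rank pi j = perm_rank s j.
Proof.
split=> [<- j jn|H]; first exact: initial_rankE.
by apply: perm_rank_inj => j jn; rewrite -initial_rankE ?H.
Qed.

(** Lower records are the positions of rank 1 and upper records those of maximal rank, so both
    counts are functions of the ranks, position by position. *)
Lemma proper_lower_recordsE n (s : 'S_n) :
  proper_lower_records s = count (fun j => (0 < j)%N && (perm_rank s j == 1)%N) (iota 0 n).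
Proof.
rewrite count_ord; apply: eq_card => j; rewrite !inE; congr (_ && _).
rewrite /perm_rank /rank_at iota_last -cats1 count_cat /= leqnn !addn0 addn1 eqSS.
rewrite -leqn0 leqNgt -has_count; apply/forallP/hasPn => [H k|H k].
  rewrite mem_iota add0n => /andP[_ kj].
  have kn := ltn_trans kj (ltn_ord j).
  have := H (Ordinal kn); rewrite /= ltnW //= -2!(perm_natE s) /= -ltnNge ltn_neqAle => ->.
  rewrite andbT; apply/eqP => /perm_nat_inj e.
  by have := e (ltn_ord j) kn; lia.
apply/implyP; rewrite leq_eqVlt => /orP[/eqP kj|kj]; first by have/val_inj -> := kj.
have := H (val k); rewrite mem_iota add0n => /(_ kj); rewrite -ltnNge.
by rewrite -2!(perm_natE s) => /ltnW.
Qed.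

Lemma proper_upper_recordsE n (s : 'S_n) :
  proper_upper_records s = count (fun j => (0 < j)%N && (perm_rank s j == j.+1)%N) (iota 0 n).
Proof.
rewrite count_ord; apply: eq_card => j; rewrite !inE; congr (_ && _).
rewrite /perm_rank /rank_at -[X in _ == X](size_iota 0 j.+1) -all_count.
apply/forallP/allP => [H k|H k].
  rewrite mem_iota add0n => /andP[_ kj].
  have kn : (k < n)%N by have := ltn_ord j; lia.
  by have := H (Ordinal kn); rewrite /= -ltnS kj /= -2!(perm_natE s).
apply/implyP => kj.
by have := H (val k); rewrite mem_iota add0n ltnS => /(_ kj); rewrite -2!(perm_natE s).
Qed.

Local Open Scope classical_set_scope.
Local Open Scope ring_scope.

(** * Expectations of bounded functions *)

Section BoundedExpectation.
Context d (T : measurableType d) (R : realType) (P : probability T R).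

(** Boundedness is included so that integrability under a probability is automatic; the class is
    stable under the algebraic operations used below. *)
Definition bmeas (f : T -> R) :=
  measurable_fun [set: T] f /\ exists C, forall x, `|f x| <= C.

Definition Ex (f : T -> R) : R := \int[P]_x f x.

Lemma bmeas_cst c : bmeas (fun=> c).
Proof. by split; [exact: measurable_cst|exists `|c|]. Qed.

Lemma bmeasD f g : bmeas f -> bmeas g -> bmeas (fun x => f x + g x).
Proof.
move=> [mf [C fC]] [mg [D gD]]; split; first exact: measurable_funD.
by exists (C + D) => x; rewrite (le_trans (ler_normD _ _)) ?lerD.
Qed.

Lemma bmeasM f g : bmeas f -> bmeas g -> bmeas (fun x => f x * g x).
Proof.
move=> [mf [C fC]] [mg [D gD]]; split; first exact: measurable_funM.
by exists (C * D) => x; rewrite normrM ler_pM.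
Qed.

Lemma bmeasZ c f : bmeas f -> bmeas (fun x => c * f x).
Proof. exact/bmeasM/bmeas_cst. Qed.

Lemma bmeasB f g : bmeas f -> bmeas g -> bmeas (fun x => f x - g x).
Proof.
move=> bf bg; rewrite (_ : (fun x => _) = fun x => f x + (-1) * g x).
  exact/bmeasD/bmeasZ.
by apply/funext => x; rewrite mulN1r.
Qed.

Lemma bmeas_sum I (r : seq I) (p : pred I) (f : I -> T -> R) :
  (forall i, p i -> bmeas (f i)) -> bmeas (fun x => \sum_(i <- r | p i) f i x).
Proof.
move=> bf; elim: r => [|i r IHr].
  by under eq_fun do rewrite big_nil; exact: bmeas_cst.
case pi : (p i); under eq_fun do rewrite big_cons pi; last exact: IHr.
exact/bmeasD/IHr/bf.
Qed.

Lemma bmeas_prod I (r : seq I) (p : pred I) (f : I -> T -> R) :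
  (forall i, p i -> bmeas (f i)) -> bmeas (fun x => \prod_(i <- r | p i) f i x).
Proof.
move=> bf; elim: r => [|i r IHr].
  by under eq_fun do rewrite big_nil; exact: bmeas_cst.
case pi : (p i); under eq_fun do rewrite big_cons pi; last exact: IHr.
exact/bmeasM/IHr/bf.
Qed.

Lemma bmeas_indic (A : set T) : measurable A -> bmeas \1_A.
Proof.
move=> mA; split; first exact: measurable_indic.
by exists 1 => x; rewrite indicE; case: (x \in A); rewrite /= ?normr1 ?normr0.
Qed.

Lemma bmeas_norm f : bmeas f -> bmeas (fun x => `|f x|).
Proof.
move=> [mf [C fC]]; split; first exact: measurableT_comp.
by exists C => x; rewrite normr_id.
Qed.

Lemma bmeas_integrable f : bmeas f -> P.-integrable [set: T] (EFin \o f).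
Proof.
move=> [mf [C fC]]; apply: measurable_bounded_integrable => //.
  by rewrite [X in (X < _)%E](probability_setT P) ltry.
by exists C; split; [rewrite num_real|move=> M CM x _; exact: le_trans (ltW CM)].
Qed.

Lemma Ex_EFin f : bmeas f -> (\int[P]_x (f x)%:E)%E = (Ex f)%:E.
Proof.
move=> bf; rewrite /Ex /Rintegral fineK //.
by apply: integrable_fin_num => //; exact: bmeas_integrable.
Qed.

Lemma Ex_cst c : Ex (fun=> c) = c.
Proof. by rewrite /Ex Rintegral_cst // [X in fine X](probability_setT P) mulr1. Qed.

Lemma ExD f g : bmeas f -> bmeas g -> Ex (fun x => f x + g x) = Ex f + Ex g.
Proof. by move=> bf bg; rewrite /Ex RintegralD //; exact: bmeas_integrable. Qed.

Lemma ExB f g : bmeas f -> bmeas g -> Ex (fun x => f x - g x) = Ex f - Ex g.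
Proof. by move=> bf bg; rewrite /Ex RintegralB //; exact: bmeas_integrable. Qed.

Lemma ExZ c f : bmeas f -> Ex (fun x => c * f x) = c * Ex f.
Proof. by move=> bf; rewrite /Ex RintegralZl //; exact: bmeas_integrable. Qed.

Lemma Ex_sum I (r : seq I) (p : pred I) (f : I -> T -> R) :
  (forall i, p i -> bmeas (f i)) ->
  Ex (fun x => \sum_(i <- r | p i) f i x) = \sum_(i <- r | p i) Ex (f i).
Proof.
move=> bf; elim: r => [|i r IHr].
  by under eq_fun do rewrite big_nil; rewrite Ex_cst big_nil.
rewrite big_cons; case pi : (p i); under eq_fun do rewrite big_cons pi; last exact: IHr.
by rewrite ExD ?IHr //; [exact: bf|exact: bmeas_sum].
Qed.

Lemma Ex_le f g : bmeas f -> bmeas g -> (forall x, f x <= g x) -> Ex f <= Ex g.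
Proof. by move=> bf bg fg; apply: le_Rintegral => //; exact: bmeas_integrable. Qed.

Lemma Ex_norm_le f g : bmeas f -> bmeas g -> (forall x, `|f x| <= g x) ->
  `|Ex f| <= Ex g.
Proof.
move=> bf bg fg; apply: le_trans (le_normr_Rintegral _ (bmeas_integrable bf)) _ => //.
by apply: Ex_le => //; exact: bmeas_norm.
Qed.

Lemma Ex_indic (A : set T) : measurable A -> (Ex \1_A)%:E = P A.
Proof. by move=> mA; rewrite -Ex_EFin ?integral_indic ?setIT //; exact: bmeas_indic. Qed.

Lemma Ex_ae f g : bmeas f -> bmeas g -> {ae P, forall x, f x = g x} -> Ex f = Ex g.
Proof.
move=> [mf _] [mg _] fg; congr fine; apply: ae_eq_integral => //.
- exact/measurable_EFinP.
- exact/measurable_EFinP.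
- by apply: filterS fg => x -> _.
Qed.

Lemma Ex_bounded_cvg (F : nat -> T -> R) f C : (forall n, bmeas (F n)) -> bmeas f ->
  (forall n x, `|F n x| <= C) -> {ae P, forall x, F n x @[n --> \oo] --> f x} ->
  Ex (F n) @[n --> \oo] --> Ex f.
Proof.
move=> bF bf FC Ff.
have [] := @dominated_convergence _ T R P setT measurableT
  (fun n x => (F n x)%:E) (fun x => (f x)%:E) (cst C%:E).
- by move=> n; apply/measurable_EFinP; case: (bF n).
- by apply/measurable_EFinP; case: bf.
- by apply: filterS Ff => x Fx _; apply: cvg_EFin => //; exact: nearW.
- exact: (bmeas_integrable (bmeas_cst C)).
- by apply: aeW => x n _; rewrite /= lee_fin.
by move=> _ _; rewrite Ex_EFin // => /fine_cvgP[].
Qed.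

Lemma Ex_sq_eq0 f : bmeas f -> Ex (fun x => f x ^+ 2) = 0 -> {ae P, forall x, f x = 0}.
Proof.
move=> bf Ef0; have bf2 : bmeas (fun x => f x ^+ 2) by under eq_fun do rewrite expr2; exact: bmeasM.
have mf2 : measurable_fun [set: T] (fun x => (f x ^+ 2)%:E).
  by apply/measurable_EFinP; case: bf2.
have /(ae_eq_integral_abs _ measurableT mf2) : (\int[P]_x `|(f x ^+ 2)%:E| = 0)%E.
  under eq_integral do rewrite gee0_abs ?lee_fin ?sqr_ge0 //.
  by rewrite Ex_EFin // Ef0.
by apply: filterS => x /(_ Logic.I) [] /eqP; rewrite sqrf_eq0 => /eqP.
Qed.

(* |g| <= 2^-k + 2^k g^2, so sum_k E|g_k| is finite. *)
Lemma ae_cvg_series (g : nat -> T -> R) (K : R) : (forall k, bmeas (g k)) ->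
  (forall k, Ex (fun x => g k x ^+ 2) <= K / 8 ^+ k) ->
  {ae P, forall x, cvgn (series (fun k => g k x))}.
Proof.
move=> bg gK.
have bn k := bmeas_norm (bg k).
have bg2 k : bmeas (fun x => g k x ^+ 2) by under eq_fun do rewrite expr2; exact: bmeasM.
have E1 k : Ex (fun x => `|g k x|) <= (1 + K) / 2 ^+ k.
  have p2 : 0 < 2 ^+ k :> R by rewrite exprn_gt0.
  apply: (@le_trans _ _ (Ex (fun x => (2 ^+ k)^-1 + 2 ^+ k * g k x ^+ 2))).
    apply: Ex_le => //; first by apply: bmeasD; [exact: bmeas_cst|exact: bmeasZ].
    move=> x; rewrite -[g k x ^+ 2]real_normK ?num_real //.
    set t := `|g k x|; have t0 : 0 <= t by exact: normr_ge0.
    set u := 2 ^+ k in p2 *; rewrite -subr_ge0.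
    have -> : u^-1 + u * t ^+ 2 - t = u^-1 * ((u * t - 2^-1) ^+ 2 + 3 / 4).
      by field; rewrite gt_eqF.
    by rewrite mulr_ge0 ?invr_ge0 ?(ltW p2) // addr_ge0 ?sqr_ge0 // divr_ge0.
  rewrite ExD ?Ex_cst ?ExZ //; last 2 first.
  - exact: bmeas_cst.
  - exact: bmeasZ.
  rewrite mulrDl mul1r lerD2l; apply: le_trans (ler_wpM2l (ltW p2) (gK k)) _.
  have -> : 8 ^+ k = (2 ^+ k) ^+ 3 :> R.
    by rewrite [RHS]exprAC; congr (_ ^+ k); ring.
  set u := 2 ^+ k in p2 *; rewrite (_ : u * (K / u ^+ 3) = u^-1 * (K / u)); last first.
    by field; rewrite gt_eqF.
  rewrite [leRHS]mulrC ler_wpM2l ?invr_ge0 ?(ltW p2) //.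
  have K0 : 0 <= K.
    have := gK 0%N; rewrite expr0 divr1; apply: le_trans.
    by apply: Rintegral_ge0 => x _; exact: sqr_ge0.
  rewrite ler_pdivrMr // ler_peMr // -[leLHS](expr1n _ k).
  by rewrite lerXn2r ?nnegrE ?ler1n.
have mn k : measurable_fun [set: T] (fun x => `|g k x|%:E).
  by apply/measurable_EFinP; case: (bn k).
have Sm : measurable_fun [set: T] (fun x => \sum_(k <oo) `|g k x|%:E)%E.
  by apply: ge0_emeasurable_sum => // k x _ _; rewrite lee_fin.
have Sfin : (\int[P]_x (\sum_(k <oo) `|g k x|%:E) < +oo)%E.
  rewrite integral_nneseries //.
  apply: (@le_lt_trans _ _ (\sum_(k <oo) (((1 + K) * 2) / (2 ^ (k + 1))%:R)%:E)%E).
    apply: lee_nneseries => k _; first by move=> _; apply: integral_ge0 => x _; rewrite lee_fin.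
    rewrite Ex_EFin // lee_fin natrX exprD expr1 (le_trans (E1 k)) // le_eqVlt.
    apply/orP; left; apply/eqP; set u := 2 ^+ k; have u0 : u != 0 by rewrite expf_neq0.
    by field.
  by rewrite (cvg_lim _ (@cvg_geometric_eseries_half R ((1 + K) * 2) 0)) ?ltry.
have Sint : P.-integrable [set: T] (fun x => \sum_(k <oo) `|g k x|%:E)%E.
  apply/integrableP; split => //; under eq_integral do rewrite gee0_abs ?nneseries_ge0 //.
  by [].
have := integrable_ae measurableT Sint; apply: filterS => x /(_ Logic.I) fin.
apply: normed_cvg; apply: nnseries_is_cvg => [i|]; first exact: normr_ge0.
move: fin; rewrite ge0_fin_numE //; apply: nneseries_ge0 => n _ _; by rewrite lee_fin.
Qed.

End BoundedExpectation.

(** * Functions of finitely many ranks *)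

Definition valid_ranks (w : nat -> nat) := forall j, (0 < w j <= j.+1)%N.

Lemma valid_initial_rank pi : valid_ranks (initial_rank pi).
Proof. exact: initial_rank_bounds. Qed.

Definition rank_cylinder n (w : nat -> nat) : set coherent_perm :=
  [set pi | forall j, (j < n)%N -> initial_rank pi j = w j].

Lemma measurable_initial_rank j (B : set nat) :
  measurable [set pi : coherent_perm | B (initial_rank pi j)].
Proof.
rewrite (_ : [set pi | _] = \bigcup_(r in B) [set pi : coherent_perm | initial_rank pi j = r]).
  apply: bigcup_measurable => r _; apply: sub_sigma_algebra.
  by exists j, r.
apply/seteqP; split=> [pi Bp|pi [r Br] /= -> //].
by exists (initial_rank pi j).
Qed.

Lemma measurable_rank_event n (B : nat -> set nat) :
  measurable [set pi : coherent_perm | forall j, (j < n)%N -> B j (initial_rank pi j)].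
Proof.
rewrite (_ : [set pi | _] = \bigcap_(j in `I_n) [set pi : coherent_perm | B j (initial_rank pi j)]).
  by apply: bigcap_measurableType => j _; exact: measurable_initial_rank.
by apply/seteqP; split.
Qed.

Lemma measurable_rank_cylinder n w : measurable (rank_cylinder n w).
Proof. exact: (measurable_rank_event n (fun j => [set w j])). Qed.

(** A finite type of rank prefixes: the ranks at the first [n] positions are at most [n]. The
    sharper bound at each position is imposed by [valid_word]. *)
Definition word n := {ffun 'I_n -> 'I_n.+1}.

(** The default 1 is a legal rank at every position, so a valid word extends to a valid sequence. *)
Definition word_ranks n (f : word n) (j : nat) : nat :=
  oapp (fun i => val (f i)) 1%N (insub j).

Lemma word_ranksE n (f : word n) (i : 'I_n) : word_ranks f i = f i.
Proof. by rewrite /word_ranks valK. Qed.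

Definition valid_word n (f : word n) := [forall j, (0 < f j <= j.+1)%N].

Lemma valid_word_ranks n (f : word n) : valid_word f -> valid_ranks (word_ranks f).
Proof.
move=> /forallP vf j; rewrite /word_ranks; case: insubP => [i _ <-|_] //=.
Qed.

Definition to_word n (w : nat -> nat) : word n := [ffun j : 'I_n => inord (w j)].

Lemma to_wordK n w j : valid_ranks w -> (j < n)%N -> word_ranks (to_word n w) j = w j.
Proof.
move=> vw jn; rewrite (word_ranksE _ (Ordinal jn)) ffunE inordK //=.
by have := vw j; lia.
Qed.

Lemma to_word_valid n w : valid_ranks w -> valid_word (to_word n w).
Proof.
move=> vw; apply/forallP => j; rewrite -word_ranksE to_wordK //; exact: vw.
Qed.

Lemma word_ranks_inj n (f g : word n) :
  (forall j, (j < n)%N -> word_ranks f j = word_ranks g j) -> f = g.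
Proof.
by move=> fg; apply/ffunP => j; apply: val_inj; rewrite /= -!word_ranksE fg.
Qed.

Definition depends_below {T} n (g : (nat -> nat) -> T) :=
  forall w w', (forall j, (j < n)%N -> w j = w' j) -> g w = g w'.

Section RankExpectation.
Context (R : realType) (P : probability coherent_perm R).

Definition cylinder_prob n w : R := fine (P (rank_cylinder n w)).

Lemma cylinder_probE n w : P (rank_cylinder n w) = (cylinder_prob n w)%:E.
Proof. by rewrite /cylinder_prob fineK // fin_num_measure //; exact: measurable_rank_cylinder. Qed.

Lemma cylinder_prob_depends n : depends_below n (cylinder_prob n).
Proof.
move=> w w' ww; congr (fine (P _)); apply/seteqP.
by split=> pi piw j jn; rewrite piw // ww.
Qed.

(** Exactly one valid word matches the path, so a function of finitely many ranks is a simple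
    function; its measurability and expectation reduce to finite sums. *)
Lemma depends_below_sum n (g : (nat -> nat) -> R) pi : depends_below n g ->
  g (initial_rank pi) = \sum_(f : word n | valid_word f)
    g (word_ranks f) * \1_(rank_cylinder n (word_ranks f)) pi.
Proof.
move=> gn; have vp := valid_initial_rank pi.
rewrite (bigD1 (to_word n (initial_rank pi))) ?to_word_valid //=.
rewrite indicE mem_set => [|j jn]; last by rewrite to_wordK.
rewrite mulr1 big1 ?addr0 => [|f /andP[_ fw]].
  by apply: gn => j jn; rewrite to_wordK.
rewrite indicE memNset ?mulr0 // => pif; case/eqP: fw.
by apply: word_ranks_inj => j jn; rewrite to_wordK // pif.
Qed.

Lemma bmeas_depends n (g : (nat -> nat) -> R) : depends_below n g ->
  bmeas (fun pi => g (initial_rank pi)).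
Proof.
move=> gn; under eq_fun do rewrite (depends_below_sum _ gn).
apply: bmeas_sum => f _; apply: bmeasZ; apply: bmeas_indic.
exact: measurable_rank_cylinder.
Qed.

Lemma Ex_depends n (g : (nat -> nat) -> R) : depends_below n g ->
  Ex P (fun pi => g (initial_rank pi)) =
  \sum_(f : word n | valid_word f) g (word_ranks f) * cylinder_prob n (word_ranks f).
Proof.
move=> gn; under eq_fun do rewrite (depends_below_sum _ gn).
have mc f := measurable_rank_cylinder n (word_ranks f).
rewrite Ex_sum => [|f _]; last by apply: bmeasZ; exact: bmeas_indic.
apply: eq_bigr => f _; rewrite ExZ; last exact: bmeas_indic.
by congr (_ * _); apply: EFin_inj; rewrite Ex_indic // cylinder_probE.
Qed.

Definition update (J : pred nat) (a w : nat -> nat) : nat -> nat :=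
  fun k => if J k then a k else w k.

Lemma update_valid (J : pred nat) a w : valid_ranks a -> valid_ranks w -> valid_ranks (update J a w).
Proof. by move=> va vw k; rewrite /update; case: ifP. Qed.

Definition agrees n (J : pred nat) (a w : nat -> nat) : bool :=
  all (fun k => J k ==> (w k == a k)) (iota 0 n).

Lemma agreesP n (J : pred nat) a w :
  reflect (forall k, (k < n)%N -> J k -> w k = a k) (agrees n J a w).
Proof.
apply: (iffP allP) => H k; last by rewrite mem_iota => kn; apply/implyP => /H ->.
by move=> kn Jk; have := H k; rewrite mem_iota kn Jk => /(_ isT) /eqP.
Qed.

Lemma agrees_depends n J a : depends_below n (agrees n J a).
Proof.
move=> w w' ww; apply: eq_in_all => k; rewrite mem_iota => kn.
by rewrite ww.
Qed.

(** Overwriting the coordinates in [J] is a bijection from the words agreeing with [b] there onto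
    those agreeing with [a], and [g] does not see it. The factors [ca] and [cb] serve product laws,
    where a change of rank rescales the probability, without dividing by one that may be 0. *)
Lemma Ex_exchange_scaled n (J : pred nat) (a b : nat -> nat) (g : (nat -> nat) -> R) (ca cb : R) :
  valid_ranks a -> valid_ranks b ->
  depends_below n g -> (forall w w', (forall k, ~~ J k -> w k = w' k) -> g w = g w') ->
  (forall w, valid_ranks w ->
     ca * cylinder_prob n (update J a w) = cb * cylinder_prob n (update J b w)) ->
  ca * Ex P (fun pi => (agrees n J a (initial_rank pi))%:R * g (initial_rank pi)) =
  cb * Ex P (fun pi => (agrees n J b (initial_rank pi))%:R * g (initial_rank pi)).
Proof.
move=> va vb gn gJ qab.
have dep c : depends_below n (fun w => (agrees n J c w)%:R * g w).
  by move=> w w' ww; rewrite (agrees_depends _ _ ww) (gn _ _ ww).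
rewrite (Ex_depends (dep a)) (Ex_depends (dep b)).
have E c : \sum_(f : word n | valid_word f) (agrees n J c (word_ranks f))%:R * g (word_ranks f)
      * cylinder_prob n (word_ranks f)
   = \sum_(f : word n | valid_word f && agrees n J c (word_ranks f))
      g (word_ranks f) * cylinder_prob n (word_ranks f).
  rewrite [RHS]big_mkcondr /=; apply: eq_bigr => f _.
  by case: ifP; rewrite ?mul1r ?mul0r.
rewrite !E !mulr_sumr.
pose h c (f : word n) := to_word n (update J c (word_ranks f)).
have hE c f j : valid_ranks c -> valid_word f -> (j < n)%N ->
    word_ranks (h c f) j = update J c (word_ranks f) j.
  by move=> vc vf jn; rewrite to_wordK //; apply: update_valid => //; exact: valid_word_ranks.
have hv c f : valid_ranks c -> valid_word f -> valid_word (h c f).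
  by move=> vc vf; apply: to_word_valid; apply: update_valid => //; exact: valid_word_ranks.
have ha c f : valid_ranks c -> valid_word f -> agrees n J c (word_ranks (h c f)).
  by move=> vc vf; apply/agreesP => k kn Jk; rewrite hE // /update Jk.
have hK c c' f : valid_ranks c -> valid_ranks c' -> valid_word f ->
    agrees n J c (word_ranks f) -> h c (h c' f) = f.
  move=> vc vc' vf /agreesP af; apply: word_ranks_inj => j jn.
  rewrite hE ?hv // /update hE // /update; case: ifP => [Jj|->] //.
  by rewrite af.
rewrite (reindex_onto (h a) (h b)) /=; last first.
  by move=> f /andP[vf af]; apply: hK.
apply: eq_big => [f|f].
  apply/andP/andP => [[/andP[vf af] /eqP <-]|[vf af]].
    by rewrite hv // ha.
  by rewrite hv // ha // hK.
move=> /andP[/andP[vhf _] /eqP hf].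
have vf : valid_word f by rewrite -hf hv.
have /agreesP af : agrees n J b (word_ranks f) by rewrite -hf ha.
have haf j : (j < n)%N -> word_ranks (h a f) j = update J a (word_ranks f) j.
  exact: hE.
have -> : g (word_ranks (h a f)) = g (word_ranks f).
  rewrite (gn _ _ haf); apply: gJ => k; rewrite /update.
  by case: (J k).
have -> : cylinder_prob n (word_ranks f) = cylinder_prob n (update J b (word_ranks f)).
  by apply: cylinder_prob_depends => k kn; rewrite /update; case: ifP => // Jk; rewrite af.
rewrite (cylinder_prob_depends haf) ![_ * (g _ * _)]mulrCA qab //.
exact: valid_word_ranks.
Qed.

Lemma Ex_exchange n (J : pred nat) (a b : nat -> nat) (g : (nat -> nat) -> R) :
  valid_ranks a -> valid_ranks b ->
  depends_below n g -> (forall w w', (forall k, ~~ J k -> w k = w' k) -> g w = g w') ->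
  (forall w, valid_ranks w ->
     cylinder_prob n (update J a w) = cylinder_prob n (update J b w)) ->
  Ex P (fun pi => (agrees n J a (initial_rank pi))%:R * g (initial_rank pi)) =
  Ex P (fun pi => (agrees n J b (initial_rank pi))%:R * g (initial_rank pi)).
Proof.
move=> va vb gn gJ qab; rewrite -[LHS]mul1r -[RHS]mul1r.
by apply: Ex_exchange_scaled => // w vw; rewrite qab.
Qed.

End RankExpectation.

(** * Exchange of types *)

(* [Some true] is a lower record, [Some false] an upper one, [None] neither. *)
Definition rank_type (j r : nat) : option bool :=
  if r == 1%N then Some true else if r == j.+1 then Some false else None.

(** A representative of each type. Rank 2 represents the third type from position 2 on; at position
    1 it is an upper record. *)
Definition rank_of_type (j : nat) (c : option bool) : nat :=
  if c is Some b then if b then 1%N else j.+1 else 2%N.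

Lemma rank_of_typeK j c : (1 < j)%N -> rank_type j (rank_of_type j c) = c.
Proof.
move=> j1; rewrite /rank_type; case: c => [[]|] //=; last by case: eqP => //; lia.
by rewrite eqxx; case: eqP => //; lia.
Qed.

Lemma rank_of_type_bounds j c : (1 < j)%N -> (0 < rank_of_type j c <= j.+1)%N.
Proof. by case: c => [[]|] /=; lia. Qed.

Definition upd1 (k a : nat) (w : nat -> nat) : nat -> nat :=
  fun l => if l == k then a else w l.

Lemma upd1_valid k a w : (0 < a <= k.+1)%N -> valid_ranks w -> valid_ranks (upd1 k a w).
Proof. by move=> ak vw l; rewrite /upd1; case: eqP => [->|]. Qed.

Lemma valid_ranks1 : valid_ranks (fun=> 1%N).
Proof. by []. Qed.

(** * Weighted counts of types and their variation when a rank is changed *)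

Section Estimate.
Context (R : realType).
Implicit Types (c : option bool) (w : nat -> nat) (phi : (nat -> nat) -> R).

(* The inverse of the number of ranks at position j of the same type as r. *)
Definition type_weight (j r : nat) : R :=
  if rank_type j r is None then (j.-1)%:R^-1 else 1.

Definition typed_weight c (j r : nat) : R := (rank_type j r == c)%:R * type_weight j r.

(** The sums begin at position 2 because position 1 admits no rank of the third type. *)
Definition type_sum N c w : R := \sum_(2 <= j < N) typed_weight c j (w j).
Definition weight_sum N w : R := \sum_(2 <= j < N) type_weight j (w j).
Definition harmonic_sum N : R := \sum_(2 <= j < N) (j.-1)%:R^-1.
Definition type_freq N w c : R := type_sum N c w / weight_sum N w.
(** The normalization turning type frequencies [t] into a distribution on the ranks of position [i],
    each rank receiving the frequency of its type. *)
Definition rank_norm (i : nat) (t : option bool -> R) : R :=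
  \sum_(1 <= s < i.+2) t (rank_type i s).

Lemma type_weight_bounds j r : (1 < j)%N -> (j.-1)%:R^-1 <= type_weight j r <= 1.
Proof.
move=> j1; have p : 1 <= (j.-1)%:R :> R by rewrite ler1n; lia.
have p' : (j.-1)%:R^-1 <= 1 :> R by rewrite invf_le1 // (lt_le_trans _ p).
by rewrite /type_weight; case: (rank_type j r) => [_|]; rewrite ?lexx p'.
Qed.

Lemma type_weight_ge0 j r : 0 <= type_weight j r.
Proof. by rewrite /type_weight; case: rank_type => [_|] //; rewrite invr_ge0. Qed.

Lemma typed_weight_ge0 c j r : 0 <= typed_weight c j r.
Proof. by rewrite mulr_ge0 ?type_weight_ge0. Qed.

Lemma typed_weight_le c j r : typed_weight c j r <= type_weight j r.
Proof. by rewrite ler_piMl ?type_weight_ge0 //; case: (_ == _). Qed.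

Lemma typed_weight_bounds c j r : (1 < j)%N -> 0 <= typed_weight c j r <= 1.
Proof.
move=> j1; rewrite typed_weight_ge0 (le_trans (typed_weight_le _ _ _)) //.
by have /andP[] := type_weight_bounds r j1.
Qed.

Lemma harmonic_sum_le N w : harmonic_sum N <= weight_sum N w.
Proof.
rewrite /harmonic_sum /weight_sum !big_nat; apply: ler_sum => j /andP[j1 _].
by have /andP[] := type_weight_bounds (w j) j1.
Qed.

Lemma type_sum_ge0 N c w : 0 <= type_sum N c w.
Proof. by apply: sumr_ge0 => j _; exact: typed_weight_ge0. Qed.

Lemma type_sum_le N c w : type_sum N c w <= weight_sum N w.
Proof. by apply: ler_sum => j _; exact: typed_weight_le. Qed.

Lemma type_sum_total N w :
  type_sum N (Some true) w + type_sum N (Some false) w + type_sum N None w = weight_sum N w.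
Proof.
rewrite /type_sum /weight_sum -!big_split /=; apply: eq_bigr => j _.
rewrite /typed_weight; case: (rank_type j (w j)) => [[]|] /=; ring.
Qed.

Lemma sum_upd1_close (F : nat -> nat -> R) N k a w :
  (forall j r, (1 < j)%N -> 0 <= F j r <= 1) ->
  `|\sum_(2 <= j < N) F j (upd1 k a w j) - \sum_(2 <= j < N) F j (w j)| <= 1.
Proof.
move=> F01; rewrite -sumrB.
have [kN|kN] := boolP (2 <= k < N)%N; last first.
  rewrite big_nat big1 ?normr0 // => j jN; rewrite /upd1.
  by case: eqP => [jk|]; rewrite ?subrr //; rewrite -jk jN in kN.
rewrite (bigD1_seq k) ?iota_uniq ?mem_index_iota //=.
rewrite big1 => [|j jk]; last by rewrite /upd1 (negPf jk) subrr.
rewrite addr0 /upd1 eqxx.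
have /andP[k1 _] := kN.
have /andP[? ?] := F01 k a k1; have /andP[? ?] := F01 k (w k) k1.
rewrite ler_norml; lra.
Qed.

(** The difference is (a - a' - (a' / D') (D - D')) / D: only the bounded quotient [a' / D'] and a
    single division by [D] enter. *)
Lemma frac_close (a a' D D' c da dD : R) : 0 < D -> 0 < D' ->
  `|a - a'| <= da -> `|a' / D'| <= c -> `|D - D'| <= dD ->
  `|a / D - a' / D'| <= (da + c * dD) / D.
Proof.
move=> D0 D'0 aa ca DD.
have -> : a / D - a' / D' = (a - a' - a' / D' * (D - D')) / D.
  by field; rewrite !gt_eqF.
rewrite normrM normfV (gtr0_norm D0) ler_pM2r ?invr_gt0 //.
by rewrite (le_trans (ler_normB _ _)) // lerD // normrM ler_pM.
Qed.

(* Only coordinates from i on are considered, so that an indicator of an event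
   of the first i coordinates does not contribute. *)
Definition osc_le (i : nat) phi (delta : R) := forall w, valid_ranks w ->
  forall k a, (i <= k)%N -> (0 < a <= k.+1)%N -> `|phi (upd1 k a w) - phi w| <= delta.

Section Fixed.
Variables (N : nat).
Hypothesis HN : 0 < harmonic_sum N.

Lemma weight_sum_gt0 w : 0 < weight_sum N w.
Proof. exact: lt_le_trans HN (harmonic_sum_le N w). Qed.

Lemma type_freq_ge0 c w : 0 <= type_freq N w c.
Proof. by rewrite divr_ge0 ?type_sum_ge0 ?(ltW (weight_sum_gt0 w)). Qed.

Lemma type_freq_le1 c w : type_freq N w c <= 1.
Proof. by rewrite ler_pdivrMr ?weight_sum_gt0 // mul1r type_sum_le. Qed.

Lemma type_freq_norm c w : `|type_freq N w c| <= 1.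
Proof. by rewrite ger0_norm ?type_freq_ge0 ?type_freq_le1. Qed.

Lemma type_freq_total w :
  type_freq N w (Some true) + type_freq N w (Some false) + type_freq N w None = 1.
Proof.
by rewrite /type_freq -!mulrDl type_sum_total divff // gt_eqF ?weight_sum_gt0.
Qed.

Lemma weight_sum_upd1 k a w : `|weight_sum N w - weight_sum N (upd1 k a w)| <= 1.
Proof.
rewrite distrC; apply: sum_upd1_close => j r j1.
by rewrite type_weight_ge0; have /andP[] := type_weight_bounds r j1.
Qed.

(** One coordinate moves the numerator and the denominator by at most 1 each, whence the 2. *)
Lemma osc_type_freq i c : osc_le i (fun w => type_freq N w c) (2 / harmonic_sum N).
Proof.
move=> w vw k a _ _; rewrite distrC.
apply: le_trans (frac_close (weight_sum_gt0 _) (weight_sum_gt0 _) _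
  (type_freq_norm c (upd1 k a w)) (weight_sum_upd1 k a w)) _.
  rewrite distrC; apply: sum_upd1_close => j r; exact: typed_weight_bounds.
rewrite mul1r ler_pM2l // lef_pV2 ?posrE ?weight_sum_gt0 //; exact: harmonic_sum_le.
Qed.

(** Two coordinates change, so [delta] and the variation of the denominator are both doubled. The
    bound keeps [weight_sum N w] itself as denominator: summed against the weights of the positions,
    it will cancel. *)
Lemma osc_quot i phi delta C : (forall w, valid_ranks w -> `|phi w| <= C) -> 0 <= C ->
  osc_le i phi delta -> forall w, valid_ranks w ->
  forall k a, (i <= k)%N -> (0 < a <= k.+1)%N ->
  forall l b, (i <= l)%N -> (0 < b <= l.+1)%N ->
  `|phi w / weight_sum N w - phi (upd1 k a (upd1 l b w)) / weight_sum N (upd1 k a (upd1 l b w))|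
  <= (2 * delta + C / harmonic_sum N * 2) / weight_sum N w.
Proof.
move=> phiC C0 ophi w vw k a ik ak l b il bl.
have vlw : valid_ranks (upd1 l b w) by exact: upd1_valid.
have vkw : valid_ranks (upd1 k a (upd1 l b w)) by exact: upd1_valid.
apply: frac_close; [exact: weight_sum_gt0|exact: weight_sum_gt0| | | ].
- rewrite distrC (_ : _ - _ = (phi (upd1 k a (upd1 l b w)) - phi (upd1 l b w))
     + (phi (upd1 l b w) - phi w)); last by ring.
  by rewrite (le_trans (ler_normD _ _)) // mulr_natl mulr2n lerD // ophi.
- rewrite normrM normfV (gtr0_norm (weight_sum_gt0 _)).
  apply: ler_pM => //; first by rewrite invr_ge0 ltW // weight_sum_gt0.
    exact: phiC.
  by rewrite lef_pV2 ?posrE ?weight_sum_gt0 ?harmonic_sum_le.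
- rewrite (_ : _ - _ = (weight_sum N w - weight_sum N (upd1 l b w))
     + (weight_sum N (upd1 l b w) - weight_sum N (upd1 k a (upd1 l b w)))); last by ring.
  rewrite (le_trans (ler_normD _ _)) // (_ : 2 = 1 + 1 :> R) // lerD //; exact: weight_sum_upd1.
Qed.

End Fixed.

Lemma sum_split_ends (F : nat -> R) j : (0 < j)%N ->
  \sum_(1 <= s < j.+2) F s = F 1%N + \sum_(2 <= s < j.+1) F s + F j.+1.
Proof. by move=> j0; rewrite big_nat_recr //= big_ltn. Qed.

Lemma rank_type_mid j s : (2 <= s < j.+1)%N -> rank_type j s = None.
Proof. by move=> sj; rewrite /rank_type; do 2 (case: eqP => [?|_]; first by lia). Qed.

Lemma rank_type_last j : (0 < j)%N -> rank_type j j.+1 = Some false.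
Proof. by move=> j0; rewrite /rank_type eqxx; case: eqP => //; lia. Qed.

Lemma rank_normE i t : (0 < i)%N ->
  rank_norm i t = t (Some true) + t (Some false) + (i.-1)%:R * t None.
Proof.
move=> i0; rewrite /rank_norm sum_split_ends // rank_type_last //.
rewrite (eq_big_nat _ _ (F2 := fun=> t None)) => [|s si]; last by rewrite rank_type_mid.
rewrite sumr_const_nat -mulr_natl (_ : i.+1 - 2 = i.-1)%N; last by lia.
rewrite {1}/rank_type /=; ring.
Qed.

(** This is the purpose of the weights: at each position from 2 on, every type has total weight 1,
    however many ranks it has there. *)
Lemma sum_typed_weight c j : (1 < j)%N -> \sum_(1 <= s < j.+2) typed_weight c j s = 1.
Proof.
move=> j1; rewrite sum_split_ends ?(ltnW j1) // /typed_weight /type_weight.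
rewrite rank_type_last ?(ltnW j1) //.
rewrite (eq_big_nat _ _ (F2 := fun=> (None == c)%:R * (j.-1)%:R^-1)) => [|s sj]; last first.
  by rewrite rank_type_mid.
rewrite sumr_const_nat -mulr_natl (_ : j.+1 - 2 = j.-1)%N; last by lia.
have p : (j.-1)%:R != 0 :> R by rewrite pnatr_eq0; lia.
by rewrite {1 2}/rank_type /=; case: c => [[]|] /=; field.
Qed.

Lemma sum_indicator (r : nat) i (F : nat -> R) : (0 < r <= i.+1)%N ->
  F r = \sum_(1 <= s < i.+2) (r == s)%:R * F s.
Proof.
move=> ri; rewrite (bigD1_seq r) ?iota_uniq ?mem_index_iota //= eqxx mul1r big1 ?addr0 //.
by move=> s; rewrite eq_sym => /negPf ->; rewrite mul0r.
Qed.

End Estimate.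

Definition pair_ranks (i r j r' : nat) : nat -> nat :=
  fun k => if k == i then r else if k == j then r' else 1%N.

Lemma pair_ranks_valid i r j r' : (0 < r <= i.+1)%N -> (0 < r' <= j.+1)%N ->
  valid_ranks (pair_ranks i r j r').
Proof.
by move=> vr vr' k; rewrite /pair_ranks; case: eqP => [->|_] //; case: eqP => [->|_].
Qed.

(** Stated for a commutative monoid, since both products of rank probabilities and sums counting
    records are split in this way. *)
Lemma big_update_pair {T} {idx : T} (op : Monoid.com_law idx) (F : nat -> nat -> T) N i j r r' w :
  i != j -> (i < N)%N -> (j < N)%N ->
  \big[op/idx]_(0 <= k < N) F k (update (pred2 i j) (pair_ranks i r j r') w k) =
  op (op (F i r) (F j r')) (\big[op/idx]_(0 <= k < N | (k != i) && (k != j)) F k (w k)).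
Proof.
move=> ij iN jN; rewrite (bigD1_seq i) ?iota_uniq ?mem_index_iota //=.
rewrite -big_filter (bigD1_seq j) ?filter_uniq ?iota_uniq //=; last first.
  by rewrite mem_filter mem_index_iota eq_sym ij.
rewrite big_filter_cond Monoid.mulmA /update /pair_ranks /= !eqxx orbT (negPf ij) eq_sym (negPf ij).
by congr (op _ _); apply: eq_bigr => k /andP[/negPf-> /negPf->].
Qed.

Lemma big_upd1 {T} {idx : T} (op : Monoid.com_law idx) (F : nat -> nat -> T) N i r w :
  (i < N)%N ->
  \big[op/idx]_(0 <= k < N) F k (upd1 i r w k) =
  op (F i r) (\big[op/idx]_(0 <= k < N | (k != i)) F k (w k)).
Proof.
move=> iN; rewrite (bigD1_seq i) ?iota_uniq ?mem_index_iota //= /upd1 eqxx.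
by congr (op _ _); apply: eq_bigr => k /negPf->.
Qed.

(** * Exchange estimates for the frequencies at finite size *)

Section Core.
Context (R : realType) (P : probability coherent_perm R).

(* Interchanging the types of two ranks does not change the probability. *)
Definition type_exchangeable := forall N i j r r' s s' w,
  (0 < i)%N -> (1 < j)%N -> i != j -> (i < N)%N -> (j < N)%N ->
  (0 < r <= i.+1)%N -> (0 < s <= i.+1)%N -> (0 < r' <= j.+1)%N -> (0 < s' <= j.+1)%N ->
  rank_type i r = rank_type j s' -> rank_type j r' = rank_type i s ->
  valid_ranks w ->
  cylinder_prob P N (update (pred2 i j) (pair_ranks i r j r') w) =
  cylinder_prob P N (update (pred2 i j) (pair_ranks i s j s') w).

Hypothesis exch : type_exchangeable.

Lemma agrees_pair N i r j r' w : (i < N)%N -> (j < N)%N -> i != j ->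
  agrees N (pred2 i j) (pair_ranks i r j r') w = (w i == r) && (w j == r').
Proof.
move=> iN jN ij; apply/agreesP/andP => [H|[/eqP wi /eqP wj] k kN].
  split; apply/eqP.
  - by rewrite (H i) //= ?eqxx // /pair_ranks ?eqxx.
  - by rewrite (H j) //= ?eqxx ?orbT // /pair_ranks [j == i]eq_sym (negPf ij) ?eqxx.
by rewrite /= /pair_ranks => /orP[/eqP->|/eqP->]; rewrite ?eqxx // eq_sym (negPf ij) ?eqxx.
Qed.

(** All ranks of one type at [j] contribute the same expectation and their weights add up to 1. The
    weighted indicator thus amounts to that of a single representative, to which the exchange
    hypothesis applies. *)
Lemma Ex_typed_exchange N i j r s (g : (nat -> nat) -> R) :
  (0 < i)%N -> (1 < j)%N -> i != j -> (i < N)%N -> (j < N)%N ->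
  (0 < r <= i.+1)%N -> (0 < s <= i.+1)%N ->
  depends_below N g ->
  (forall w w', (forall k, ~~ pred2 i j k -> w k = w' k) -> g w = g w') ->
  Ex P (fun pi => (initial_rank pi i == r)%:R *
     typed_weight R (rank_type i s) j (initial_rank pi j) * g (initial_rank pi)) =
  Ex P (fun pi => (initial_rank pi i == s)%:R *
     typed_weight R (rank_type i r) j (initial_rank pi j) * g (initial_rank pi)).
Proof.
move=> i0 j1 ij iN jN vr vs gN gij.
pose e r' v : R := Ex P (fun pi => ((initial_rank pi i == r') && (initial_rank pi j == v))%:R
                              * g (initial_rank pi)).
have key r1 s1 v v' : (0 < r1 <= i.+1)%N -> (0 < s1 <= i.+1)%N -> (0 < v <= j.+1)%N ->
    (0 < v' <= j.+1)%N -> rank_type i r1 = rank_type j v' -> rank_type j v = rank_type i s1 ->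
    e r1 v = e s1 v'.
  move=> vr1 vs1 vv vv' t1 t2; rewrite /e.
  have eE u u' : e u u' = Ex P (fun pi =>
      (agrees N (pred2 i j) (pair_ranks i u j u') (initial_rank pi))%:R * g (initial_rank pi)).
    by congr Ex; apply/funext => pi; rewrite agrees_pair.
  rewrite -/(e r1 v) -/(e s1 v') !eE.
  apply: Ex_exchange => //; [exact: pair_ranks_valid|exact: pair_ranks_valid|].
  by move=> w vw; exact: exch.
have be r1 v : bmeas (fun pi => ((initial_rank pi i == r1) && (initial_rank pi j == v))%:R
                              * g (initial_rank pi)).
  apply: (@bmeas_depends R N (fun w => ((w i == r1) && (w j == v))%:R * g w)).
  by move=> w w' ww; rewrite (gN _ _ ww) !ww.
have expand r1 s1 : (0 < r1 <= i.+1)%N -> (0 < s1 <= i.+1)%N ->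
    Ex P (fun pi => (initial_rank pi i == r1)%:R *
     typed_weight R (rank_type i s1) j (initial_rank pi j) * g (initial_rank pi)) =
    e s1 (rank_of_type j (rank_type i r1)).
  move=> vr1 vs1.
  transitivity (Ex P (fun pi => \sum_(1 <= v < j.+2) typed_weight R (rank_type i s1) j v *
      (((initial_rank pi i == r1) && (initial_rank pi j == v))%:R * g (initial_rank pi)))).
    congr Ex; apply/funext => pi.
    rewrite (sum_indicator (fun v => typed_weight R (rank_type i s1) j v)
      (valid_initial_rank pi j)) mulr_sumr mulr_suml.
    by apply: eq_bigr => v _; rewrite -mulnb natrM; ring.
  rewrite Ex_sum => [|v _]; last exact: bmeasZ.
  transitivity ((\sum_(1 <= v < j.+2) typed_weight R (rank_type i s1) j v)
      * e s1 (rank_of_type j (rank_type i r1))); last by rewrite sum_typed_weight // mul1r.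
  rewrite mulr_suml.
  rewrite !big_nat; apply: eq_bigr => v vj; rewrite ExZ // -/(e r1 v).
  rewrite /typed_weight; case: eqP => [tv|_]; last by rewrite !mul0r.
  congr (_ * _).  apply: (key r1 s1 v (rank_of_type j (rank_type i r1))) => //.
  - exact: rank_of_type_bounds.
  - by rewrite rank_of_typeK.
by rewrite !expand //; apply: key => //; rewrite ?rank_of_typeK //; exact: rank_of_type_bounds.
Qed.

Lemma upd1_update i j w : upd1 j 1 (upd1 i 1 w) = update (pred2 i j) (fun=> 1%N) w.
Proof.
by apply/funext => k; rewrite /upd1 /update /=; case: eqP; case: eqP.
Qed.

Lemma type_sum_depends N c : depends_below N (@type_sum R N c).
Proof.
by move=> w w' ww; rewrite /type_sum !big_nat; apply: eq_bigr => j /andP[_ jN]; rewrite ww.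
Qed.

Lemma weight_sum_depends N : depends_below N (@weight_sum R N).
Proof.
by move=> w w' ww; rewrite /weight_sum !big_nat; apply: eq_bigr => j /andP[_ jN]; rewrite ww.
Qed.

Lemma type_freq_depends N c : depends_below N (fun w => @type_freq R N w c).
Proof.
by move=> w w' ww; rewrite /type_freq (type_sum_depends _ ww) (weight_sum_depends ww).
Qed.

Lemma depends_belowW {T} N M (g : (nat -> nat) -> T) :
  (N <= M)%N -> depends_below N g -> depends_below M g.
Proof. by move=> NM gN w w' ww; apply: gN => j jN; apply: ww; exact: leq_trans NM. Qed.

(** The frequencies are expanded as sums over positions [j]. For [j] beyond [i] the exchange is
    exact up to the dependence of [phi] and of the denominator on the ranks at [i] and [j]; the at
    most [i] remaining positions are bounded crudely. *)
Lemma Ex_freq_exchange N M i r s (phi : (nat -> nat) -> R) C delta :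
  (0 < i < N)%N -> (N <= M)%N -> (0 < r <= i.+1)%N -> (0 < s <= i.+1)%N ->
  0 < harmonic_sum R N -> depends_below M phi ->
  (forall w, valid_ranks w -> `|phi w| <= C) -> osc_le i phi delta ->
  `|Ex P (fun pi => let w := initial_rank pi in
      ((w i == r)%:R * type_freq R N w (rank_type i s)
       - (w i == s)%:R * type_freq R N w (rank_type i r)) * phi w)|
  <= 4 * delta + (i.+4)%:R * (C / harmonic_sum R N).
Proof.
move=> /andP[i0 iN] NM vr vs HN phiM phiC ophi.
set H := harmonic_sum R N in HN *.
have C0 : 0 <= C by apply: le_trans (phiC _ valid_ranks1); exact: normr_ge0.
have delta0 : 0 <= delta.
  by apply: le_trans (ophi _ valid_ranks1 i 1%N (leqnn i) _); rewrite ?normr_ge0.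
pose psi w := phi w / weight_sum R N w.
pose x := rank_type i s; pose y := rank_type i r.
pose Z w j : R := (w i == r)%:R * typed_weight R x j (w j) - (w i == s)%:R * typed_weight R y j (w j).
pose A j w := Z w j * psi w.
pose eps : R := 2 * delta + C / H * 2.
(* The bound for position [j]: the trivial one up to [i], beyond it the cost of freezing two
   coordinates, weighted by the types actually met. *)
pose B j w : R := if (j <= i)%N then C / H else
  (typed_weight R x j (w j) + typed_weight R y j (w j)) * (eps / weight_sum R N w).
have eps0 : 0 <= eps by rewrite addr_ge0 // mulr_ge0 // divr_ge0 // ltW.
have psiM : depends_below M psi.
  move=> w w' ww; rewrite /psi (phiM _ _ ww).
  by rewrite (depends_belowW NM (@weight_sum_depends N) ww).
have AM j : (2 <= j < N)%N -> depends_below M (A j).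
  move=> /andP[_ jN] w w' ww; rewrite /A /Z (psiM _ _ ww) !ww //; last exact: leq_trans NM.
  exact: leq_trans NM.
have BM j : (2 <= j < N)%N -> depends_below M (B j).
  move=> /andP[_ jN] w w' ww; rewrite /B (depends_belowW NM (@weight_sum_depends N) ww) ww //.
  exact: leq_trans NM.
have bA j : (2 <= j < N)%N -> bmeas (fun pi => A j (initial_rank pi)).
  by move=> /AM; exact: bmeas_depends.
have bB j : (2 <= j < N)%N -> bmeas (fun pi => B j (initial_rank pi)).
  by move=> /BM; exact: bmeas_depends.
have Z_le w j : `|Z w j| <= typed_weight R x j (w j) + typed_weight R y j (w j).
  rewrite (le_trans (ler_normB _ _)) // lerD // normrM (ger0_norm (typed_weight_ge0 _ _ _ _));
  by rewrite ler_piMl ?typed_weight_ge0 //; case: (_ == _); rewrite ?normr1 ?normr0.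
have EAB j : (2 <= j < N)%N -> `|Ex P (fun pi => A j (initial_rank pi))| <=
     Ex P (fun pi => B j (initial_rank pi)).
  move=> jN; have /andP[j1 jN'] := jN.
  have [ji|ij] := leqP j i.
    apply: Ex_norm_le => [||pi]; [exact: bA|exact: bB|].
    rewrite /A /B ji normrM -[leRHS]mul1r; set w := initial_rank pi.
    have vw : valid_ranks w by exact: valid_initial_rank.
    apply: ler_pM => //; last first.
      rewrite /psi normrM normfV (gtr0_norm (weight_sum_gt0 HN w)).
      apply: ler_pM => //; first by rewrite invr_ge0 ltW // weight_sum_gt0.
        exact: phiC.
      by rewrite lef_pV2 ?posrE ?weight_sum_gt0 ?harmonic_sum_le.
    have /andP[x0 x1] := @typed_weight_bounds R x j (w j) j1.
    have /andP[y0 y1] := @typed_weight_bounds R y j (w j) j1.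
    rewrite /Z; case: eqP => _; case: eqP => _; rewrite ?mul1r ?mul0r ?subr0 ?sub0r ?normrN ?normr0 //.
    - rewrite ler_norml; lra.
    - by rewrite ger0_norm.
    - by rewrite ger0_norm.
  have ineqj : i != j by rewrite neq_ltn ij.
  have jM := leq_trans jN' NM; have iM := leq_trans iN NM.
  (* With both coordinates frozen at the legal rank 1 the factor ignores them, and the exchange
     becomes exact. *)
  pose psij w := psi (upd1 j 1 (upd1 i 1 w)).
  have psij_dep : depends_below M psij.
    by move=> w w' ww; apply: psiM => k kM; rewrite /upd1; do 2 case: eqP => //; rewrite ww.
  have ZM : depends_below M (fun w => Z w j).
    by move=> w w' ww; rewrite /Z !ww.
  have bZj : bmeas (fun pi => Z (initial_rank pi) j * psij (initial_rank pi)).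
    apply: (@bmeas_depends R M (fun w => Z w j * psij w)) => w w' ww.
    by rewrite (ZM _ _ ww) (psij_dep _ _ ww).
  have EZ0 : Ex P (fun pi => Z (initial_rank pi) j * psij (initial_rank pi)) = 0.
    under eq_fun do rewrite /Z mulrBl.
    have b1 u c : bmeas (fun pi => (initial_rank pi i == u)%:R *
        typed_weight R c j (initial_rank pi j) * psij (initial_rank pi)).
      apply: (@bmeas_depends R M (fun w => (w i == u)%:R * typed_weight R c j (w j) * psij w)).
      by move=> w w' ww; rewrite (psij_dep _ _ ww) !ww.
    rewrite ExB //; apply/eqP; rewrite subr_eq0; apply/eqP.
    apply: (@Ex_typed_exchange M) => // w w' ww; rewrite /psij !upd1_update.
    congr psi; apply/funext => k; rewrite /update; case: ifPn => // /ww //.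
  rewrite -[Ex _ _]subr0 -EZ0 -ExB //; last exact: bA.
  apply: Ex_norm_le => [||pi]; [by apply: bmeasB => //; exact: bA|exact: bB|].
  rewrite /B leqNgt ij /= /A -mulrBr normrM; set w := initial_rank pi.
  have vw : valid_ranks w by exact: valid_initial_rank.
  apply: ler_pM => //.
  by apply: (osc_quot HN phiC C0 ophi) => //; exact: ltnW.
have -> : (fun pi => let w := initial_rank pi in
      ((w i == r)%:R * type_freq R N w (rank_type i s)
       - (w i == s)%:R * type_freq R N w (rank_type i r)) * phi w)
    = fun pi => \sum_(2 <= j < N | (2 <= j < N)%N) A j (initial_rank pi).
  apply/funext => pi /=; set w := initial_rank pi.
  rewrite -big_nat /A -mulr_suml /Z sumrB -!mulr_sumr -/(type_sum R N x w) -/(type_sum R N y w).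
  by rewrite /type_freq /psi -/x -/y; ring.
rewrite Ex_sum //.
apply: le_trans (ler_norm_sum _ _ _) _.
apply: (@le_trans _ _ (\sum_(2 <= j < N | (2 <= j < N)%N) Ex P (fun pi => B j (initial_rank pi)))).
  exact: ler_sum.
rewrite -Ex_sum // -[leRHS](Ex_cst P).
apply: Ex_le => [||pi]; [exact: bmeas_sum|exact: bmeas_cst|].
set w := initial_rank pi; rewrite -big_nat (bigID (fun j => j <= i)%N) /=.
have W0 := weight_sum_gt0 HN w.
have Wn0 : weight_sum R N w != 0 by rewrite gt_eqF.
have CH0 : 0 <= C / H by rewrite divr_ge0 // ltW.
have b1 : \sum_(2 <= j < N | (j <= i)%N) B j w <= i%:R * (C / H).
  rewrite (eq_bigr (fun=> C / H)) => [|j ji]; last by rewrite /B ji.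
  rewrite big_const_seq iter_addr_0 -[X in X <= _]mulr_natl ler_wpM2r // ler_nat -size_filter.
  rewrite -[leqRHS](size_iota 1 i) uniq_leq_size ?filter_uniq ?iota_uniq // => j.
  by rewrite mem_filter mem_index_iota mem_iota; lia.
have b2 : \sum_(2 <= j < N | ~~ (j <= i)%N) B j w <= 2 * eps.
  apply: (@le_trans _ _ (\sum_(2 <= j < N) (typed_weight R x j (w j) + typed_weight R y j (w j))
      * (eps / weight_sum R N w))).
    rewrite [leLHS]big_mkcond; apply: ler_sum => j _.
    have t0 : 0 <= (typed_weight R x j (w j) + typed_weight R y j (w j)) * (eps / weight_sum R N w).
      by rewrite mulr_ge0 ?addr_ge0 ?typed_weight_ge0 // divr_ge0 // ltW.
    by case: ifPn => //; rewrite /B => /negPf ->.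
  rewrite -mulr_suml big_split /= -/(type_sum R N x w) -/(type_sum R N y w).
  apply: (@le_trans _ _ ((weight_sum R N w + weight_sum R N w) * (eps / weight_sum R N w))).
    rewrite ler_wpM2r ?divr_ge0 ?(ltW W0) // lerD //; exact: type_sum_le.
  by rewrite le_eqVlt; apply/orP; left; apply/eqP; field.
(* The term 2 * eps equals 4 * delta + 4 * (C / H), to which i * (C / H) is added. *)
apply: le_trans (lerD b1 b2) _.
rewrite /eps -[in leRHS]addn4 natrD; lra.
Qed.

End Core.

(** * Limiting frequencies *)

Section Level.
Context (R : realType).

Lemma harmonic_sumS N : harmonic_sum R N <= harmonic_sum R N.+1.
Proof.
rewrite /harmonic_sum; have [N2|N2] := leqP 2 N; first by rewrite big_nat_recr //= lerDl.
by rewrite !big_geq //; lia.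
Qed.

Lemma harmonic_sum_mono N M : (N <= M)%N -> harmonic_sum R N <= harmonic_sum R M.
Proof. exact: (homo_leq lexx le_trans harmonic_sumS). Qed.

Lemma harmonic_sum_unbounded (B : R) : exists N, B <= harmonic_sum R N.
Proof.
apply: contrapT => /forallNP HB; apply: (@dvg_harmonic R).
apply: nondecreasing_is_cvgn; first by rewrite /series /=; apply: (@nondecreasing_series _ _ xpredT 0) => i _ _; exact: harmonic_ge0.
exists B => _ [n _ <-]; have /negP := HB n.+2; rewrite -ltNge => /ltW; apply: le_trans.
rewrite /harmonic_sum /series /= (big_addn 0 n.+2 2) subn2 /= le_eqVlt; apply/orP; left.
by apply/eqP; apply: eq_bigr => i _; rewrite addn2.
Qed.

Lemma level_subproof k : exists N, 8 ^+ k <= harmonic_sum R N.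
Proof. exact: harmonic_sum_unbounded. Qed.

(** Along these sizes an L^2 bound of order 1 / [harmonic_sum] decays like 8^-k, the rate that
    [ae_cvg_series] asks for. *)
Definition level k : nat := ex_minn (level_subproof k).

Lemma level_ge k : 8 ^+ k <= harmonic_sum R (level k).
Proof. by rewrite /level; case: ex_minnP. Qed.

Lemma harmonic_level_gt0 k : 0 < harmonic_sum R (level k).
Proof. by apply: lt_le_trans (level_ge k); rewrite exprn_gt0. Qed.

Lemma level_mono k : (level k <= level k.+1)%N.
Proof.
rewrite {1}/level; case: ex_minnP => n _; apply; apply: le_trans (level_ge k.+1).
by rewrite exprS ler_peMl ?exprn_ge0 // ler1n.
Qed.

Lemma harmonic_sum_gt0 N : 0 < harmonic_sum R N -> (2 < N)%N.
Proof. by rewrite ltnNge; apply: contraTN => N2; rewrite /harmonic_sum big_geq ?ltxx. Qed.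

Lemma inv_harmonic_level k : (harmonic_sum R (level k))^-1 <= (8 ^+ k)^-1.
Proof. by rewrite lef_pV2 ?posrE ?level_ge ?exprn_gt0 ?harmonic_level_gt0. Qed.

Lemma level_unbounded n : exists k0, forall k, (k0 <= k)%N -> (n < level k)%N.
Proof.
have lt8 (k : nat) : k%:R < 8 ^+ k :> R by rewrite -natrX ltr_nat; apply: ltn_expl.
have : exists k0 : nat, harmonic_sum R n < k0%:R.
  exists (Num.truncn (harmonic_sum R n)).+1; rewrite truncnS_gt //.
move=> [k0 hk0]; exists k0 => k k0k; rewrite ltnNge; apply: contraTN isT => ln.
suff : harmonic_sum R n < harmonic_sum R n by rewrite ltxx.
apply: lt_le_trans hk0 _; apply: le_trans (harmonic_sum_mono ln).
by apply: le_trans (level_ge k); apply: le_trans (ltW (lt8 k)); rewrite ler_nat.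
Qed.

End Level.

(** * Almost sure convergence of the frequencies along the levels *)

Section Limit.
Context (R : realType).

(** An upper limit is defined and measurable on all paths, whereas convergence is only almost
    sure. *)
Definition sup_freq (pi : coherent_perm) (c : option bool) : R :=
  limn_sup (fun k => type_freq R (level R k) (initial_rank pi) c).

Definition in_simplex (t : option bool -> R) : bool :=
  [&& 0 <= t (Some true), 0 <= t (Some false), 0 <= t None &
      t (Some true) + t (Some false) + t None == 1].

(* The limit of [type_freq], forced into the simplex on the null set where the
   limit does not exist. *)
Definition limit_freq (pi : coherent_perm) (c : option bool) : R :=
  if in_simplex (sup_freq pi) then sup_freq pi c else (c == None)%:R.

Lemma in_simplex_ge0 t c : in_simplex t -> 0 <= t c.
Proof. by case/and4P; case: c => [[]|]. Qed.

Lemma in_simplex_total t : in_simplex t -> t (Some true) + t (Some false) + t None = 1.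
Proof. by case/and4P => _ _ _ /eqP. Qed.

Lemma in_simplex_le1 t c : in_simplex t -> t c <= 1.
Proof.
move=> /and4P[a b d /eqP <-]; case: c => [[]|]; lra.
Qed.

Lemma limit_freq_simplex pi : in_simplex (limit_freq pi).
Proof.
case s : (in_simplex (sup_freq pi)).
  by rewrite (_ : limit_freq pi = sup_freq pi) //; apply/funext => c; rewrite /limit_freq s.
rewrite (_ : limit_freq pi = fun c => (c == None)%:R).
  by rewrite /in_simplex /= !lexx ler01 !add0r eqxx.
by apply/funext => c; rewrite /limit_freq s.
Qed.

Lemma type_freq_simplex N w : 0 < harmonic_sum R N -> in_simplex (@type_freq R N w).
Proof. by move=> HN; rewrite /in_simplex !type_freq_ge0 // type_freq_total // eqxx. Qed.

Lemma type_freq_bmeas N c : bmeas (fun pi => @type_freq R N (initial_rank pi) c).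
Proof. exact: bmeas_depends (@type_freq_depends R N c). Qed.

Lemma sup_freq_measurable c : measurable_fun [set: coherent_perm] (sup_freq^~ c).
Proof.
have b pi n : 0 <= type_freq R (level R n) (initial_rank pi) c <= 1.
  by rewrite type_freq_ge0 ?type_freq_le1 ?harmonic_level_gt0.
apply: measurable_fun_limn_sup => [pi _|pi _|n].
- by exists 1 => _ [n _ <-]; have /andP[] := b pi n.
- by exists 0 => _ [n _ <-]; have /andP[] := b pi n.
- by case: (type_freq_bmeas (level R n) c).
Qed.

Lemma limit_freq_measurable c : measurable_fun [set: coherent_perm] (limit_freq^~ c).
Proof.
apply: measurable_fun_ifT; [|exact: sup_freq_measurable|exact: measurable_cst].
have m := sup_freq_measurable.
apply: measurable_and; first by apply: measurable_fun_ler => //; exact: measurable_cst.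
apply: measurable_and; first by apply: measurable_fun_ler => //; exact: measurable_cst.
apply: measurable_and; first by apply: measurable_fun_ler => //; exact: measurable_cst.
apply: measurable_fun_eqr; last exact: measurable_cst.
by do 2 (apply: measurable_funD => //).
Qed.

Lemma limit_freq_bmeas c : bmeas (limit_freq^~ c).
Proof.
split; first exact: limit_freq_measurable.
exists 1 => pi; rewrite ger0_norm ?in_simplex_ge0 ?in_simplex_le1 //; exact: limit_freq_simplex.
Qed.

(** A limit of frequencies inherits the constraints of the simplex, so the default value is not
    taken. *)
Lemma limit_freqE pi (t : option bool -> R) :
  (forall c, type_freq R (level R k) (initial_rank pi) c @[k --> \oo] --> t c) ->
  forall c, limit_freq pi c = t c.
Proof.
move=> tt c.
have st c' : sup_freq pi c' = t c' by have /cvg_sups/cvg_lim := tt c'; apply.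
have pos c' : 0 <= t c'.
  have /cvg_lim <- // := tt c'; apply: limr_ge; first by apply/cvg_ex; exists (t c').
  by apply: nearW => k; rewrite type_freq_ge0 ?harmonic_level_gt0.
have tot : t (Some true) + t (Some false) + t None = 1.
  pose f c' k := type_freq R (level R k) (initial_rank pi) c'.
  have H : f (Some true) k + f (Some false) k + f None k @[k --> \oo] -->
      t (Some true) + t (Some false) + t None.
    by apply: cvgD (tt None); apply: cvgD (tt (Some true)) (tt (Some false)).
  have /cvg_lim <- // := H.
  by under eq_fun do rewrite /f type_freq_total ?harmonic_level_gt0 //; rewrite lim_cst.
by rewrite /limit_freq /in_simplex !st !pos tot eqxx.
Qed.

Variable (P : probability coherent_perm R).
Hypothesis exch : type_exchangeable P.

(** Sum [Ex_freq_exchange] over the i + 1 ranks [s]: the indicators of [s] add up to 1 and the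
    frequencies of their types to [rank_norm]. *)
Lemma Ex_rank_freq N M i r (phi : (nat -> nat) -> R) C delta :
  (0 < i < N)%N -> (N <= M)%N -> (0 < r <= i.+1)%N ->
  0 < harmonic_sum R N -> depends_below M phi ->
  (forall w, valid_ranks w -> `|phi w| <= C) -> osc_le i phi delta ->
  `|Ex P (fun pi => let w := initial_rank pi in
      ((w i == r)%:R * rank_norm i (type_freq R N w) - type_freq R N w (rank_type i r)) * phi w)|
  <= (i.+1)%:R * (4 * delta + (i.+4)%:R * (C / harmonic_sum R N)).
Proof.
move=> iN NM vr HN phiM phiC ophi; have /andP[i0 iN'] := iN.
pose G s w := ((w i == r)%:R * type_freq R N w (rank_type i s)
       - (w i == s)%:R * type_freq R N w (rank_type i r)) * phi w.
have bG s : bmeas (fun pi => G s (initial_rank pi)).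
  apply: (@bmeas_depends R M) => w w' ww; rewrite /G (phiM _ _ ww).
  by rewrite !(depends_belowW NM (@type_freq_depends R N _) ww) !ww //; exact: leq_trans NM.
have -> : (fun pi => let w := initial_rank pi in
      ((w i == r)%:R * rank_norm i (type_freq R N w) - type_freq R N w (rank_type i r)) * phi w)
   = fun pi => \sum_(1 <= s < i.+2 | (1 <= s < i.+2)%N) G s (initial_rank pi).
  apply/funext => pi /=; rewrite -big_nat -mulr_suml sumrB -mulr_sumr; congr ((_ - _) * _).
  by rewrite -(sum_indicator (fun=> type_freq R N (initial_rank pi) (rank_type i r))
       (valid_initial_rank pi i)).
rewrite Ex_sum //; apply: le_trans (ler_norm_sum _ _ _) _.
set K := 4 * delta + _; apply: (@le_trans _ _ (\sum_(1 <= s < i.+2) K)); last first.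
  by rewrite sumr_const_nat subn1 mulr_natl.
rewrite [leRHS]big_nat; apply: ler_sum => s si.
exact: (Ex_freq_exchange exch iN NM vr si HN phiM phiC ophi).
Qed.

(** Position 2 has exactly one rank of each type. *)
Lemma rank_norm2 (t : option bool -> R) : in_simplex t -> rank_norm 2 t = 1.
Proof. by move=> st; rewrite rank_normE //= mul1r in_simplex_total. Qed.

(** The constants come from the three ranks at position 2: 12 = 3 * 4 and 18 = 3 * (2 + 4). *)
Lemma Ex_rank2_freq N M c (phi : (nat -> nat) -> R) C delta :
  (N <= M)%N -> 0 < harmonic_sum R N -> depends_below M phi ->
  (forall w, valid_ranks w -> `|phi w| <= C) -> osc_le 2 phi delta ->
  `|Ex P (fun pi => let w := initial_rank pi in
      ((w 2%N == rank_of_type 2 c)%:R - type_freq R N w c) * phi w)|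
  <= 12 * delta + 18 * (C / harmonic_sum R N).
Proof.
move=> NM HN phiM phiC ophi.
have := Ex_rank_freq (i := 2) _ NM (rank_of_type_bounds c _) HN phiM phiC ophi.
rewrite (harmonic_sum_gt0 HN) // => /(_ isT isT).
under eq_fun do rewrite /= rank_norm2 ?type_freq_simplex // mulr1 rank_of_typeK //.
by move=> /le_trans; apply; lra.
Qed.

Lemma type_freq_sub_bmeas N M c :
  bmeas (fun pi => type_freq R N (initial_rank pi) c - type_freq R M (initial_rank pi) c : R).
Proof. by apply: bmeasB; exact: type_freq_bmeas. Qed.

Lemma osc_sub i (phi psi : (nat -> nat) -> R) a b :
  osc_le i phi a -> osc_le i psi b -> osc_le i (fun w => phi w - psi w) (a + b).
Proof.
move=> oa ob w vw k r ik rk.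
rewrite (_ : _ - _ = (phi (upd1 k r w) - phi w) - (psi (upd1 k r w) - psi w)); last by ring.
by rewrite (le_trans (ler_normB _ _)) // lerD ?oa ?ob.
Qed.

Lemma osc_le_trans i (phi : (nat -> nat) -> R) a b : a <= b -> osc_le i phi a -> osc_le i phi b.
Proof. by move=> ab oa w vw k r ik rk; exact: le_trans (oa w vw k r ik rk) ab. Qed.

(** Against their difference [phi], both frequencies approximate the same indicator at position 2;
    subtracting the two estimates leaves the expectation of phi^2. With H the harmonic sum at [N],
    [phi] oscillates by at most 4 / H, so each estimate costs at most (12 * 4 + 18) / H = 66 / H. *)
Lemma type_freq_cauchy N M c : (N <= M)%N -> 0 < harmonic_sum R N ->
  Ex P (fun pi => (type_freq R N (initial_rank pi) c - type_freq R M (initial_rank pi) c) ^+ 2)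
  <= 132 / harmonic_sum R N.
Proof.
move=> NM HN; have HNM := harmonic_sum_mono R NM; have HM := lt_le_trans HN HNM.
pose phi w : R := type_freq R N w c - type_freq R M w c.
have phiM : depends_below M phi.
  by move=> w w' ww; rewrite /phi (depends_belowW NM (@type_freq_depends R N c) ww)
    (@type_freq_depends R M c _ _ ww).
have phi1 w : valid_ranks w -> `|phi w| <= 1.
  move=> _; rewrite ler_norml /phi.
  have := type_freq_ge0 HN c w; have := type_freq_le1 HN c w.
  have := type_freq_ge0 HM c w; have := type_freq_le1 HM c w; lra.
have invH : (harmonic_sum R M)^-1 <= (harmonic_sum R N)^-1 by rewrite lef_pV2 ?posrE.
have ophi : osc_le 2 phi (4 / harmonic_sum R N).
  apply: osc_le_trans (osc_sub (osc_type_freq HN (i := 2) c) (osc_type_freq HM (i := 2) c)); lra.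
have := Ex_rank2_freq c NM HN phiM phi1 ophi.
have := Ex_rank2_freq c (leqnn M) HM phiM phi1 ophi.
set f1 := (fun _ => _) => E1; set f2 := (fun _ => _) => E2.
have b1 : bmeas f1.
  apply: bmeasM; last exact: bmeas_depends phiM.
  apply: bmeasB; last exact: type_freq_bmeas.
  by apply: (@bmeas_depends R 3 (fun w => (w 2%N == rank_of_type 2 c)%:R)) => w w' ->.
have b2 : bmeas f2.
  apply: bmeasM; last exact: bmeas_depends phiM.
  apply: bmeasB; last exact: type_freq_bmeas.
  by apply: (@bmeas_depends R 3 (fun w => (w 2%N == rank_of_type 2 c)%:R)) => w w' ->.
have -> : (fun pi => (type_freq R N (initial_rank pi) c - type_freq R M (initial_rank pi) c) ^+ 2)
    = fun pi => f1 pi - f2 pi.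
  by apply/funext => pi; rewrite /f1 /f2 /= /phi; ring.
rewrite ExB //; move: E1 E2; rewrite !ler_norml => /andP[_ E1] /andP[E2 _].
by move: E1 E2; rewrite mulrA mulrCA; lra.
Qed.

(** The frequencies are partial sums of their increments between consecutive levels, whose L^2
    bounds give an almost surely convergent series. *)
Lemma type_freq_ae_cvg :
  {ae P, forall pi, forall c, type_freq R (level R k) (initial_rank pi) c @[k --> \oo] --> limit_freq pi c}.
Proof.
pose g c k pi : R := type_freq R (level R k.+1) (initial_rank pi) c
   - type_freq R (level R k) (initial_rank pi) c.
have gc c : {ae P, forall pi, cvgn (series (fun k => g c k pi))}.
  apply: (@ae_cvg_series _ _ R P (g c) 132) => k; first exact: type_freq_sub_bmeas.
  rewrite (_ : (fun pi => g c k pi ^+ 2) = fun pi => (type_freq R (level R k) (initial_rank pi) c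
     - type_freq R (level R k.+1) (initial_rank pi) c) ^+ 2); last first.
    by apply/funext => pi; rewrite /g; ring.
  apply: le_trans (type_freq_cauchy c (level_mono R k) (harmonic_level_gt0 R k)) _.
  by rewrite ler_pM2l // inv_harmonic_level.
have := gc (Some true); have := gc (Some false); have := gc None.
apply: filterS3 => pi c1 c2 c3.
have cv c : cvgn (fun k => type_freq R (level R k) (initial_rank pi) c : R).
  have : cvgn (series (fun k => g c k pi)) by case: c => [[]|].
  rewrite (_ : series _ = fun k => type_freq R (level R k) (initial_rank pi) c
     - type_freq R (level R 0) (initial_rank pi) c).
    move=> /cvg_ex[l lc]; apply/cvg_ex; exists (l + type_freq R (level R 0) (initial_rank pi) c).
    rewrite (_ : (fun k => _) = fun k => (type_freq R (level R k) (initial_rank pi) c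
     - type_freq R (level R 0) (initial_rank pi) c) + type_freq R (level R 0) (initial_rank pi) c).
      by apply: cvgD lc _; exact: cvg_cst.
    by apply/funext => k; rewrite subrK.
  by apply/funext => k; rewrite /series /= telescope_sumr.
move=> c; rewrite (@limit_freqE pi (fun c => limn (fun k => type_freq R (level R k) (initial_rank pi) c))) //.
Qed.

End Limit.

(** * Lipschitz test functions on the simplex of frequencies *)

Section TestFunctions.
Context (R : realType).
Implicit Types (t : option bool -> R) (phi : (option bool -> R) -> R).

Definition simplex_dist t t' : R :=
  `|t (Some true) - t' (Some true)| + `|t (Some false) - t' (Some false)| + `|t None - t' None|.

Lemma simplex_dist_ge0 t t' : 0 <= simplex_dist t t'.
Proof. by rewrite !addr_ge0. Qed.

Lemma simplex_dist_coord c t t' : `|t c - t' c| <= simplex_dist t t'.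
Proof.
rewrite /simplex_dist.
have := normr_ge0 (t (Some true) - t' (Some true)).
have := normr_ge0 (t (Some false) - t' (Some false)).
have := normr_ge0 (t None - t' None).
by case: c => [[]|]; lra.
Qed.

(** The Lipschitz bound gives slow variation along the frequencies. Measurability is expressed by
    composition with simplex-valued maps, which avoids a sigma-algebra on the functions
    [option bool -> R]. *)
Definition test_fun phi := [/\
  exists C, forall t, in_simplex t -> `|phi t| <= C,
  exists L, 0 <= L /\ forall t t', in_simplex t -> in_simplex t' ->
    `|phi t - phi t'| <= L * simplex_dist t t' &
  forall X : coherent_perm -> option bool -> R, (forall c, measurable_fun [set: coherent_perm] (X^~ c)) ->
    (forall pi, in_simplex (X pi)) -> measurable_fun [set: coherent_perm] (fun pi => phi (X pi))].

Lemma test_fun_cst a : test_fun (fun=> a).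
Proof.
split; first by exists `|a|.
- by exists 0; split=> // t t' _ _; rewrite subrr normr0 mul0r.
- by move=> X _ _; exact: measurable_cst.
Qed.

Lemma test_fun_coord c : test_fun (fun t => t c).
Proof.
split; first by exists 1 => t st; rewrite ger0_norm ?in_simplex_ge0 ?in_simplex_le1.
- by exists 1; split=> // t t' _ _; rewrite mul1r simplex_dist_coord.
- by move=> X mX _; exact: mX.
Qed.

Lemma test_funD phi psi : test_fun phi -> test_fun psi -> test_fun (fun t => phi t + psi t).
Proof.
move=> [[C pC] [L [L0 pL]] pm] [[C' qC] [L' [L'0 qL]] qm]; split.
- by exists (C + C') => t st; rewrite (le_trans (ler_normD _ _)) // lerD ?pC ?qC.
- exists (L + L'); split=> [|t t' st st']; first exact: addr_ge0.
  rewrite opprD addrACA (le_trans (ler_normD _ _)) // mulrDl lerD ?pL ?qL //.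
- by move=> X mX sX; apply: measurable_funD; [exact: pm|exact: qm].
Qed.

Lemma test_funM phi psi : test_fun phi -> test_fun psi -> test_fun (fun t => phi t * psi t).
Proof.
move=> [[C pC] [L [L0 pL]] pm] [[C' qC] [L' [L'0 qL]] qm]; split.
- by exists (C * C') => t st; rewrite normrM ler_pM ?pC ?qC.
- exists (`|C| * L' + `|C'| * L); split=> [|t t' st st'].
    by rewrite addr_ge0 // mulr_ge0.
  rewrite (_ : _ - _ = phi t * (psi t - psi t') + psi t' * (phi t - phi t')); last by ring.
  rewrite (le_trans (ler_normD _ _)) // !normrM mulrDl -!mulrA lerD //.
    by apply: ler_pM => //; [exact: le_trans (pC _ st) (ler_norm _)|exact: qL].
  by apply: ler_pM => //; [exact: le_trans (qC _ st') (ler_norm _)|exact: pL].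
- by move=> X mX sX; apply: measurable_funM; [exact: pm|exact: qm].
Qed.

Lemma test_fun_sum I (r : seq I) (F : I -> (option bool -> R) -> R) :
  (forall i, test_fun (F i)) -> test_fun (fun t => \sum_(i <- r) F i t).
Proof.
move=> tF; elim: r => [|i r IHr].
  by under eq_fun do rewrite big_nil; exact: test_fun_cst.
by under eq_fun do rewrite big_cons; exact: test_funD.
Qed.

Lemma test_fun_rank_norm i : test_fun (@rank_norm R i).
Proof. by apply: test_fun_sum => s; exact: test_fun_coord. Qed.

Lemma test_funV phi m : 0 < m -> (forall t, in_simplex t -> m <= phi t) ->
  test_fun phi -> test_fun (fun t => (phi t)^-1).
Proof.
move=> m0 pm [[C pC] [L [L0 pL]] pmeas].
have pos t : in_simplex t -> 0 < phi t by move=> st; exact: lt_le_trans m0 (pm _ st).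
have inv t : in_simplex t -> (phi t)^-1 <= m^-1.
  by move=> st; rewrite lef_pV2 ?posrE ?pos ?pm.
split.
- by exists m^-1 => t st; rewrite ger0_norm ?inv // invr_ge0 ltW ?pos.
- exists (m^-1 * m^-1 * L); split=> [|t t' st st'].
    by rewrite mulr_ge0 // mulr_ge0 // invr_ge0 ltW.
  have -> : (phi t)^-1 - (phi t')^-1 = (phi t)^-1 * (phi t')^-1 * (phi t' - phi t).
    by field; rewrite !gt_eqF ?pos.
  rewrite normrM distrC -[leRHS]mulrA; apply: ler_pM => //; last exact: pL.
  have [i1 i2] : 0 <= (phi t)^-1 /\ 0 <= (phi t')^-1 by rewrite !invr_ge0 !ltW ?pos.
  by rewrite ger0_norm ?mulr_ge0 // ler_pM // inv.
- move=> X mX sX; rewrite (_ : (fun pi => _) = fun pi => (@powR R)^~ (-1) (phi (X pi))).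
    by apply: (measurableT_comp (measurable_powR (-1))); exact: pmeas.
  by apply/funext => pi; rewrite /= powR_inv1 // ltW // pos.
Qed.

(** The factor 6 is an oscillation of 2 for each of the three frequencies. *)
Lemma test_fun_osc phi : test_fun phi -> exists2 K, 0 <= K & forall N, 0 < harmonic_sum R N ->
  forall i, osc_le i (fun w => phi (type_freq R N w)) (K / harmonic_sum R N).
Proof.
move=> [_ [L [L0 pL]] _]; exists (L * 6); first by rewrite mulr_ge0.
move=> N HN i w vw k a ik ak.
apply: le_trans (pL _ _ (type_freq_simplex _ HN) (type_freq_simplex _ HN)) _.
rewrite -mulrA ler_wpM2l // /simplex_dist.
have o c := osc_type_freq HN c vw ik ak.
by have := o (Some true); have := o (Some false); have := o None; lra.
Qed.

Lemma test_fun_bmeas phi : test_fun phi -> bmeas (fun pi => phi (@limit_freq R pi)).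
Proof.
move=> [[C pC] _ pm]; split; first by apply: pm => [c|pi]; [exact: limit_freq_measurable|exact: limit_freq_simplex].
by exists C => pi; rewrite pC // limit_freq_simplex.
Qed.

Lemma test_fun_bmeasN phi N : 0 < harmonic_sum R N -> test_fun phi ->
  bmeas (fun pi => phi (type_freq R N (initial_rank pi))).
Proof.
move=> HN [[C pC] _ pm]; split.
  by apply: pm => [c|pi]; [case: (@type_freq_bmeas R N c)|exact: type_freq_simplex].
by exists C => pi; rewrite pC // type_freq_simplex.
Qed.

(** The probability of rank [r] at position [i] given limiting frequencies [t]. At position 1 the
    denominator may be 0, and the quotient is then 0 by convention. *)
Definition rank_ratio i r t : R := t (rank_type i r) / rank_norm i t.

(** From position 2 on all types occur among the ranks, so the total frequency 1 is a lower bound;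
    this is what makes [rank_ratio] a test function there. *)
Lemma rank_norm_ge1 i t : (1 < i)%N -> in_simplex t -> 1 <= rank_norm i t.
Proof.
move=> i1 st; rewrite rank_normE ?(ltnW i1) // -[leLHS](in_simplex_total st) lerD2l.
by rewrite ler_peMl ?in_simplex_ge0 // ler1n; lia.
Qed.

Lemma test_fun_rank_ratio i r : (1 < i)%N -> test_fun (rank_ratio i r).
Proof.
move=> i1; apply: test_funM; first exact: test_fun_coord.
apply: (@test_funV _ 1) => //; last exact: test_fun_rank_norm.
by move=> t; exact: rank_norm_ge1.
Qed.

End TestFunctions.

(** * Conditional law of the ranks given the limiting frequencies *)

Section LimitIdentities.
Context (R : realType) (P : probability coherent_perm R).
Hypothesis exch : type_exchangeable P.
Implicit Types (phi : (option bool -> R) -> R).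
Local Notation lfreq := (@limit_freq R).

Lemma Ex_test_cvg phi (G : coherent_perm -> R) : test_fun phi -> bmeas G ->
  Ex P (fun pi => G pi * phi (type_freq R (level R k) (initial_rank pi))) @[k --> \oo] -->
  Ex P (fun pi => G pi * phi (lfreq pi)).
Proof.
move=> tphi bG; have [[C pC] [L [L0 pL]] _] := tphi; have [_ [D GD]] := bG.
apply: (@Ex_bounded_cvg _ _ R P _ _ (D * C)) => [k||k pi|].
- by apply: bmeasM => //; apply: test_fun_bmeasN => //; exact: harmonic_level_gt0.
- by apply: bmeasM => //; exact: test_fun_bmeas.
- by rewrite normrM ler_pM // pC // type_freq_simplex // harmonic_level_gt0.
apply: filterS (type_freq_ae_cvg exch) => pi cv.
apply: cvgM; first exact: cvg_cst.
apply/cvgrPdist_le => e e0.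
pose f c k := type_freq R (level R k) (initial_rank pi) c.
have dcv : L * simplex_dist (lfreq pi) (fun c => f c k) @[k --> \oo] --> 0.
  rewrite -(mulr0 L); apply: cvgM; first exact: cvg_cst.
  have d0 c : `|lfreq pi c - f c k| @[k --> \oo] --> (0 : R).
    rewrite -(normr0 R) -(subrr (lfreq pi c)); apply: cvg_norm.
    by apply: cvgB; [exact: cvg_cst|exact: cv].
  have := cvgD (cvgD (d0 (Some true)) (d0 (Some false))) (d0 None).
  by rewrite !addr0; apply.
have /cvgrPdist_le /(_ e e0) := dcv.
apply: filterS => k; rewrite sub0r normrN ger0_norm; last first.
  by rewrite mulr_ge0 // simplex_dist_ge0.
apply: le_trans; apply: pL; first exact: limit_freq_simplex.
exact: type_freq_simplex (harmonic_level_gt0 _ _).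
Qed.

Lemma cvg_to_0_level (u : nat -> R) K k0 :
  (forall k, (k0 <= k)%N -> `|u k| <= K / harmonic_sum R (level R k)) -> 0 <= K ->
  u k @[k --> \oo] --> 0.
Proof.
move=> uK K0; apply: norm_cvg0.
apply: (@squeeze_cvgr _ _ _ _ (fun=> 0) (fun k => K * (8^-1) ^+ k)).
- exists k0 => // k /= k0k; rewrite normr_ge0 /= (le_trans (uK k k0k)) //.
  by rewrite ler_wpM2l // exprVn inv_harmonic_level.
- exact: cvg_cst.
- rewrite -(mulr0 K); apply: cvgM; first exact: cvg_cst.
apply: cvg_expr.
  by rewrite ger0_norm // invf_lt1 // ltr1n.
Qed.

(** The limit of [Ex_rank_freq] along the levels. The factor [G] looks only at positions before [i]
    and adds nothing to the oscillation. The normalization stays on the left, undivided, because it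
    may vanish at position 1. *)
Lemma Ex_limit_freq i r (G : (nat -> nat) -> R) phi : (0 < i)%N -> (0 < r <= i.+1)%N ->
  depends_below i G -> (forall w, `|G w| <= 1) -> test_fun phi ->
  Ex P (fun pi => (initial_rank pi i == r)%:R * G (initial_rank pi)
     * (rank_norm i (lfreq pi) * phi (lfreq pi))) =
  Ex P (fun pi => G (initial_rank pi) * (lfreq pi (rank_type i r) * phi (lfreq pi))).
Proof.
move=> i0 vr Gi G1 tphi.
have bG : bmeas (fun pi => G (initial_rank pi)) by exact: bmeas_depends Gi.
have bI : bmeas (fun pi => (initial_rank pi i == r)%:R : R).
  by apply: (@bmeas_depends R i.+1 (fun w => (w i == r)%:R)) => w w' ->.
pose phi1 t := rank_norm i t * phi t.
pose phi2 t := t (rank_type i r) * phi t.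
have t1 : test_fun phi1 by apply: test_funM => //; exact: test_fun_rank_norm.
have t2 : test_fun phi2 by apply: test_funM => //; exact: test_fun_coord.
have c1 := Ex_test_cvg t1 (bmeasM bI bG).
have c2 := Ex_test_cvg t2 bG.
apply/eqP; rewrite -subr_eq0; apply/eqP.
apply: cvg_unique (cvgB c1 c2) _; first exact: norm_hausdorff.
have [[C pC] _ _] := tphi; have [K K0 oK] := test_fun_osc tphi.
have [k0 hk0] := level_unbounded R i.
have C0 : 0 <= C.
  apply: le_trans (pC (fun c => (c == None)%:R) _); first exact: normr_ge0.
  by rewrite /in_simplex /= !lexx ler01 !add0r eqxx.
pose K' := (i.+1)%:R * (4 * K + (i.+4)%:R * C).
apply: (@cvg_to_0_level _ K' k0); last by rewrite mulr_ge0 // addr_ge0 // mulr_ge0.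
move=> k k0k; set N := level R k; have HN : 0 < harmonic_sum R N by exact: harmonic_level_gt0.
have iN : (0 < i < N)%N by rewrite i0 hk0.
pose psi w := G w * phi (type_freq R N w).
have psiN : depends_below N psi.
  move=> w w' ww; rewrite /psi (Gi w w') => [|j ji]; last by apply: ww; case/andP: iN => _; exact: ltn_trans.
  by congr (_ * phi _); apply/funext => c; apply: (@type_freq_depends R N c).
have psiC w : valid_ranks w -> `|psi w| <= C.
  move=> _; rewrite normrM -[C]mul1r ler_pM // pC //; exact: type_freq_simplex.
have opsi : osc_le i psi (K / harmonic_sum R N).
  move=> w vw j a ij aj; rewrite /psi (Gi (upd1 j a w) w) => [|l li]; last first.
    by rewrite /upd1; case: eqP => // lj; lia.
  rewrite -mulrBr normrM -[leRHS]mul1r ler_pM //; exact: (oK N HN i w vw j a ij aj).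
have := Ex_rank_freq exch iN (leqnn N) vr HN psiN psiC opsi.
have b1 : bmeas (fun pi => (initial_rank pi i == r)%:R * G (initial_rank pi) *
     phi1 (type_freq R N (initial_rank pi))).
  by apply: bmeasM; [exact: bmeasM|exact: test_fun_bmeasN].
have b2 : bmeas (fun pi => G (initial_rank pi) * phi2 (type_freq R N (initial_rank pi))).
  by apply: bmeasM => //; exact: test_fun_bmeasN.
rewrite /= -ExB // (_ : (fun pi => _) = fun pi => (initial_rank pi i == r)%:R * G (initial_rank pi) *
     phi1 (type_freq R N (initial_rank pi)) - G (initial_rank pi) * phi2 (type_freq R N (initial_rank pi))).
  move/le_trans; apply; rewrite /K' -mulrA ler_wpM2l //; lra.
by apply/funext => pi /=; rewrite /phi1 /phi2 /psi; ring.
Qed.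

(** From position 2 on the inverse of the normalization is itself a test function and can be
    inserted into [Ex_limit_freq]. *)
Lemma Ex_peel i r (G : (nat -> nat) -> R) phi : (1 < i)%N -> (0 < r <= i.+1)%N ->
  depends_below i G -> (forall w, `|G w| <= 1) -> test_fun phi ->
  Ex P (fun pi => (initial_rank pi i == r)%:R * G (initial_rank pi) * phi (lfreq pi)) =
  Ex P (fun pi => G (initial_rank pi) * (rank_ratio i r (lfreq pi) * phi (lfreq pi))).
Proof.
move=> i1 vr Gi G1 tphi.
have tinv : test_fun (fun t => (rank_norm i t)^-1 : R).
  apply: (@test_funV _ _ 1) => //; last exact: test_fun_rank_norm.
  by move=> t; exact: rank_norm_ge1.
have := Ex_limit_freq (ltnW i1) vr Gi G1 (test_funM tinv tphi).
set a := Ex _ _ => e; rewrite -[LHS]/(Ex P _); transitivity a.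
  congr Ex; apply/funext => pi; congr (_ * _); rewrite mulVKf // gt_eqF //.
  exact: lt_le_trans ltr01 (rank_norm_ge1 i1 (limit_freq_simplex _ _)).
rewrite e; congr Ex; apply/funext => pi; congr (_ * _).
by rewrite /rank_ratio mulrA.
Qed.

Definition ranks_agree m (w : nat -> nat) pi : R :=
  \prod_(0 <= j < m) (initial_rank pi j == w j)%:R.

Lemma ranks_agreeE m w pi : ranks_agree m w pi = \1_(rank_cylinder m w) pi.
Proof.
rewrite /ranks_agree indicE; have [pw|pw] := pselect (rank_cylinder m w pi).
  by rewrite mem_set // big_nat big1 // => j /andP[_ jm]; rewrite pw ?eqxx.
rewrite memNset //; apply/eqP; rewrite prodf_seq_eq0; apply/hasP.
have /existsNP[j /not_implyP[jm /eqP jw]] := pw.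
by exists j; rewrite ?mem_index_iota //= (negPf jw).
Qed.

(** Positions are peeled from the last one down, each ratio being absorbed into the test function.
    The process stops at position 2, the last whose normalization is bounded below, and leaves the
    indicator of the second rank. *)
Lemma Ex_peel_all m w phi : valid_ranks w -> test_fun phi ->
  Ex P (fun pi => ranks_agree m.+2 w pi * phi (lfreq pi)) =
  Ex P (fun pi => (initial_rank pi 1 == w 1%N)%:R *
    (\prod_(2 <= j < m.+2) rank_ratio j (w j) (lfreq pi) * phi (lfreq pi))).
Proof.
move=> vw; elim: m phi => [|m IHm] phi tphi.
  congr Ex; apply/funext => pi; rewrite /ranks_agree big_nat_recr //= big_nat1.
  rewrite [\prod_(2 <= _ < 2) _]big_geq // mul1r (_ : initial_rank pi 0 == w 0%N) ?mul1r //.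
  by have := vw 0%N; have := valid_initial_rank pi 0%N; lia.
transitivity (Ex P (fun pi => (initial_rank pi m.+2 == w m.+2)%:R
    * ranks_agree m.+2 w pi * phi (lfreq pi))).
  by congr Ex; apply/funext => pi; rewrite /ranks_agree big_nat_recr //= [X in X * _]mulrC.
rewrite (@Ex_peel _ _ (fun v => \prod_(0 <= j < m.+2) (v j == w j)%:R)) //.
- rewrite (IHm (fun t => rank_ratio m.+2 (w m.+2) t * phi t)); last first.
    by apply: test_funM => //; exact: test_fun_rank_ratio.
  by congr Ex; apply/funext => pi; congr (_ * _); rewrite [in RHS]big_nat_recr //= mulrA.
- by move=> v v' vv; rewrite !big_nat; apply: eq_bigr => j /andP[_ jm]; rewrite vv.
- move=> v; apply: (big_ind (fun x : R => `|x| <= 1)) => [|x y x1 y1|j _].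
  + by rewrite normr1.
  + by rewrite normrM -[1]mulr1 ler_pM.
  + by case: (_ == _); rewrite ?normr1 ?normr0 ?lexx ?ler01.
Qed.

End LimitIdentities.

(** * The second rank, and types with equal frequencies *)

Section SecondRank.
Context (R : realType) (P : probability coherent_perm R).
Hypothesis exch : type_exchangeable P.
Implicit Types (phi : (option bool -> R) -> R).
Local Notation lfreq := (@limit_freq R).

Lemma rank_norm1 (t : option bool -> R) : rank_norm 1 t = t (Some true) + t (Some false).
Proof. by rewrite rank_normE // mul0r addr0. Qed.

Lemma rank_type1 r : (0 < r <= 2)%N -> exists b, rank_type 1 r = Some b.
Proof.
by case: r => [|[|[|]]] // _; [exists true|exists false].
Qed.

Lemma rank_norm1_ge (t : option bool -> R) r : in_simplex t -> (0 < r <= 2)%N ->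
  0 <= t (rank_type 1 r) <= rank_norm 1 t.
Proof.
move=> st /rank_type1[b ->]; rewrite in_simplex_ge0 // rank_norm1.
by case: b; rewrite ?lerDl ?lerDr in_simplex_ge0.
Qed.

Lemma rank_norm1_ge0 (t : option bool -> R) : in_simplex t -> 0 <= rank_norm 1 t.
Proof. by move=> st; rewrite rank_norm1 addr_ge0 ?in_simplex_ge0. Qed.

(** This ratio is not Lipschitz where its denominator tends to 0, hence not a test function; it is
    bounded because its numerator is a summand of its denominator. *)
Lemma rank_ratio1_bmeas r : (0 < r <= 2)%N -> bmeas (fun pi => rank_ratio 1 r (lfreq pi)).
Proof.
move=> vr; split.
  apply: measurable_funM; first exact: limit_freq_measurable.
  rewrite (_ : (fun pi => _) = fun pi => (@powR R)^~ (-1) (rank_norm 1 (lfreq pi))).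
    apply: (measurableT_comp (measurable_powR (-1))).
    by case: (test_fun_bmeas (test_fun_rank_norm R 1)).
  by apply/funext => pi; rewrite /= powR_inv1 // rank_norm1_ge0 // limit_freq_simplex.
exists 1 => pi; have st := limit_freq_simplex R pi.
have /andP[t0 t1] := rank_norm1_ge st vr.
rewrite /rank_ratio ger0_norm ?divr_ge0 ?rank_norm1_ge0 //.
have [->|n0] := eqVneq (rank_norm 1 (lfreq pi)) 0; first by rewrite invr0 mulr0.
by rewrite ler_pdivrMr ?mul1r // lt_neqAle eq_sym n0 rank_norm1_ge0.
Qed.

Lemma rank_eq_bmeas i r : bmeas (fun pi : coherent_perm => (initial_rank pi i == r)%:R : R).
Proof. by apply: (@bmeas_depends R i.+1 (fun w => (w i == r)%:R)) => w w' ->. Qed.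

Lemma bmeas_norm1_eq0 : bmeas (fun pi => (rank_norm 1 (lfreq pi) == 0)%:R : R).
Proof.
have m : measurable_fun [set: coherent_perm] (fun pi => rank_norm 1 (lfreq pi) == 0).
  apply: measurable_fun_eqr; last exact: measurable_cst.
  by case: (test_fun_bmeas (test_fun_rank_norm R 1)).
rewrite (_ : (fun pi => _) = fun pi => if rank_norm 1 (lfreq pi) == 0 then 1 else 0 : R).
  split; first by apply: measurable_fun_ifT => //; exact: measurable_cst.
  by exists 1 => pi; case: ifP; rewrite ?normr1 ?normr0.
by apply/funext => pi; case: ifP.
Qed.

Lemma bmeas_norm1_neq0 : bmeas (fun pi => (rank_norm 1 (lfreq pi) != 0)%:R : R).
Proof.
rewrite (_ : (fun pi => _) = fun pi => 1 - (rank_norm 1 (lfreq pi) == 0)%:R : R).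
  by apply: bmeasB; [exact: bmeas_cst|exact: bmeas_norm1_eq0].
by apply/funext => pi; case: eqP; rewrite ?subrr ?subr0.
Qed.

Lemma cvg_regularized_ratio (x : R) : 0 <= x ->
  x / (x + k.+1%:R^-1) @[k --> \oo] --> ((x != 0)%:R : R).
Proof.
rewrite le_eqVlt => /predU1P[<-|x0].
  by under eq_fun do rewrite mul0r; rewrite eqxx; exact: cvg_cst.
rewrite gt_eqF //= -[X in _ --> X](@divff _ x) ?gt_eqF //.
apply: cvgM; first exact: cvg_cst.
apply: cvgV; first by rewrite gt_eqF.
rewrite -[X in _ --> X]addr0; apply: cvgD; first exact: cvg_cst.
exact: cvg_harmonic.
Qed.

(* Regularize the denominator, which may vanish. *)
Lemma Ex_peel1 r phi : (0 < r <= 2)%N -> test_fun phi ->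
  Ex P (fun pi => (initial_rank pi 1 == r)%:R * ((rank_norm 1 (lfreq pi) != 0)%:R * phi (lfreq pi))) =
  Ex P (fun pi => rank_ratio 1 r (lfreq pi) * phi (lfreq pi)).
Proof.
move=> vr tphi; have [[C pC] _ _] := tphi.
pose d (k : nat) (t : option bool -> R) : R := rank_norm 1 t + k.+1%:R^-1.
have dpos k t : in_simplex t -> (k.+1%:R)^-1 <= d k t.
  by move=> st; rewrite lerDr rank_norm1_ge0.
have kpos (k : nat) : 0 < (k.+1%:R)^-1 :> R by rewrite invr_gt0.
have td k : test_fun (d k).
  by apply: test_funD; [exact: test_fun_rank_norm|exact: test_fun_cst].
have tdV k : test_fun (fun t => (d k t)^-1).
  by apply: (test_funV (kpos k)) => // t; exact: dpos.
have ts k : test_fun (fun t => (d k t)^-1 * phi t) by exact: test_funM.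
have e k := @Ex_limit_freq R P exch 1 r (fun=> 1) _ isT vr (fun _ _ _ => erefl)
  (fun=> eq_ind_r (fun x => x <= 1) (lexx 1) (normr1 R)) (ts k).
have bphi := test_fun_bmeas tphi.
have bI := rank_eq_bmeas 1 r.
have dgt k pi : 0 < d k (lfreq pi).
  by apply: lt_le_trans (kpos k) _; exact/dpos/limit_freq_simplex.
have le1 k pi : 0 <= rank_norm 1 (lfreq pi) / d k (lfreq pi) <= 1.
  have n0 := rank_norm1_ge0 (limit_freq_simplex R pi).
  rewrite divr_ge0 ?(ltW (dgt k pi)) //= ler_pdivrMr // mul1r lerDl ltW //.
have le2 k pi : `|lfreq pi (rank_type 1 r) / d k (lfreq pi)| <= 1.
  have /andP[t0 t1] := rank_norm1_ge (limit_freq_simplex R pi) vr.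
  rewrite ger0_norm ?divr_ge0 ?(ltW (dgt k pi)) //= ler_pdivrMr // mul1r.
  by rewrite (le_trans t1) // lerDl ltW.
have c1 : Ex P (fun pi => (initial_rank pi 1 == r)%:R * 1
     * (rank_norm 1 (lfreq pi) * ((d k (lfreq pi))^-1 * phi (lfreq pi)))) @[k --> \oo] -->
   Ex P (fun pi => (initial_rank pi 1 == r)%:R * ((rank_norm 1 (lfreq pi) != 0)%:R * phi (lfreq pi))).
  apply: (@Ex_bounded_cvg _ _ R P _ _ C) => [k||k pi|].
  - apply: bmeasM; first by apply: bmeasM => //; exact: bmeas_cst.
    apply: bmeasM; first exact: test_fun_bmeas (test_fun_rank_norm R 1).
    exact: test_fun_bmeas (ts k).
  - by apply: bmeasM => //; apply: bmeasM => //; exact: bmeas_norm1_neq0.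
  - have /andP[l0 l1] := le1 k pi; have C1 := pC _ (limit_freq_simplex R pi).
    rewrite mulr1 [X in _ * X]mulrA normrM -[C]mul1r ler_pM //.
      by case: (_ == _); rewrite ?normr1 ?normr0.
    by rewrite normrM -[C]mul1r ler_pM // ger0_norm.
  - apply: aeW => pi; rewrite mulr1; apply: cvgM; first exact: cvg_cst.
    under eq_fun do rewrite mulrA; apply: cvgM; last exact: cvg_cst.
    by apply: cvg_regularized_ratio; rewrite rank_norm1_ge0 ?limit_freq_simplex.
have c2 : Ex P (fun pi => 1 * (lfreq pi (rank_type 1 r) * ((d k (lfreq pi))^-1 * phi (lfreq pi))))
     @[k --> \oo] --> Ex P (fun pi => rank_ratio 1 r (lfreq pi) * phi (lfreq pi)).
  apply: (@Ex_bounded_cvg _ _ R P _ _ C) => [k||k pi|].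
  - apply: bmeasM; first exact: bmeas_cst.
    apply: bmeasM; first exact: limit_freq_bmeas.
    exact: test_fun_bmeas (ts k).
  - by apply: bmeasM => //; exact: rank_ratio1_bmeas.
  - by rewrite mul1r mulrA normrM -[C]mul1r ler_pM // pC // limit_freq_simplex.
  - apply: aeW => pi; under eq_fun do rewrite mul1r mulrA; apply: cvgM; last exact: cvg_cst.
    have st := limit_freq_simplex R pi.
    rewrite /rank_ratio; have [n0|n0] := eqVneq (rank_norm 1 (lfreq pi)) 0.
      have /andP[t0 t1] := rank_norm1_ge st vr.
      have -> : lfreq pi (rank_type 1 r) = 0 by apply/eqP; rewrite eq_le t0 -n0 t1.
      by under eq_fun do rewrite mul0r; rewrite mul0r; exact: cvg_cst.
    apply: cvgM; first exact: cvg_cst.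
    apply: cvgV => //; rewrite -[X in _ --> X]addr0; apply: cvgD; first exact: cvg_cst.
    exact: cvg_harmonic.
rewrite (funext e) in c1; exact: (@cvg_unique R^o (@norm_hausdorff _ _) _ _ _ _ c1 c2).
Qed.

Lemma test_fun_prod_ratio m (w : nat -> nat) :
  test_fun (fun t : option bool -> R => \prod_(2 <= j < m.+2) rank_ratio j (w j) t).
Proof.
elim: m => [|m IHm].
  by under eq_fun do rewrite big_geq //; exact: test_fun_cst.
under eq_fun do rewrite big_nat_recr //=.
by apply: test_funM => //; exact: test_fun_rank_ratio.
Qed.

(** Where the record frequencies do not both vanish, [Ex_peel1] replaces the indicator of the second
    rank by its ratio. On the remaining event the ratio is 0 and the indicator is kept as it is. *)
Lemma cylinder_prob_limit m w : valid_ranks w ->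
  cylinder_prob P m.+2 w = Ex P (fun pi =>
    (rank_ratio 1 (w 1%N) (lfreq pi)
      + (initial_rank pi 1 == w 1%N)%:R * (rank_norm 1 (lfreq pi) == 0)%:R)
    * \prod_(2 <= j < m.+2) rank_ratio j (w j) (lfreq pi)).
Proof.
move=> vw; pose h (t : option bool -> R) := \prod_(2 <= j < m.+2) rank_ratio j (w j) t.
have th : test_fun h by exact: test_fun_prod_ratio.
have v1 : (0 < w 1%N <= 2)%N by exact: vw.
have bh := test_fun_bmeas th; have bI := rank_eq_bmeas 1 (w 1%N).
transitivity (Ex P (fun pi => (initial_rank pi 1 == w 1%N)%:R * h (lfreq pi))).
  transitivity (Ex P (fun pi => ranks_agree R m.+2 w pi * 1)).
    apply: EFin_inj; under eq_fun do rewrite mulr1 ranks_agreeE.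
    by rewrite Ex_indic ?cylinder_probE //; exact: measurable_rank_cylinder.
  rewrite (@Ex_peel_all R P exch m w (fun=> 1)) //; last exact: test_fun_cst.
  by congr Ex; apply/funext => pi; rewrite mulr1.
transitivity (Ex P (fun pi => (initial_rank pi 1 == w 1%N)%:R * ((rank_norm 1 (lfreq pi) != 0)%:R * h (lfreq pi)))
  + Ex P (fun pi => (initial_rank pi 1 == w 1%N)%:R * (rank_norm 1 (lfreq pi) == 0)%:R * h (lfreq pi))).
  rewrite -ExD.
  - by congr Ex; apply/funext => pi; case: (rank_norm _ _ == 0); rewrite /=; ring.
  - by apply: bmeasM => //; apply: bmeasM => //; exact: bmeas_norm1_neq0.
  - by apply: bmeasM => //; apply: bmeasM => //; exact: bmeas_norm1_eq0.
rewrite Ex_peel1 // -ExD.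
- by congr Ex; apply/funext => pi; rewrite mulrDl.
- by apply: bmeasM => //; exact: rank_ratio1_bmeas.
- by apply: bmeasM => //; apply: bmeasM => //; exact: bmeas_norm1_eq0.
Qed.

(** The situation of a statistic that does not distinguish the types [c] and [c']: a single rank may
    be changed, with no compensation elsewhere. *)
Definition type_symmetric (c c' : option bool) := forall N i r s w,
  (0 < i)%N -> (i < N)%N -> (0 < r <= i.+1)%N -> (0 < s <= i.+1)%N ->
  rank_type i r = c -> rank_type i s = c' -> valid_ranks w ->
  cylinder_prob P N (upd1 i r w) = cylinder_prob P N (upd1 i s w).

Lemma update_pred1 i a w : update (pred1 i) a w = upd1 i (a i) w.
Proof. by apply/funext => k; rewrite /update /upd1 /=; case: eqP => [->|]. Qed.

(** Freezing the coordinate [i] inside the frequencies makes the symmetry applicable, at a cost that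
    vanishes along the levels. *)
Lemma Ex_symmetric c c' i r s phi : type_symmetric c c' -> (0 < i)%N ->
  (0 < r <= i.+1)%N -> (0 < s <= i.+1)%N -> rank_type i r = c -> rank_type i s = c' ->
  test_fun phi ->
  Ex P (fun pi => (initial_rank pi i == r)%:R * phi (lfreq pi)) =
  Ex P (fun pi => (initial_rank pi i == s)%:R * phi (lfreq pi)).
Proof.
move=> sym i0 vr vs tr ts tphi.
have b u := rank_eq_bmeas i u.
apply/eqP; rewrite -subr_eq0; apply/eqP.
apply: cvg_unique (cvgB (Ex_test_cvg exch tphi (b r)) (Ex_test_cvg exch tphi (b s))) _;
  first exact: norm_hausdorff.
have [K K0 oK] := test_fun_osc tphi.
have [k0 hk0] := level_unbounded R i.
apply: (@cvg_to_0_level R _ (K + K) k0); last by rewrite addr_ge0.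
move=> k k0k; set N := level R k; have HN : 0 < harmonic_sum R N by exact: harmonic_level_gt0.
have iN : (i < N)%N by exact: hk0.
pose psi w := phi (type_freq R N w).
have psiN : depends_below N psi.
  by move=> w w' ww; congr phi; apply/funext => x; exact: (@type_freq_depends R N x).
pose psi1 w := psi (upd1 i 1 w).
have psi1N : depends_below N psi1.
  by move=> w w' ww; apply: psiN => j jN; rewrite /upd1; case: eqP => // _; exact: ww.
have bpsi := bmeas_depends psiN; have bpsi1 := bmeas_depends psi1N.
have E1 : Ex P (fun pi => (initial_rank pi i == r)%:R * psi1 (initial_rank pi))
        = Ex P (fun pi => (initial_rank pi i == s)%:R * psi1 (initial_rank pi)).
  pose a u : nat -> nat := fun k => if k == i then u else 1%N.
  have va u : (0 < u <= i.+1)%N -> valid_ranks (a u).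
    by move=> vu j; rewrite /a; case: eqP => [->|].
  have aE u w : agrees N (pred1 i) (a u) w = (w i == u).
    apply/agreesP/eqP => [->|wi j _ /eqP ->] //=; first by rewrite /a eqxx.
    by rewrite /a eqxx.
  have := @Ex_exchange R P N (pred1 i) (a r) (a s) psi1 (va r vr) (va s vs) psi1N.
  have aE' u : (fun pi => (agrees N (pred1 i) (a u) (initial_rank pi))%:R * psi1 (initial_rank pi))
    = fun pi => (initial_rank pi i == u)%:R * psi1 (initial_rank pi).
    by apply/funext => pi; rewrite aE.
  rewrite !aE'; apply.
  - move=> w w' ww; congr psi; apply/funext => j; rewrite /upd1.
    by case: eqP => // /eqP /ww.
  - by move=> w vw; rewrite !update_pred1 /a eqxx; apply: sym.
have D u : (0 < u <= i.+1)%N ->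
   `|Ex P (fun pi => (initial_rank pi i == u)%:R * psi (initial_rank pi))
      - Ex P (fun pi => (initial_rank pi i == u)%:R * psi1 (initial_rank pi))| <= K / harmonic_sum R N.
  move=> vu; rewrite -ExB; [|exact: bmeasM|exact: bmeasM].
  rewrite -[leRHS](Ex_cst P); apply: Ex_norm_le => [||pi].
  - by apply: bmeasB; exact: bmeasM.
  - exact: bmeas_cst.
  rewrite -mulrBr normrM -[leRHS]mul1r ler_pM //.
    by case: (_ == _); rewrite ?normr1 ?normr0.
  by rewrite distrC; exact: (oK N HN i _ (valid_initial_rank pi) i 1%N (leqnn i) isT).
have := D r vr; have := D s vs; rewrite -E1.
set x := Ex _ _; set y := Ex _ _; set z := Ex _ _ => d1 d2.
rewrite (_ : _ - _ = (z - y) - (x - y)); last by rewrite /= -/x -/z; ring.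
by rewrite (le_trans (ler_normB _ _)) // mulrDl lerD.
Qed.

(** Take the difference of the two frequencies as test function. At position 2 its products with the
    two frequencies have the expectations of its products with the two indicators, which agree by
    symmetry; so its square has expectation 0. *)
Lemma limit_freq_symmetric c c' : type_symmetric c c' ->
  {ae P, forall pi, lfreq pi c = lfreq pi c'}.
Proof.
move=> sym; pose phi (t : option bool -> R) := t c - t c'.
have tphi : test_fun phi.
  rewrite /phi (_ : (fun t => _) = fun t => t c + (-1) * t c'); last by apply/funext => t; ring.
  apply: test_funD; first exact: test_fun_coord.
  by apply: test_funM; [exact: test_fun_cst|exact: test_fun_coord].
have key x : Ex P (fun pi => (initial_rank pi 2 == rank_of_type 2 x)%:R * phi (lfreq pi))
   = Ex P (fun pi => lfreq pi x * phi (lfreq pi)).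
  have vx := @rank_of_type_bounds 2 x isT.
  have := @Ex_peel R P exch 2 _ (fun=> 1) phi isT vx (fun _ _ _ => erefl)
   (fun=> eq_ind_r (fun x => x <= 1) (lexx 1) (normr1 R)) tphi.
  under eq_fun do rewrite mulr1; move=> ->; congr Ex; apply/funext => pi.
  rewrite mul1r /rank_ratio rank_of_typeK // rank_norm2 ?divr1 //; exact: limit_freq_simplex.
have e : Ex P (fun pi => lfreq pi c * phi (lfreq pi)) = Ex P (fun pi => lfreq pi c' * phi (lfreq pi)).
  rewrite -!key; apply: (Ex_symmetric sym) => //; rewrite ?rank_of_typeK //;
  exact: rank_of_type_bounds.
have bphi := test_fun_bmeas tphi.
have : Ex P (fun pi => phi (lfreq pi) ^+ 2) = 0.
  transitivity (Ex P (fun pi => lfreq pi c * phi (lfreq pi)) - Ex P (fun pi => lfreq pi c' * phi (lfreq pi))).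
    rewrite -ExB; [|by apply: bmeasM => //; exact: limit_freq_bmeas..].
    by congr Ex; apply/funext => pi; rewrite /phi; ring.
  by rewrite e subrr.
move=> /(Ex_sq_eq0 bphi); apply: filterS => pi /eqP.
by rewrite subr_eq0 => /eqP.
Qed.

End SecondRank.

(** * Independent ranks with prescribed distributions *)

Lemma law_exists d d' (T : measurableType d) (T' : measurableType d') (R : realType)
    (P : probability T R) (f : T -> T') : measurable_fun [set: T] f ->
  exists mu : probability T' R, (forall A, mu A = P (f @^-1` A)) /\
    (forall g : T' -> \bar R, measurable_fun [set: T'] g -> (forall y, 0 <= g y)%E ->
      \int[mu]_y g y = \int[P]_x g (f x))%E.
Proof.
move=> mf; pose f' : {mfun T >-> T'} := HB.pack f (isMeasurableFun.Build _ _ _ _ f mf).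
exists (distribution P f'); split=> // g mg g0.
exact: (@ge0_integral_distribution _ _ T T' R P f' g mg g0).
Qed.

(** * Product laws constructed from a uniform variable *)

Section UnitInterval.
Context (R : realType).

Definition unit_lebesgue :=
  mrestr (@lebesgue_measure R) (measurable_itv `[0, 1[ : measurable (`[0, 1[ : set R)).

HB.instance Definition _ := Measure.on unit_lebesgue.

Lemma unit_lebesgue_setT : unit_lebesgue setT = 1%E.
Proof.
by rewrite /unit_lebesgue /mrestr setTI lebesgue_measure_itv /= lte_fin ltr01 oppr0 adde0.
Qed.

HB.instance Definition _ := Measure_isProbability.Build _ _ _ unit_lebesgue unit_lebesgue_setT.

End UnitInterval.

Section ProductRanks.
Context (R : realType) (p : nat -> nat -> R).
Hypothesis p_ge0 : forall j r, 0 <= p j r.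
Hypothesis p_sum : forall j, \sum_(1 <= r < j.+2) p j r = 1.

Definition cumulated j r : R := \sum_(1 <= s < r) p j s.

Lemma cumulatedS j r : (0 < r)%N -> cumulated j r.+1 = cumulated j r + p j r.
Proof. by move=> r0; rewrite /cumulated big_nat_recr. Qed.

Lemma cumulated_mono j r s : (0 < r)%N -> (r <= s)%N -> cumulated j r <= cumulated j s.
Proof.
move=> r0; elim: s => [|s IHs]; first by lia.
rewrite leq_eqVlt => /predU1P[->//|rs]; apply: (le_trans (IHs rs)).
by rewrite cumulatedS ?lerDl //; lia.
Qed.

(* The interval [x, x + l) is cut into pieces of lengths l * p j r, r = 1, .., j+1;
   [pick_rank] is the index of the piece containing u. *)
Definition pick_rank (u : R) j (s : R * R) : nat :=
  (find (fun k => u < s.1 + s.2 * cumulated j k.+2) (iota 0 j)).+1.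

Definition subinterval (s : R * R) j r : R * R :=
  (s.1 + s.2 * cumulated j r, s.2 * p j r).

Fixpoint interval_at (w : nat -> nat) n : R * R :=
  if n is n'.+1 then subinterval (interval_at w n') n' (w n') else (0, 1).

Fixpoint digit_interval (u : R) n : R * R :=
  if n is n'.+1 then subinterval (digit_interval u n') n' (pick_rank u n' (digit_interval u n'))
  else (0, 1).

Definition digit u j := pick_rank u j (digit_interval u j).

Lemma pick_rank_bounds u j s : (0 < pick_rank u j s <= j.+1)%N.
Proof.
have := find_size (fun k => u < s.1 + s.2 * cumulated j k.+2) (iota 0 j).
by rewrite size_iota.
Qed.

Lemma pick_rankP u j s r : 0 <= s.2 -> s.1 <= u < s.1 + s.2 -> (0 < r <= j.+1)%N ->
  (pick_rank u j s == r) = (s.1 + s.2 * cumulated j r <= u < s.1 + s.2 * cumulated j r.+1).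
Proof.
move=> l0 /andP[su us] /andP[r0 rj].
pose a r := s.1 + s.2 * cumulated j r.
have a_mono r1 r2 : (0 < r1)%N -> (r1 <= r2)%N -> a r1 <= a r2.
  by move=> r10 r12; rewrite lerD2l ler_wpM2l // cumulated_mono.
have [f1 f2] : a (pick_rank u j s) <= u /\ u < a (pick_rank u j s).+1.
  rewrite /pick_rank; set f := find _ _.
  have fj : (f <= j)%N by rewrite -[leqRHS](size_iota 0 j) find_size.
  split.
    case f0 : f => [|f'].
      by rewrite /a /cumulated big_geq // mulr0 addr0.
    have := @before_find _ 0%N (fun k => u < s.1 + s.2 * cumulated j k.+2) (iota 0 j) f'.
    rewrite -/f f0 leqnn => /(_ isT); rewrite nth_iota ?add0n; last by rewrite -f0.
    by move=> /negbT; rewrite -leNgt.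
  (* A failed search selects the last piece, whose right end is that of the whole interval. *)
  have := fj; rewrite leq_eqVlt => /predU1P[->|fj'].
    by rewrite /a /cumulated p_sum mulr1.
  have : has (fun k => u < s.1 + s.2 * cumulated j k.+2) (iota 0 j).
    by rewrite has_find size_iota.
  by move=> /(nth_find 0%N); rewrite -/f nth_iota.
have q0 : (0 < pick_rank u j s)%N by [].
apply/eqP/idP => [<-|/andP[ru ur]]; first by rewrite f1 f2.
case: (ltngtP (pick_rank u j s) r) => // [qr|rq].
  by have := lt_le_trans f2 (le_trans (a_mono _ _ _ qr) ru); rewrite ltxx => /(_ isT).
by have := lt_le_trans ur (le_trans (a_mono _ _ _ rq) f1); rewrite ltxx => /(_ isT).
Qed.

Lemma interval_at_ge0 w n : 0 <= (interval_at w n).2.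
Proof. by elim: n => [|n IHn] //=; rewrite mulr_ge0. Qed.

Lemma interval_at_len w n : (interval_at w n).2 = \prod_(0 <= j < n) p j (w j).
Proof. by elim: n => [|n IHn] /=; [rewrite big_geq|rewrite big_nat_recr //= IHn]. Qed.

Lemma subinterval_sub s j r u : 0 <= s.2 -> (0 < r <= j.+1)%N ->
  s.1 + s.2 * cumulated j r <= u < s.1 + s.2 * cumulated j r.+1 -> s.1 <= u < s.1 + s.2.
Proof.
move=> s0 /andP[r0 rj] /andP[ru ur]; apply/andP; split.
  apply: le_trans ru; rewrite lerDl mulr_ge0 //.
  by rewrite /cumulated; apply: sumr_ge0.
apply: lt_le_trans ur _; rewrite lerD2l -[leRHS]mulr1 ler_wpM2l //.
by rewrite -(p_sum j) cumulated_mono.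
Qed.

Lemma digits_interval w n u : valid_ranks w -> 0 <= u < 1 ->
  (forall j, (j < n)%N -> digit u j = w j) <->
  (interval_at w n).1 <= u < (interval_at w n).1 + (interval_at w n).2.
Proof.
move=> vw u01.
(* The induction also has to carry that the interval computed from [u] is the one prescribed by
   [w]. *)
suff H : ((forall j, (j < n)%N -> digit u j = w j) ->
   (interval_at w n).1 <= u < (interval_at w n).1 + (interval_at w n).2 /\
   digit_interval u n = interval_at w n) /\
  ((interval_at w n).1 <= u < (interval_at w n).1 + (interval_at w n).2 ->
   (forall j, (j < n)%N -> digit u j = w j)).
  by split=> [/H.1[]|/H.2].
elim: n => [|n [IH1 IH2]]; first by split=> //= _; rewrite add0r.
have l0 := interval_at_ge0 w n.
have step : (interval_at w n).1 <= u < (interval_at w n).1 + (interval_at w n).2 ->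
  (pick_rank u n (interval_at w n) == w n) =
  ((interval_at w n.+1).1 <= u < (interval_at w n.+1).1 + (interval_at w n.+1).2).
  move=> Hn; rewrite pick_rankP // /= -addrA -mulrDr cumulatedS //.
  by have /andP[] := vw n.
split=> [H|H j jn].
  have [Hn dn] := IH1 (fun j jn => H j (ltnW jn)).
  have e : pick_rank u n (interval_at w n) = w n by rewrite -dn; exact: H.
  split; first by rewrite -step // e.
  by rewrite /= dn e.
have Hn : (interval_at w n).1 <= u < (interval_at w n).1 + (interval_at w n).2.
  apply: (subinterval_sub l0 (vw n)).
  move: H; rewrite /= -addrA -mulrDr cumulatedS //; by have /andP[] := vw n.
move: jn; rewrite ltnS leq_eqVlt => /predU1P[->|]; last exact: IH2.
have [_ dn] := IH1 (IH2 Hn).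
by apply/eqP; rewrite /digit dn step.
Qed.

Definition digit_perm (u : R) : coherent_perm :=
  if (0 <= u < 1) then coherent_of_ranks (digit u) else point.

Lemma digit_permE u j : 0 <= u < 1 -> initial_rank (digit_perm u) j = digit u j.
Proof. by move=> u01; rewrite /digit_perm u01 initial_rank_of_ranks // pick_rank_bounds. Qed.

Lemma digit_perm_cylinder n w : valid_ranks w ->
  digit_perm @^-1` rank_cylinder n w `&` `[0, 1[ =
  [set` `[(interval_at w n).1, (interval_at w n).1 + (interval_at w n).2[] `&` `[0, 1[.
Proof.
move=> vw; apply/seteqP; split=> u [/= H]; rewrite in_itv /= => u01; split=> //=.
  by rewrite in_itv /=; apply/(digits_interval n vw u01) => j jn; rewrite -digit_permE // H.
move=> j jn; rewrite digit_permE //; apply: (digits_interval n vw u01).2 => //.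
Qed.

(** For an event on a single rank, the preimage within [0, 1) is a finite union of intervals, one
    for each word; outside [0, 1) the map is constant. *)
Lemma digit_perm_measurable : measurable_fun [set: R] digit_perm.
Proof.
apply: (@measurability _ _ _ _ _ _ rank_cylinders) => // _ [_ [j [r ->]] <-]; rewrite setTI.
set A := (X in _ @^-1` X).
rewrite (_ : digit_perm @^-1` A = (digit_perm @^-1` A `&` `[0, 1[) `|` (digit_perm @^-1` A `&` ~` `[0, 1[));
  last by rewrite -setIUr setUv setIT.
apply: measurableU.
  rewrite (_ : _ `&` _ = \bigcup_(f in [set f : word j.+1 | valid_word f /\ word_ranks f j = r])
     (digit_perm @^-1` rank_cylinder j.+1 (word_ranks f) `&` `[0, 1[)).
    apply: fin_bigcup_measurable => [|f [vf _]]; first exact: finite_finset.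
    rewrite digit_perm_cylinder; last exact: valid_word_ranks.
    by apply: measurableI; exact: measurable_itv.
  apply/seteqP; split=> [u [Au u01]|u [f [vf fr] [cu u01]]]; last first.
    by split=> //; rewrite /A /= cu.
  have vu := valid_initial_rank (digit_perm u).
  exists (to_word j.+1 (initial_rank (digit_perm u))) => /=.
    by split; [exact: to_word_valid|rewrite to_wordK].
  by split=> // k kj; rewrite to_wordK.
have [Ap|Ap] := pselect (A point).
  rewrite (_ : _ `&` _ = ~` `[0, 1[); first by apply: measurableC; exact: measurable_itv.
  apply/seteqP; split=> [u []|u /= nu] //; split=> //=.
  by rewrite /digit_perm; move: nu; rewrite in_itv /= => /negP/negPf ->.
rewrite (_ : _ `&` _ = set0) //; apply/seteqP; split=> [u [/= Au nu]|//].
by apply: Ap; move: Au nu; rewrite /digit_perm in_itv /=; case: ifP.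
Qed.

(** Image of the uniform measure: a cylinder pulls back to an interval whose length is the product
    of the prescribed probabilities. *)
Lemma product_ranks_exists : exists Q : probability coherent_perm R,
  forall n w, valid_ranks w -> cylinder_prob Q n w = \prod_(0 <= j < n) p j (w j).
Proof.
have [Q [HQ _]] := law_exists (@unit_lebesgue R) digit_perm_measurable.
exists Q => n w vw; apply: EFin_inj; rewrite -cylinder_probE HQ.
rewrite -[LHS]/(lebesgue_measure (digit_perm @^-1` rank_cylinder n w `&` `[0, 1[)).
rewrite digit_perm_cylinder //; set s := interval_at w n.
have s0 : 0 <= s.2 by exact: interval_at_ge0.
have [x0 x1] : 0 <= s.1 /\ s.1 + s.2 <= 1.
  rewrite /s; elim: n {s s0} => [|n [IH1 IH2]]; first by rewrite /= add0r.
  have l0 := interval_at_ge0 w n.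
  have c0 : 0 <= cumulated n (w n) by rewrite /cumulated; apply: sumr_ge0.
  split=> /=; first by rewrite addr_ge0 // mulr_ge0.
  have /andP[w0 wn] := vw n.
  rewrite -addrA -mulrDr -cumulatedS //; apply: le_trans IH2.
  by rewrite lerD2l ler_piMr // -(p_sum n) cumulated_mono.
rewrite setIidl; last first.
  move=> u /=; rewrite !in_itv /= => /andP[a b].
  by rewrite (le_trans x0 a) (lt_le_trans b x1).
rewrite lebesgue_measure_itv /= lte_fin -interval_at_len -/s.
have [s00|s0'] := eqVneq s.2 0; first by rewrite s00 addr0 ltxx.
by rewrite ltrDl lt_neqAle eq_sym s0' s0 /= -EFinB addrAC subrr add0r.
Qed.

End ProductRanks.

(** * Events of finitely many ranks and independence *)

Section RankEvents.
Context (R : realType) (P : probability coherent_perm R).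

Lemma rank_event_sum n (B : nat -> set nat) :
  P [set pi | forall j, (j < n)%N -> B j (initial_rank pi j)] =
  (\sum_(f : word n | valid_word f) \prod_(0 <= j < n) (word_ranks f j \in B j)%:R
    * cylinder_prob P n (word_ranks f))%:E.
Proof.
pose g (w : nat -> nat) : R := \prod_(0 <= j < n) (w j \in B j)%:R.
have gn : depends_below n g.
  by move=> w w' ww; rewrite /g !big_nat; apply: eq_bigr => j /andP[_ jn]; rewrite ww.
rewrite -Ex_indic; last exact: measurable_rank_event.
congr EFin; transitivity (Ex P (fun pi => g (initial_rank pi))).
  congr Ex; apply/funext => pi; rewrite indicE /g.
  have [Bp|Bp] := pselect (forall j, (j < n)%N -> B j (initial_rank pi j)).
    by rewrite mem_set // big_nat big1 // => j /andP[_ jn]; rewrite mem_set //; exact: Bp.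
  rewrite memNset //; apply/esym/eqP; rewrite prodf_seq_eq0; apply/hasP.
  have /existsNP[j /not_implyP[jn jB]] := Bp.
  by exists j; rewrite ?mem_index_iota //= memNset.
exact: (Ex_depends P gn).
Qed.

(** Distributivity over all functions, after giving the value 0 to letters that are not legal ranks
    at their position. *)
Lemma sum_words_prod (p : nat -> nat -> R) n (B : nat -> set nat) :
  \sum_(f : word n | valid_word f) \prod_(0 <= j < n) (word_ranks f j \in B j)%:R
    * \prod_(0 <= j < n) p j (word_ranks f j)
  = \prod_(0 <= j < n) \sum_(1 <= r < j.+2) (r \in B j)%:R * p j r.
Proof.
pose F (j : 'I_n) (r : 'I_n.+1) : R :=
  if (0 < r <= j.+1)%N then (val r \in B j)%:R * p j r else 0.
transitivity (\sum_(f : word n) \prod_(j < n) F j (f j)).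
  rewrite [RHS](bigID (@valid_word n)) /= [X in _ = _ + X]big1 ?addr0 => [|f nv]; last first.
    have /forallPn[j jv] := nv.
    by apply/eqP; rewrite prodf_seq_eq0; apply/hasP; exists j; rewrite ?mem_index_enum //= /F (negPf jv).
  apply: eq_bigr => f vf; rewrite !big_mkord -big_split /=; apply: eq_bigr => j _.
  by rewrite word_ranksE /F (forallP vf j).
rewrite -(bigA_distr_bigA F) big_mkord; apply: eq_bigr => j _.
rewrite /F -(big_mkord xpredT (fun r => if (0 < r <= j.+1)%N then (r \in B j)%:R * p j r else 0)).
rewrite (@big_cat_nat _ _ _ j.+2) //=; last by rewrite ltnS.
rewrite [X in _ + X]big_nat_cond [X in _ + X]big1 ?addr0; last first.
  by move=> r /andP[/andP[jr _] _]; rewrite leqNgt ltnS in jr *; case: ifP => //; lia.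
rewrite big_ltn //= add0r [LHS]big_nat [RHS]big_nat; apply: eq_bigr => r /andP[r0 rj].
by rewrite r0 -ltnS rj.
Qed.

End RankEvents.

Section ProductLaw.
Context (R : realType) (Q : probability coherent_perm R) (p : nat -> nat -> R).
Hypothesis p_sum : forall j, \sum_(1 <= r < j.+2) p j r = 1.
Hypothesis Qp : forall n w, valid_ranks w -> cylinder_prob Q n w = \prod_(0 <= j < n) p j (w j).

Definition rank_mass j (B : set nat) : R := \sum_(1 <= r < j.+2) (r \in B)%:R * p j r.

Lemma product_rank_event n (B : nat -> set nat) :
  Q [set pi | forall j, (j < n)%N -> B j (initial_rank pi j)] =
  (\prod_(0 <= j < n) rank_mass j (B j))%:E.
Proof.
rewrite rank_event_sum -sum_words_prod; congr EFin; apply: eq_bigr => f vf.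
by rewrite Qp //; exact: valid_word_ranks.
Qed.

Lemma rank_massT j : rank_mass j setT = 1.
Proof.
by rewrite -[RHS](p_sum j); apply: eq_bigr => r _; rewrite in_setT mul1r.
Qed.

Lemma product_rank_law j (B : set nat) :
  Q [set pi | B (initial_rank pi j)] = (rank_mass j B)%:E.
Proof.
have := product_rank_event j.+1 (fun k => if k == j then B else setT).
rewrite big_nat_recr //= eqxx big_nat big1 => [|k /andP[_ kj]]; last by rewrite ltn_eqF // rank_massT.
rewrite mul1r => <-; congr (Q _); apply/seteqP; split=> [pi Bp k|pi /(_ j (ltnSn j))] /=.
  by case: eqP => [->|].
by rewrite eqxx.
Qed.

Lemma product_independent : independent_ranks Q.
Proof.
move=> n B; rewrite product_rank_event -prodEFin big_mkord; apply: eq_bigr => j _.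
by rewrite product_rank_law.
Qed.

Lemma product_rank_prob j r : (forall r, ~~ (0 < r <= j.+1)%N -> p j r = 0) ->
  Q [set pi | initial_rank pi j = r] = (p j r)%:E.
Proof.
move=> p0; rewrite (product_rank_law j [set r]); congr EFin; rewrite /rank_mass.
have [vr|nvr] := boolP (0 < r <= j.+1)%N.
  rewrite (sum_indicator (p j) vr); apply: eq_bigr => s _; congr (_%:R * _).
  by congr nat_of_bool; apply/idP/eqP => [/set_mem /= -> //|->]; exact: mem_set.
rewrite p0 // big_nat big1 // => s sj; rewrite memNset ?mul0r // => sr.
by move: nvr; rewrite -sr sj.
Qed.

End ProductLaw.

(** * Members of the families and their limiting frequencies *)

Section RankProbabilities.
Context (R : realType).

(** One condition common to all the families, under which the rank probabilities are nonnegative and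
    add up to 1. *)
Definition proper_param (x : record_param R) : Prop :=
  let: (t, (a, b)) := x in
  [/\ 0 <= (a : R), 0 <= (b : R) & if t is Defs.Finite then 0 < a + b :> R else a + b = 1 :> R].

(** The rank probabilities depend on a rank only through its type. Positions are 0-based: [j.-1]
    stands for (j + 1) - 2, and [j == 1] is the second rank. *)
Definition type_prob (x : record_param R) (j : nat) (c : option bool) : R :=
  let: (t, (a, b)) := x in
  match t with
  | Defs.Finite => (if c is Some l then if l then a else b else 1) / (a + b + (j.-1)%:R)
  | Defs.Infinite => if c is Some l then if l then a else b else 0
  | Defs.Zero => if j == 1%N then if c is Some l then if l then a else b else 0
            else (c == None)%:R / (j.-1)%:R
  end.

Lemma rank_prob0 (x : record_param R) r : rank_prob x 1 r = (r == 1%N)%:R.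
Proof. by case: x => -[] []. Qed.

Lemma rank_probE (x : record_param R) j r : (0 < j)%N -> (0 < r <= j.+1)%N ->
  rank_prob x j.+1 r = type_prob x j (rank_type j r).
Proof.
case: j => // j _ /andP[r0 rj]; case: x => t [a b]; rewrite /rank_prob /type_prob /= /rank_type.
rewrite !eqSS subn2 /=.
have [->|r1] := eqVneq r 1%N.
  case: t => //=; case: eqP => // _; by rewrite ltnn mul0r.
have [->|r2] := eqVneq r j.+2.
  by case: t => //=; rewrite ltnn ?andbF mul0r; case: eqP => // ->.
have -> : (1 < r < j.+2)%N by lia.
by case: t => //=; case: eqP => // j0; lia.
Qed.

Lemma rank_prob_out (x : record_param R) j r : ~~ (0 < r <= j.+1)%N -> rank_prob x j.+1 r = 0.
Proof.
move=> nv; have r1 : (r == 1)%N = false by lia.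
have r2 : (r == j.+1)%N = false by lia.
have r3 : (1 < r < j.+1)%N = false by lia.
case: j nv r2 r3 => [|j] nv r2 r3; first by rewrite rank_prob0 r1.
case: x => t [a b]; rewrite /rank_prob /= r1 r2 r3 !mul0r.
have -> : (r == 2)%N = false by lia.
by case: t => //; case: ifP.
Qed.

Lemma type_prob_ge0 x j c : proper_param x -> 0 <= type_prob x j c.
Proof.
case: x => t [a b] [a0 b0 ab]; rewrite /type_prob; case: t ab => ab.
- by rewrite divr_ge0 ?addr_ge0 //; case: c => [[]|].
- by case: ifP => _; [case: c => [[]|]|rewrite divr_ge0].
- by case: c => [[]|].
Qed.

Lemma rank_prob_ge0 x j r : proper_param x -> 0 <= rank_prob x j.+1 r.
Proof.
move=> px; have [vr|nv] := boolP (0 < r <= j.+1)%N; last by rewrite rank_prob_out.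
case: j vr => [|j] vr; first by rewrite rank_prob0.
by rewrite rank_probE // type_prob_ge0.
Qed.

Lemma type_prob_total x j : proper_param x -> (0 < j)%N ->
  type_prob x j (Some true) + type_prob x j (Some false) + (j.-1)%:R * type_prob x j None = 1.
Proof.
case: x => t [a b] [a0 b0 ab] j0; rewrite /type_prob; case: t ab => ab.
- rewrite -!mulrDl mulrA mulr1 -mulrDl divff // gt_eqF //.
  by rewrite (lt_le_trans ab) // lerDl.
- case: eqP => [->|/eqP j1]; first by rewrite mul0r addr0.
  rewrite /= !mul0r !add0r mul1r divff // pnatr_eq0; lia.
- by rewrite mulr0 addr0.
Qed.

Lemma rank_prob_sum x j : proper_param x -> \sum_(1 <= r < j.+2) rank_prob x j.+1 r = 1.
Proof.
move=> px; case: j => [|j]; first by rewrite big_nat1 rank_prob0.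
rewrite big_nat (eq_bigr (fun r => type_prob x j.+1 (rank_type j.+1 r))); last first.
  by move=> r rj; rewrite rank_probE.
by rewrite -big_nat -/(rank_norm j.+1 (type_prob x j.+1)) rank_normE // type_prob_total.
Qed.

Lemma rank_prob_le1 (x : record_param R) j r : proper_param x -> rank_prob x j.+1 r <= 1.
Proof.
move=> px; have [vr|nv] := boolP (0 < r <= j.+1)%N; last by rewrite rank_prob_out.
rewrite -(rank_prob_sum j px) (bigD1_seq r) ?iota_uniq ?mem_index_iota //= lerDl.
by apply: sumr_ge0 => s _; exact: rank_prob_ge0.
Qed.

Lemma record_distribution_exists x : proper_param x -> exists Q, record_distribution x Q.
Proof.
move=> px.
have [Q HQ] := @product_ranks_exists R (fun j r => rank_prob x j.+1 r)
  (fun j r => rank_prob_ge0 j r px) (fun j => rank_prob_sum j px).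
exists Q; split; first by apply: (product_independent (fun j => rank_prob_sum j px) HQ).
move=> j r; rewrite (product_rank_prob (fun j => rank_prob_sum j px) HQ) // => s.
exact: rank_prob_out.
Qed.

Section RecordDistribution.
Variables (x : record_param R) (Q : probability coherent_perm R).
Hypothesis (px : proper_param x) (QxQ : record_distribution x Q).

Lemma record_cylinder_prob n w : cylinder_prob Q n w = \prod_(0 <= j < n) rank_prob x j.+1 (w j).
Proof.
have [ind law] := QxQ; apply: EFin_inj; rewrite -cylinder_probE.
have := ind n (fun j => [set w j]); rewrite /rank_cylinder => ->.
by rewrite -prodEFin big_mkord; apply: eq_bigr => j _; rewrite law.
Qed.

(** Up to a factor depending on the position alone, the probability depends on the type alone. The
    exception is the zero regime at position 1: both types are then records, impossible at the later
    position, and both sides are 0. *)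
Lemma type_prob_exchange i j c c' : (0 < i)%N -> (1 < j)%N ->
  (i = 1%N -> c != None /\ c' != None) ->
  type_prob x i c * type_prob x j c' = type_prob x i c' * type_prob x j c.
Proof.
move=> i0 j1; case: x => t [a b]; rewrite /type_prob; case: t => H.
- by rewrite mulrACA [RHS]mulrACA; congr (_ * _); rewrite mulrC.
- have -> : (j == 1)%N = false by lia.
  have [i1|i1] := eqVneq i 1%N; last by rewrite mulrACA [RHS]mulrACA; congr (_ * _); rewrite mulrC.
  by have [/negPf -> /negPf ->] := H i1; rewrite !mul0r !mulr0.
- by rewrite mulrC.
Qed.

(** The limit results thus apply under each member as well, which is what uniqueness rests on. *)
Lemma record_exchangeable : type_exchangeable Q.
Proof.
move=> N i j r r' s s' w i0 j1 ij iN jN vr vs vr' vs' t1 t2 vw.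
rewrite !record_cylinder_prob !(big_update_pair _ (fun k => rank_prob x k.+1)) //.
congr (_ * _); rewrite /= !rank_probE ?(ltnW j1) // -t1 t2.
apply: type_prob_exchange => // i1; rewrite i1 in vr vs *.
by have [b ->] := rank_type1 vr; have [b' ->] := rank_type1 vs.
Qed.

(** Changing the rank at [i] shows that the expectations restricted to its values are proportional
    to their probabilities; they add up to the full expectation. *)
Lemma Ex_record_split i r (g : (nat -> nat) -> R) N : (i < N)%N -> (0 < r <= i.+1)%N ->
  depends_below N g -> (forall w w', (forall k, k != i -> w k = w' k) -> g w = g w') ->
  Ex Q (fun pi => (initial_rank pi i == r)%:R * g (initial_rank pi)) =
  rank_prob x i.+1 r * Ex Q (fun pi => g (initial_rank pi)).
Proof.
move=> iN vr gN gi.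
pose e u := Ex Q (fun pi => (initial_rank pi i == u)%:R * g (initial_rank pi)).
pose a u : nat -> nat := fun k => if k == i then u else 1%N.
have va u : (0 < u <= i.+1)%N -> valid_ranks (a u).
  by move=> vu j; rewrite /a; case: eqP => [->|].
have eE u : e u = Ex Q (fun pi => (agrees N (pred1 i) (a u) (initial_rank pi))%:R * g (initial_rank pi)).
  congr Ex; apply/funext => pi; congr (_%:R * _); congr nat_of_bool.
  by apply/eqP/agreesP => [<- j _ /eqP ->|/(_ i iN)] /=; rewrite /a ?eqxx // => ->.
have key u v : (0 < u <= i.+1)%N -> (0 < v <= i.+1)%N ->
    rank_prob x i.+1 v * e u = rank_prob x i.+1 u * e v.
  move=> vu vv; rewrite !eE; apply: Ex_exchange_scaled => //; [exact: va|exact: va|].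
  move=> w vw; rewrite !update_pred1 !record_cylinder_prob !(big_upd1 _ (fun k => rank_prob x k.+1)) //.
  by rewrite /a !eqxx /= mulrCA.
have be u : bmeas (fun pi => (initial_rank pi i == u)%:R * g (initial_rank pi)).
  by apply: bmeasM; [exact: rank_eq_bmeas|exact: bmeas_depends gN].
have -> : Ex Q (fun pi => g (initial_rank pi)) = \sum_(1 <= u < i.+2) e u.
  rewrite -Ex_sum //; congr Ex; apply/funext => pi.
  by rewrite -(sum_indicator (fun=> g (initial_rank pi)) (valid_initial_rank pi i)).
rewrite mulr_sumr big_nat (eq_bigr (fun u => rank_prob x i.+1 u * e r)) => [|u ui]; last exact: key.
by rewrite -big_nat -mulr_suml rank_prob_sum // mul1r.
Qed.

(** The limiting frequencies are insensitive to any single rank, hence independent of it. *)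
Lemma Ex_record_limit i r phi : (0 < r <= i.+1)%N -> test_fun phi ->
  Ex Q (fun pi => (initial_rank pi i == r)%:R * phi (@limit_freq R pi)) =
  rank_prob x i.+1 r * Ex Q (fun pi => phi (@limit_freq R pi)).
Proof.
move=> vr tphi; have exch := record_exchangeable.
have bI := rank_eq_bmeas R i r.
have c1 := Ex_test_cvg exch tphi bI.
have c2 := Ex_test_cvg exch tphi (bmeas_cst _ 1).
have c3 : rank_prob x i.+1 r * Ex Q (fun pi => 1 * phi (type_freq R (level R k) (initial_rank pi)))
    @[k --> \oo] --> rank_prob x i.+1 r * Ex Q (fun pi => 1 * phi (@limit_freq R pi)).
  by apply: cvgM; [exact: cvg_cst|exact: c2].
have -> : Ex Q (fun pi => phi (@limit_freq R pi)) = Ex Q (fun pi => 1 * phi (@limit_freq R pi)).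
  by congr Ex; apply/funext => pi; rewrite mul1r.
apply/eqP; rewrite -subr_eq0; apply/eqP.
apply: cvg_unique (cvgB c1 c3) _; first exact: norm_hausdorff.
have [K K0 oK] := test_fun_osc tphi.
have [k0 hk0] := level_unbounded R i.
have p0 := rank_prob_ge0 i r px.
apply: (@cvg_to_0_level R _ (K + rank_prob x i.+1 r * K) k0); last by rewrite addr_ge0 // mulr_ge0.
move=> k k0k; set N := level R k; have HN : 0 < harmonic_sum R N by exact: harmonic_level_gt0.
have iN : (i < N)%N by exact: hk0.
pose psi w := phi (type_freq R N w).
have psiN : depends_below N psi.
  by move=> w w' ww; congr phi; apply/funext => y; exact: (@type_freq_depends R N y).
pose psi1 w := psi (upd1 i 1 w).
have psi1N : depends_below N psi1.
  by move=> w w' ww; apply: psiN => j jN; rewrite /upd1; case: eqP => // _; exact: ww.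
have bpsi := bmeas_depends psiN; have bpsi1 := bmeas_depends psi1N.
have spl : Ex Q (fun pi => (initial_rank pi i == r)%:R * psi1 (initial_rank pi)) =
    rank_prob x i.+1 r * Ex Q (fun pi => psi1 (initial_rank pi)).
  apply: (Ex_record_split iN vr psi1N) => w w' ww; congr psi; apply/funext => j.
  by rewrite /upd1; case: eqP => // /eqP /ww.
have close pi : `|psi (initial_rank pi) - psi1 (initial_rank pi)| <= K / harmonic_sum R N.
  by rewrite distrC; exact: (oK N HN i _ (valid_initial_rank pi) i 1%N (leqnn i) isT).
have D1 : `|Ex Q (fun pi => (initial_rank pi i == r)%:R * psi (initial_rank pi))
      - Ex Q (fun pi => (initial_rank pi i == r)%:R * psi1 (initial_rank pi))| <= K / harmonic_sum R N.
  rewrite -ExB; [|exact: bmeasM|exact: bmeasM].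
  rewrite -[leRHS](Ex_cst Q); apply: Ex_norm_le => [||pi].
  - by apply: bmeasB; exact: bmeasM.
  - exact: bmeas_cst.
  rewrite -mulrBr normrM -[leRHS]mul1r ler_pM //.
  by case: (_ == _); rewrite ?normr1 ?normr0.
have D2 : `|Ex Q (fun pi => psi1 (initial_rank pi)) - Ex Q (fun pi => psi (initial_rank pi))| <= K / harmonic_sum R N.
  rewrite -ExB // -[leRHS](Ex_cst Q); apply: Ex_norm_le => [||pi].
  - exact: bmeasB.
  - exact: bmeas_cst.
  by rewrite distrC.
have E1 : Ex Q (fun pi => 1 * psi (initial_rank pi)) = Ex Q (fun pi => psi (initial_rank pi)).
  by congr Ex; apply/funext => pi; rewrite mul1r.
rewrite /= -/N -[X in _ - _ * Ex Q X]/(fun pi => 1 * psi (initial_rank pi)) E1.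
rewrite -[X in Ex Q X - _]/(fun pi => (initial_rank pi i == r)%:R * psi (initial_rank pi)).
move: D1 D2; rewrite spl; set A := Ex Q _; set B := Ex Q _; set C := Ex Q _ => D1 D2.
rewrite (_ : _ - _ = (A - rank_prob x i.+1 r * B) + rank_prob x i.+1 r * (B - C)); last by ring.
rewrite (le_trans (ler_normD _ _)) // mulrDl lerD // normrM ger0_norm // -mulrA.
by rewrite ler_wpM2l.
Qed.

(** Let [phi] be the frequency minus the claimed constant. At position 2 the expectation of
    frequency times [phi] is that of indicator times [phi], which by independence is the constant
    times the expectation of [phi]; hence phi^2 has expectation 0. *)
Lemma record_limit_freq : {ae Q, forall pi, forall c, @limit_freq R pi c = type_prob x 2 c}.
Proof.
suff H c : {ae Q, forall pi, @limit_freq R pi c - type_prob x 2 c = 0}.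
  have := H (Some true); have := H (Some false); have := H None.
  apply: filterS3 => pi h1 h2 h3 c; apply/eqP; rewrite -subr_eq0; apply/eqP.
  by case: c => [[]|].
pose phi (t : option bool -> R) := t c - type_prob x 2 c.
have tphi : test_fun phi.
  apply: test_funD; first exact: test_fun_coord.
  exact: (test_fun_cst (- type_prob x 2 c)).
have bphi := test_fun_bmeas tphi.
apply: (Ex_sq_eq0 bphi); rewrite -/phi.
have vc := @rank_of_type_bounds 2 c isT.
have e1 := @Ex_record_limit 2 (rank_of_type 2 c) phi vc tphi.
have e2 := @Ex_peel R Q record_exchangeable 2 _ (fun=> 1) phi isT vc (fun _ _ _ => erefl)
   (fun=> eq_ind_r (fun x => x <= 1) (lexx 1) (normr1 R)) tphi.
rewrite rank_probE // rank_of_typeK // in e1.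
have e3 : Ex Q (fun pi => @limit_freq R pi c * phi (@limit_freq R pi)) =
   type_prob x 2 c * Ex Q (fun pi => phi (@limit_freq R pi)).
  rewrite -e1; transitivity (Ex Q (fun pi => (initial_rank pi 2 == rank_of_type 2 c)%:R * 1 * phi (@limit_freq R pi))).
    rewrite e2; congr Ex; apply/funext => pi.
    by rewrite mul1r /rank_ratio rank_of_typeK // rank_norm2 ?divr1 //; exact: limit_freq_simplex.
  by congr Ex; apply/funext => pi; rewrite mulr1.
transitivity (Ex Q (fun pi => @limit_freq R pi c * phi (@limit_freq R pi))
   - type_prob x 2 c * Ex Q (fun pi => phi (@limit_freq R pi))); last by rewrite e3 subrr.
rewrite -ExZ // -ExB.
- by congr Ex; apply/funext => pi; rewrite /phi; ring.
- by apply: bmeasM => //; exact: limit_freq_bmeas.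
- exact: bmeasZ.
Qed.

End RecordDistribution.
End RankProbabilities.

(** * Mixtures identified by a statistic *)

Section Mixture.
Context (R : realType).

Lemma measurable_inv_fun d (T : measurableType d) (f : T -> R) :
  measurable_fun [set: T] f -> measurable_fun [set: T] (fun x => (f x)^-1).
Proof.
move=> mf; rewrite (_ : (fun x => _) = fun x => f x * (@powR R)^~ (-1) (f x ^+ 2)).
  apply: measurable_funM => //; apply: (measurableT_comp (measurable_powR (-1))).
  exact: measurable_funX.
apply/funext => x; rewrite /= powR_inv1 ?sqr_ge0 // expr2 invfM mulrA.
by have [->|x0] := eqVneq (f x) 0; rewrite ?invr0 ?mulr0 // divff // mul1r.
Qed.

Lemma ae_probability1 (Q : probability coherent_perm R) (A : set coherent_perm) : measurable A ->
  {ae Q, forall pi, A pi} -> Q A = 1%E.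
Proof.
move=> mA [N [mN N0 sub]].
have : Q (~` A) = 0%E by apply: (subset_measure0 (measurableC mA) mN sub N0).
by rewrite probability_setC //; move/eqP; rewrite sube_eq ?fin_num_measure // add0e => /eqP.
Qed.

Lemma ae_probability0 (Q : probability coherent_perm R) (A : set coherent_perm) : measurable A ->
  {ae Q, forall pi, ~ A pi} -> Q A = 0%E.
Proof.
move=> mA [N [mN N0 sub]]; apply: (subset_measure0 mA mN _ N0).
by move=> pi Ap; apply: sub => /=; apply.
Qed.

Lemma probability1_setI d (X : measurableType d) (nu : probability X R) (A C : set X) :
  measurable C -> nu C = 1%E -> measurable A -> nu (A `&` C) = nu A.
Proof.
move=> mC nuC mA; rewrite [RHS](measureDI nu mA mC) [X in _ = (X + _)%E](_ : _ = 0%E) ?add0e //.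
apply: (@subset_measure0 _ _ _ nu (A `\` C) (~` C)).
- exact: measurableD.
- exact: measurableC.
- by move=> x [].
- by rewrite [LHS](probability_setC nu mC) nuC subee.
Qed.

Definition is_finite (t : regime) := if t is Defs.Finite then true else false.
Definition is_zero (t : regime) := if t is Defs.Zero then true else false.

Lemma measurable_regime (p : regime -> bool) :
  measurable_fun [set: record_param R] (fun x => p x.1).
Proof. exact: (@measurableT_comp _ _ _ _ _ _ p _ fst). Qed.

Lemma measurable_param1 : measurable_fun [set: record_param R] (fun x => x.2.1 : R).
Proof. exact: measurableT_comp measurable_fst measurable_snd. Qed.

Lemma measurable_param2 : measurable_fun [set: record_param R] (fun x => x.2.2 : R).
Proof. exact: measurableT_comp measurable_snd measurable_snd. Qed.

Lemma measurable_rank_prob j r : measurable_fun [set: record_param R] (fun x => rank_prob x j r).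
Proof.
have m1 := measurable_param1; have m2 := measurable_param2.
rewrite (_ : (fun x => _) = fun x => if (j <= 1)%N then (r == 1%N)%:R else
  if is_finite x.1 then
      (if r == 1%N then x.2.1 else if r == j then x.2.2 else (1 < r < j)%N%:R)
      / (x.2.1 + x.2.2 + (j - 2)%N%:R)
  else if is_zero x.1 then
      if j == 2%N then
        (if r == 1%N then x.2.1 else if r == 2%N then x.2.2 else 0)
      else (1 < r < j)%N%:R / (j - 2)%N%:R
  else
      if r == 1%N then x.2.1 else if r == j then x.2.2 else 0); last first.
  by apply/funext => -[[] [a b]]; rewrite /rank_prob /=.
case: (j <= 1)%N; first exact: measurable_cst.
apply: measurable_fun_ifT; first exact: (measurable_regime is_finite).
  apply: measurable_funM.
    by case: (r == 1)%N => //; case: (r == j).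
  apply: measurable_inv_fun; apply: measurable_funD; last exact: measurable_cst.
  exact: measurable_funD.
apply: measurable_fun_ifT; first exact: (measurable_regime is_zero).
  by case: (j == 2)%N => //; case: (r == 1)%N => //; case: (r == 2)%N.
by case: (r == 1)%N => //; case: (r == j).
Qed.

Definition event_prob (x : record_param R) n (B : nat -> set nat) : R :=
  \prod_(0 <= j < n) \sum_(1 <= r < j.+2) (r \in B j)%:R * rank_prob x j.+1 r.

Lemma measurable_event_prob n B : measurable_fun [set: record_param R] (fun x => event_prob x n B).
Proof.
rewrite /event_prob; elim: n => [|n IHn].
  by under eq_fun do rewrite big_geq //; exact: measurable_cst.
under eq_fun do rewrite big_nat_recr //=.
apply: measurable_funM => //; apply: measurable_sum => r.
by apply: measurable_funM; [exact: measurable_cst|exact: measurable_rank_prob].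
Qed.

Lemma record_event (x : record_param R) Q n B : proper_param x -> record_distribution x Q ->
  Q [set pi | forall j, (j < n)%N -> B j (initial_rank pi j)] = (event_prob x n B)%:E.
Proof.
move=> px QxQ; apply: (@product_rank_event R Q (fun j => rank_prob x j.+1)).
by move=> m w _; exact: record_cylinder_prob.
Qed.

(** An intersection-stable generator on which the law of a member is the explicit function
    [event_prob] of its parameter. *)
Definition rank_events : set (set coherent_perm) :=
  [set A | exists n B, A = [set pi | forall j, (j < n)%N -> B j (initial_rank pi j)]].

Lemma rank_events_setI : setI_closed rank_events.
Proof.
move=> _ _ [n [B ->]] [m [C ->]].
exists (maxn n m), (fun j => [set r | ((j < n)%N -> B j r) /\ ((j < m)%N -> C j r)]).
apply/seteqP; split=> [pi [Bp Cp] j _|pi H] /=.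
  by split=> jn; [exact: Bp|exact: Cp].
by split=> j jn; have [|b c] := H j; rewrite ?leq_max ?jn ?orbT //; [exact: b|exact: c].
Qed.

Lemma rank_events_generate : @measurable _ coherent_perm = <<s rank_events >>.
Proof.
apply/seteqP; split.
  apply: smallest_sub; first exact: smallest_sigma_algebra.
  move=> _ [j [r ->]]; apply: sub_sigma_algebra.
  exists j.+1, (fun k => [set s | k = j -> s = r]).
  apply/seteqP; split=> [pi <- k _ -> //|pi H /=].
  exact: (H j (ltnSn j)).
apply: smallest_sub; first exact: sigma_algebra_measurable.
by move=> _ [n [B ->]]; exact: measurable_rank_event.
Qed.

(** * Existence and uniqueness of the mixing measure *)

Section MixtureOfStatistic.
Variables (P : probability coherent_perm R) (D : set (record_param R))
  (T : coherent_perm -> record_param R).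
Hypotheses (mD : measurable D) (D_proper : forall x, D x -> proper_param x)
  (mT : measurable_fun [set: coherent_perm] T) (T_proper : forall pi, proper_param (T pi))
  (T_D : {ae P, forall pi, D (T pi)})
  (T_law : forall n w, valid_ranks w -> cylinder_prob P n w =
     Ex P (fun pi => \prod_(0 <= j < n) rank_prob (T pi) j.+1 (w j)))
  (T_identifies : forall x Q, D x -> record_distribution x Q -> {ae Q, forall pi, T pi = x}).

Lemma rank_prob_stat_bmeas j r : bmeas (fun pi => rank_prob (T pi) j.+1 r).
Proof.
split; first exact: measurableT_comp (measurable_rank_prob j.+1 r) mT.
by exists 1 => pi; rewrite ger0_norm ?rank_prob_ge0 ?rank_prob_le1.
Qed.

Lemma event_prob_stat n (B : nat -> set nat) :
  P [set pi | forall j, (j < n)%N -> B j (initial_rank pi j)] =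
  (Ex P (fun pi => event_prob (T pi) n B))%:E.
Proof.
rewrite rank_event_sum; congr EFin.
pose F (f : word n) pi := \prod_(0 <= j < n) (word_ranks f j \in B j)%:R
    * \prod_(0 <= j < n) rank_prob (T pi) j.+1 (word_ranks f j) : R.
have bp (f : word n) : bmeas (fun pi => \prod_(0 <= j < n) rank_prob (T pi) j.+1 (word_ranks f j)).
  by apply: bmeas_prod => j _; exact: rank_prob_stat_bmeas.
transitivity (Ex P (fun pi => \sum_(f : word n | valid_word f) F f pi)); last first.
  by congr Ex; apply/funext => pi; rewrite /F (sum_words_prod (fun j => rank_prob (T pi) j.+1)).
rewrite Ex_sum => [|f _]; last exact: bmeasZ.
by apply: eq_bigr => f vf; rewrite T_law ?ExZ //; exact: valid_word_ranks.
Qed.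

(** Members are picked by choice; outside [D] the value [P] is a default, integrals being taken over
    [D]. *)
Definition member_law (x : record_param R) : probability coherent_perm R :=
  if pselect (D x) is left Dx then
    sval (cid (record_distribution_exists (D_proper Dx)))
  else P.

Lemma member_lawP x : D x -> record_distribution x (member_law x).
Proof.
move=> Dx; rewrite /member_law; case: pselect => // Dx'.
by case: cid.
Qed.

Lemma member_law_event x n (B : nat -> set nat) : D x ->
  member_law x [set pi | forall j, (j < n)%N -> B j (initial_rank pi j)] = (event_prob x n B)%:E.
Proof. by move=> Dx; apply: record_event; [exact: D_proper|exact: member_lawP]. Qed.

Lemma event_prob_stat_bmeas n (B : nat -> set nat) : bmeas (fun pi => event_prob (T pi) n B).
Proof.
apply: bmeas_prod => j _; apply: bmeas_sum => r _; apply: bmeasZ.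
exact: rank_prob_stat_bmeas.
Qed.

Lemma mixture_of_statistic : unique_mixture P D.
Proof.
have [mu [muE muI]] := law_exists P mT.
have mTA A : measurable A -> measurable (T @^-1` A).
  by move=> mA; rewrite -[X in measurable X]setTI; exact: mT.
have muD : mu D = 1%E by rewrite muE; apply: ae_probability1 => //; exact: mTA.
exists mu; split; last first.
  move=> nu [nuD [M [MD MA]]] A mA.
  rewrite muE MA; last exact: mTA.
  rewrite -[LHS](probability1_setI mD nuD mA) -integral_indic //.
  apply/esym; apply: eq_integral => x; rewrite inE => Dx.
  (* Under the member [x] the event that [T] lies in [A] has probability 1 or 0 according to whether
     [x] lies in [A], so the mixture integrates an indicator. *)
  have Tx := T_identifies Dx (MD x Dx).
  rewrite indicE; have [Ax|Ax] := pselect (A x).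
    rewrite mem_set //; apply: ae_probability1; first exact: mTA.
    by apply: filterS Tx => pi /= ->.
  rewrite memNset //; apply: ae_probability0; first exact: mTA.
  by apply: filterS Tx => pi /= ->.
split=> //; exists member_law; split; first exact: member_lawP.
(* Since members come from choice, measurability in the parameter is not known beforehand; it is
   proved together with the mixture identity by Dynkin induction. *)
pose Pr A := measurable_fun D (fun x => member_law x A) /\
   P A = (\int[mu]_(x in D) member_law x A)%E.
suff H A : measurable A -> Pr A by move=> A /H[].
rewrite rank_events_generate; apply: (dynkin_induction rank_events_generate rank_events_setI).
- split.
    apply: (@eq_measurable_fun _ _ _ _ _ (cst 1%E)); last exact: measurable_cst.
    by move=> x _; rewrite [RHS](probability_setT (member_law x)).
  rewrite (eq_integral (cst 1%E)) => [|x _]; last exact: probability_setT.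
  by rewrite integral_cst // [X in (_ * X)%E]muD mule1; exact: probability_setT.
- move=> _ [n [B ->]].
  pose g x := (event_prob x n B)%:E.
  have mg : measurable_fun D g.
    by apply: measurable_funTS; apply/measurable_EFinP; exact: measurable_event_prob.
  split.
    apply: (@eq_measurable_fun _ _ _ _ _ g) => // x; rewrite inE => Dx.
    by rewrite /= member_law_event.
  rewrite event_prob_stat (eq_integral g); last first.
    by move=> x; rewrite inE => Dx; rewrite member_law_event.
  have mgD : measurable_fun [set: record_param R] (g \_ D) by apply/(measurable_restrictT _ mD).
  rewrite integral_mkcond muI //; last first.
    move=> x; rewrite patchE; case: ifPn => //; rewrite inE => Dx.
    by rewrite /g -member_law_event.
  rewrite -Ex_EFin; last exact: event_prob_stat_bmeas.
  apply: ae_eq_integral => //.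
  + by apply/measurable_EFinP; case: (event_prob_stat_bmeas n B).
  + exact: (measurableT_comp mgD mT).
  + by apply: filterS T_D => pi DT _; rewrite patchE mem_set.
- move=> S mS [mfS PS]; have mSC := measurableC mS.
  have mfC : measurable_fun D (fun x => member_law x (~` S)).
    apply: (@eq_measurable_fun _ _ _ _ _ (fun x => 1 - member_law x S)%E).
      by move=> x _; rewrite /= probability_setC.
    by apply: emeasurable_funB => //; exact: measurable_cst.
  split=> //.
  have e : (\int[mu]_(x in D) member_law x (~` S) + \int[mu]_(x in D) member_law x S = 1)%E.
    rewrite -ge0_integralD //.
    rewrite (eq_integral (cst 1%E)) => [|x _]; first by rewrite integral_cst // [X in (_ * X)%E]muD mule1.
    by rewrite [X in (X + _)%E](probability_setC (member_law x) mS) subeK // fin_num_measure.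
  by rewrite [LHS](probability_setC P mS) -e -PS addeK // fin_num_measure.
- move=> F mF tF PF.
  have mfF n : measurable_fun D (fun x => member_law x (F n)) by case: (PF n).
  have sumE x : member_law x (\bigcup_k F k) = (\sum_(i <oo) member_law x (F i))%E.
    rewrite measure_semi_bigcup //; exact: bigcup_measurable.
  split.
    apply: (@eq_measurable_fun _ _ _ _ _ (fun x => \sum_(i <oo) member_law x (F i))%E).
      by move=> x _; rewrite sumE.
    exact: (@ge0_emeasurable_sum _ _ _ D (fun i x => member_law x (F i)) xpredT).
  rewrite measure_semi_bigcup //; last exact: bigcup_measurable.
  under eq_integral do rewrite sumE.
  rewrite integral_nneseries //; apply: eq_eseriesr => n _.
  by case: (PF n).
Qed.

End MixtureOfStatistic.
End Mixture.

(** * The random parameter *)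

Definition lower_count N (v : nat -> nat) : nat := (\sum_(0 <= k < N) ((0 < k) && (v k == 1)))%N.
Definition upper_count N (v : nat -> nat) : nat := (\sum_(0 <= k < N) ((0 < k) && (v k == k.+1)))%N.

Lemma count_big (q : pred nat) N : count q (iota 0 N) = (\sum_(0 <= k < N) q k)%N.
Proof. by rewrite /index_iota subn0 -sum1_count big_mkcond. Qed.

Lemma lower_of_ranks N v : valid_ranks v ->
  proper_lower_records (coherent_of_ranks v N) = lower_count N v.
Proof.
move=> vv; rewrite proper_lower_recordsE count_big /lower_count !big_nat.
by apply: eq_bigr => k /andP[_ kN]; rewrite -initial_rankE // initial_rank_of_ranks.
Qed.

Lemma upper_of_ranks N v : valid_ranks v ->
  proper_upper_records (coherent_of_ranks v N) = upper_count N v.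
Proof.
move=> vv; rewrite proper_upper_recordsE count_big /upper_count !big_nat.
by apply: eq_bigr => k /andP[_ kN]; rewrite -initial_rankE // initial_rank_of_ranks.
Qed.

Lemma lower_type k v : (0 < k)%N -> ((0 < k) && (v == 1))%N = (rank_type k v == Some true).
Proof. by move=> ->; rewrite /rank_type; case: (v == 1)%N => //; case: (v == k.+1). Qed.

Lemma upper_type k v : (0 < k)%N -> ((0 < k) && (v == k.+1))%N = (rank_type k v == Some false).
Proof.
move=> k0; rewrite k0 /rank_type; have [->|_] := eqVneq v k.+1; last by case: (v == 1)%N.
by have -> : (k.+1 == 1)%N = false by lia.
Qed.

Section Uniform.
Context (R : realType) (P : probability coherent_perm R).

Lemma perm_law_cylinder N v : valid_ranks v ->
  perm_law P (coherent_of_ranks v N) = (cylinder_prob P N v)%:E.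
Proof.
move=> vv; rewrite -cylinder_probE; congr (P _); apply/seteqP; split=> pi /=.
  move=> /perm_at_eq H j jN; rewrite H // -(initial_rankE (coherent_of_ranks v) jN) initial_rank_of_ranks //.
move=> H; apply/perm_at_eq => j jN; rewrite H // -(initial_rankE (coherent_of_ranks v) jN) initial_rank_of_ranks //.
Qed.

Context (T : Type) (stat : forall n, 'S_n -> T).
Hypothesis unif : conditionally_uniform P stat.

Lemma uniform_cylinder N v v' : valid_ranks v -> valid_ranks v' ->
  stat (coherent_of_ranks v N) = stat (coherent_of_ranks v' N) ->
  cylinder_prob P N v = cylinder_prob P N v'.
Proof.
by move=> vv vv' /unif e; apply: EFin_inj; rewrite -!perm_law_cylinder.
Qed.

(** Interchanging two types preserves both record counts, hence every statistic determined by them;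
    all four cases are covered. *)
Lemma uniform_exchangeable :
  (forall n (s t : 'S_n), proper_lower_records s = proper_lower_records t ->
     proper_upper_records s = proper_upper_records t -> stat s = stat t) ->
  type_exchangeable P.
Proof.
move=> Hstat N i j r r' s s' w i0 j1 ij iN jN vr vs vr' vs' t1 t2 vw.
have j0 := ltnW j1.
have v1 : valid_ranks (update (pred2 i j) (pair_ranks i r j r') w).
  exact: update_valid (pair_ranks_valid vr vr') vw.
have v2 : valid_ranks (update (pred2 i j) (pair_ranks i s j s') w).
  exact: update_valid (pair_ranks_valid vs vs') vw.
apply: uniform_cylinder => //; apply: Hstat.
  rewrite !lower_of_ranks // /lower_count.
  rewrite !(big_update_pair _ (fun k v => ((0 < k) && (v == 1))%N : nat)) //=; congr (_ + _)%N.
  by rewrite !lower_type // t1 t2 addnC.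
rewrite !upper_of_ranks // /upper_count.
rewrite !(big_update_pair _ (fun k v => ((0 < k) && (v == k.+1))%N : nat)) //=; congr (_ + _)%N.
by rewrite !upper_type // t1 t2 addnC.
Qed.

Lemma uniform_symmetric c c' :
  (forall N i r s w, (0 < i)%N -> (i < N)%N -> (0 < r <= i.+1)%N -> (0 < s <= i.+1)%N ->
     rank_type i r = c -> rank_type i s = c' -> valid_ranks w ->
     stat (coherent_of_ranks (upd1 i r w) N) = stat (coherent_of_ranks (upd1 i s w) N)) ->
  type_symmetric P c c'.
Proof.
move=> H N i r s w i0 iN vr vs tr ts vw.
by apply: uniform_cylinder; [exact: upd1_valid|exact: upd1_valid|exact: H].
Qed.

End Uniform.

Lemma lower_count_upd1 N i r w : (0 < i)%N -> (i < N)%N ->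
  lower_count N (upd1 i r w) = ((rank_type i r == Some true) +
     \sum_(0 <= k < N | k != i) ((0 < k) && (w k == 1)))%N.
Proof.
move=> i0 iN; rewrite /lower_count.
by rewrite (big_upd1 _ (fun k v => ((0 < k) && (v == 1))%N : nat)) //= lower_type.
Qed.

Lemma upper_count_upd1 N i r w : (0 < i)%N -> (i < N)%N ->
  upper_count N (upd1 i r w) = ((rank_type i r == Some false) +
     \sum_(0 <= k < N | k != i) ((0 < k) && (w k == k.+1)))%N.
Proof.
move=> i0 iN; rewrite /upper_count.
by rewrite (big_upd1 _ (fun k v => ((0 < k) && (v == k.+1))%N : nat)) //= upper_type.
Qed.

(** * The parameter as a statistic of the limiting frequencies *)

Section RecordStat.
Context (R : realType).
Local Notation lfreq := (@limit_freq R).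

(* When the limiting frequency of records vanishes, it does not determine the
   parameter, which is then given by z. *)
Definition record_stat (z : coherent_perm -> R * R) (pi : coherent_perm) : record_param R :=
  let t := lfreq pi in
  if rank_norm 1 t == 0 then (Zero, z pi)
  else if t None == 0 then (Infinite, (t (Some true), t (Some false)))
  else (Defs.Finite, (t (Some true) / t None, t (Some false) / t None)).

Variable z : coherent_perm -> R * R.
Hypothesis z_ok : forall pi, [/\ 0 <= (z pi).1, 0 <= (z pi).2 & (z pi).1 + (z pi).2 = 1].
Hypotheses (mz1 : measurable_fun [set: coherent_perm] (fun pi => (z pi).1))
  (mz2 : measurable_fun [set: coherent_perm] (fun pi => (z pi).2)).

Lemma record_stat_proper pi : proper_param (record_stat z pi).
Proof.
rewrite /record_stat; have st := limit_freq_simplex R pi.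
have t0 c := in_simplex_ge0 c st; have tot := in_simplex_total st.
rewrite rank_norm1; case: eqP => [_|n0].
  by have := z_ok pi; case: (z pi).
case: eqP => [m0|/eqP m0] /=; first by split=> //; rewrite -tot m0 addr0.
split; [by rewrite divr_ge0|by rewrite divr_ge0|].
rewrite -mulrDl divr_gt0 // lt_neqAle ?t0 eq_sym ?m0 //.
by rewrite addr_ge0 // andbT; apply/eqP.
Qed.

Lemma measurable_record_stat : measurable_fun [set: coherent_perm] (record_stat z).
Proof.
have ml c := @limit_freq_measurable R c.
have mn : measurable_fun [set: coherent_perm] (fun pi => rank_norm 1 (lfreq pi) == 0).
  apply: measurable_fun_eqr; last exact: measurable_cst.
  by case: (test_fun_bmeas (test_fun_rank_norm R 1)).
have m0 : measurable_fun [set: coherent_perm] (fun pi => lfreq pi None == 0).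
  by apply: measurable_fun_eqr => //; exact: measurable_cst.
apply: measurable_fun_ifT => //.
  apply: (measurable_fun_pair (T1 := regime)); first exact: measurable_cst.
  rewrite (_ : z = fun pi => ((z pi).1, (z pi).2)); last by apply/funext => pi; case: (z pi).
  exact: measurable_fun_pair.
apply: measurable_fun_ifT => //.
  apply: (measurable_fun_pair (T1 := regime)); first exact: measurable_cst.
  apply: measurable_fun_pair; exact: ml.
apply: (measurable_fun_pair (T1 := regime)); first exact: measurable_cst.
by apply: measurable_fun_pair; apply: measurable_funM => //; exact: measurable_inv_fun.
Qed.

(** Dividing numerator and denominator of [rank_ratio] by the frequency of the third type produces
    the finite regime; the cases where that frequency is 0 or 1 are the two others. *)
Lemma record_stat_ratio pi j r : (0 < j)%N -> (0 < r <= j.+1)%N ->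
  (1 < j)%N || (rank_norm 1 (lfreq pi) != 0) ->
  rank_prob (record_stat z pi) j.+1 r = rank_ratio j r (lfreq pi).
Proof.
move=> j0 vr H; have st := limit_freq_simplex R pi.
have t0 c := in_simplex_ge0 c st; have tot := in_simplex_total st.
rewrite rank_norm1 in H; rewrite rank_probE // /rank_ratio (rank_normE _ j0) /record_stat rank_norm1.
case: eqP H => [n0|/eqP n0] H.
  have j1 : (1 < j)%N by move: H; rewrite orbF.
  have tM : lfreq pi None = 1 by rewrite -tot n0 add0r.
  have [tL tU] : lfreq pi (Some true) = 0 /\ lfreq pi (Some false) = 0.
    by have := t0 (Some true); have := t0 (Some false); split; lra.
  rewrite /type_prob; case: (z pi) => a b; have -> : (j == 1)%N = false by lia.
  rewrite n0 add0r tM mulr1; congr (_ / _).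
  by case: (rank_type j r) => [[]|] /=; rewrite ?tL ?tU ?tM.
case: eqP => [m0|/eqP m0].
  have ab : lfreq pi (Some true) + lfreq pi (Some false) = 1 by rewrite -tot m0 addr0.
  rewrite /type_prob ab m0 mulr0 addr0 divr1.
  by case: (rank_type j r) => [[]|].
rewrite /type_prob.
have den : lfreq pi (Some true) + lfreq pi (Some false) + j.-1%:R * lfreq pi None != 0.
  rewrite gt_eqF // ltr_wpDr ?mulr_ge0 // lt_neqAle eq_sym n0 addr_ge0 //.
have den' : lfreq pi (Some true) / lfreq pi None + lfreq pi (Some false) / lfreq pi None + j.-1%:R
  = (lfreq pi (Some true) + lfreq pi (Some false) + j.-1%:R * lfreq pi None) / lfreq pi None.
  by field.
rewrite den'.
case: (rank_type j r) => [[]|] /=; field; rewrite ?m0 ?den //.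
Qed.

Lemma record_stat_rank2 pi r : (0 < r <= 2)%N ->
  rank_prob (record_stat z pi) 2 r = rank_ratio 1 r (lfreq pi) +
    (if r == 1%N then (z pi).1 else (z pi).2) * (rank_norm 1 (lfreq pi) == 0)%:R.
Proof.
move=> vr; have [n0|n0] := eqVneq (rank_norm 1 (lfreq pi)) 0; last first.
  by rewrite record_stat_ratio // mulr0 addr0.
rewrite mulr1 /rank_ratio n0 invr0 mulr0 add0r /record_stat n0 eqxx.
by case: r vr => [|[|[|]]] //; case: (z pi).
Qed.

(** The hypothesis lets [z] replace the indicators of the second rank on the event where records
    have frequency 0, the one place where the frequencies do not prescribe the law. *)
Lemma record_stat_law (P : probability coherent_perm R) : type_exchangeable P ->
  (forall r phi, (0 < r <= 2)%N -> test_fun phi ->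
    Ex P (fun pi => (initial_rank pi 1 == r)%:R * (rank_norm 1 (lfreq pi) == 0)%:R * phi (lfreq pi)) =
    Ex P (fun pi => (if r == 1%N then (z pi).1 else (z pi).2)
                     * (rank_norm 1 (lfreq pi) == 0)%:R * phi (lfreq pi))) ->
  forall n w, valid_ranks w -> cylinder_prob P n w =
     Ex P (fun pi => \prod_(0 <= j < n) rank_prob (record_stat z pi) j.+1 (w j)).
Proof.
move=> exch Hz n w vw.
have cyl1 m : (m <= 1)%N -> cylinder_prob P m w = 1.
  move=> m1; apply: EFin_inj; rewrite -cylinder_probE -(probability_setT P); congr (P _).
  apply/seteqP; split=> // pi _ j jm; have -> : j = 0%N by lia.
  by have := vw 0%N; have := valid_initial_rank pi 0%N; lia.
have w0 : w 0%N = 1%N by have := vw 0%N; lia.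
case: n => [|[|m]].
- by under eq_fun do rewrite big_geq //; rewrite Ex_cst cyl1.
- by under eq_fun do rewrite big_nat1 rank_prob0 w0 /=; rewrite Ex_cst cyl1.
rewrite cylinder_prob_limit //.
pose h (t : option bool -> R) := \prod_(2 <= j < m.+2) rank_ratio j (w j) t.
have th : test_fun h by exact: test_fun_prod_ratio.
have v1 : (0 < w 1%N <= 2)%N by exact: vw.
have bh := test_fun_bmeas th; have bI := rank_eq_bmeas R 1 (w 1%N).
have b0 := bmeas_norm1_eq0 R.
have br : bmeas (fun pi => rank_ratio 1 (w 1%N) (lfreq pi)) by exact: rank_ratio1_bmeas.
have bz : bmeas (fun pi => if w 1%N == 1%N then (z pi).1 else (z pi).2).
  split; first by case: (w 1%N == 1%N).
  exists 1 => pi; have [a b ab] := z_ok pi.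
  by case: ifP => _; rewrite ger0_norm // -ab ?lerDl ?lerDr.
transitivity (Ex P (fun pi => rank_ratio 1 (w 1%N) (lfreq pi) * h (lfreq pi))
  + Ex P (fun pi => (initial_rank pi 1 == w 1%N)%:R * (rank_norm 1 (lfreq pi) == 0)%:R * h (lfreq pi))).
  rewrite -ExD; last 2 first.
  - exact: bmeasM.
  - by apply: bmeasM => //; exact: bmeasM.
  by congr Ex; apply/funext => pi; rewrite mulrDl.
rewrite Hz // -ExD; last 2 first.
- exact: bmeasM.
- by apply: bmeasM => //; exact: bmeasM.
congr Ex; apply/funext => pi; rewrite -mulrDl -record_stat_rank2 //.
rewrite [RHS]big_ltn // [X in _ = _ * X]big_ltn // rank_prob0 w0 mul1r; congr (_ * _).
rewrite /h !big_nat; apply: eq_bigr => j /andP[j2 jm].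
by rewrite record_stat_ratio // ?j2 //; exact: ltnW.
Qed.

(** In the finite regime the frequencies are a, b and 1 divided by a + b + 1, and their ratios
    return a and b. In the zero regime they are (0, 0, 1), so [z] has to supply the pair. *)
Lemma record_stat_identifies (x : record_param R) Q : proper_param x -> record_distribution x Q ->
  (x.1 = Zero -> {ae Q, forall pi, z pi = x.2}) -> {ae Q, forall pi, record_stat z pi = x}.
Proof.
move=> px QxQ Hz; have := record_limit_freq px QxQ.
case: x px QxQ Hz => t [a b] [a0 b0 ab] QxQ Hz.
case: t ab QxQ Hz => ab QxQ Hz.
- apply: filterS => pi tE; rewrite /record_stat rank_norm1 !tE /type_prob /=.
  have s0 : a + b + 1 != 0 by rewrite gt_eqF // ltr_wpDr.
  have ab0 : a + b != 0 by rewrite gt_eqF.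
  rewrite -mulrDl mulf_eq0 (negPf ab0) invr_eq0 (negPf s0) /=.
  rewrite mulf_eq0 oner_eq0 invr_eq0 (negPf s0) /=.
  by congr (_, (_, _)); field.
- apply: filterS2 (Hz erefl) => pi zE tE; rewrite /record_stat rank_norm1 !tE /type_prob /=.
  by rewrite !mul0r addr0 eqxx zE.
- apply: filterS => pi tE; rewrite /record_stat rank_norm1 !tE /type_prob /=.
  by rewrite ab oner_eq0 eqxx.
Qed.

End RecordStat.

(** * The four families *)

Section Families.
Context (R : realType).
Local Notation lfreq := (@limit_freq R).

Definition is_infinite (t : regime) := if t is Defs.Infinite then true else false.

Lemma measurable_bool_set (b : record_param R -> bool) :
  measurable_fun [set: record_param R] b -> measurable [set x | b x].
Proof.
move=> mb; rewrite (_ : [set x | b x] = [set: record_param R] `&` b @^-1` [set true]).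
  exact: mb.
by rewrite setTI; apply/seteqP; split=> x.
Qed.

Let m1 := @measurable_param1 R.
Let m2 := @measurable_param2 R.
Let mc (c : R) := @measurable_cst _ _ (record_param R) R [set: record_param R] c.

(** In boolean form membership is measurable coordinate by coordinate and can be checked by
    computation. *)
Lemma lower_familyE : lower_family R = [set x |
  (is_finite x.1 && ((0 <= x.2.1) && (x.2.2 == 1))) ||
  (is_infinite x.1 && ((x.2.1 == 1) && (x.2.2 == 0)))].
Proof.
apply/seteqP; split=> [x [[a]|->]|[t [a b]]] /=.
- by rewrite in_itv /= andbT => a0 <-; rewrite /= a0 eqxx.
- by rewrite /= !eqxx.
case: t => //=; rewrite ?orbF => /andP[h /eqP ->].
  by left; exists a => //; rewrite /= in_itv /= h.
by move/eqP: h => ->; right.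
Qed.

Lemma upper_familyE : upper_family R = [set x |
  (is_finite x.1 && ((0 <= x.2.2) && (x.2.1 == 1))) ||
  (is_infinite x.1 && ((x.2.1 == 0) && (x.2.2 == 1)))].
Proof.
apply/seteqP; split=> [x [[a]|->]|[t [a b]]] /=.
- by rewrite in_itv /= andbT => a0 <-; rewrite /= a0 eqxx.
- by rewrite /= !eqxx.
case: t => //=; rewrite ?orbF => /andP[h /eqP ->].
  by left; exists b => //; rewrite /= in_itv /= h.
by move/eqP: h => ->; right.
Qed.

Lemma total_familyE : total_family R = [set x |
  (is_finite x.1 && ((0 < x.2.1) && (x.2.1 == x.2.2))) ||
  (~~ is_finite x.1 && ((x.2.1 == 2^-1) && (x.2.2 == 2^-1)))].
Proof.
apply/seteqP; split=> [x [[[a]|->]|->]|[t [a b]]] /=.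
- by rewrite in_itv /= andbT => a0 <-; rewrite /= a0 eqxx.
- by rewrite /= !eqxx.
- by rewrite /= !eqxx.
case: t => /=; rewrite ?orbF => /andP[h /eqP e].
- by left; left; exists a; [rewrite /= in_itv /= h|rewrite e].
- by move/eqP: h => ->; rewrite e; left; right.
- by move/eqP: h => ->; rewrite e; right.
Qed.

Lemma nondegenerate_familyE : nondegenerate_family R = [set x |
  is_finite x.1 && ((0 < x.2.1) && (0 < x.2.2))].
Proof.
apply/seteqP; split=> [x [a]|[t [a b]]] /=.
  by rewrite in_itv /= andbT => a0 [b]; rewrite in_itv /= andbT => b0 <-; rewrite /= a0 b0.
case: t => //= /andP[a0 b0]; exists a; first by rewrite /= in_itv /= a0.
by exists b => //; rewrite /= in_itv /= b0.
Qed.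

Lemma degenerate_familyE : degenerate_family R = [set x |
  [|| is_finite x.1 && ((0 < x.2.1) && (x.2.2 == 0)),
      is_finite x.1 && ((x.2.1 == 0) && (0 < x.2.2)),
      is_zero x.1 && ((x.2.1 == 1) && (x.2.2 == 0)),
      is_zero x.1 && ((x.2.1 == 0) && (x.2.2 == 1)) |
      is_infinite x.1 && ((0 <= x.2.1) && ((0 <= x.2.2) && (x.2.1 + x.2.2 == 1)))]].
Proof.
apply/seteqP; split=> [x [[[[[a]|[a]]|->]|->]|[a]]|[t [a b]]] /=.
- by rewrite in_itv /= andbT => a0 <-; rewrite /= a0 eqxx.
- by rewrite in_itv /= andbT => a0 <-; rewrite /= a0 eqxx orbT.
- by rewrite /= !eqxx.
- by rewrite /= !eqxx orbT.
- by rewrite in_itv /= => /andP[a0 a1] <-; rewrite /= a0 subr_ge0 a1 addrC subrK eqxx.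
case: t => /=; rewrite ?orbF.
- move=> /orP[/andP[h /eqP ->]|/andP[/eqP -> h]]; left; left; left.
    by left; exists a => //; rewrite /= in_itv /= h.
  by right; exists b => //; rewrite /= in_itv /= h.
- by move=> /orP[/andP[/eqP-> /eqP->]|/andP[/eqP-> /eqP->]]; left; [left|]; right.
move=> /and3P[a0 b0 /eqP ab]; right; exists a; last by rewrite -ab addrAC subrr add0r.
by rewrite /= in_itv /= a0 -ab lerDl.
Qed.

Ltac measurable_family :=
  repeat (first [apply: measurable_or | apply: measurable_and
    | exact: (measurable_regime is_finite) | exact: (measurable_regime is_zero)
    | exact: (measurable_regime is_infinite) | exact: (measurable_regime (fun t => ~~ is_finite t))
    | exact: measurable_fun_ler | exact: measurable_fun_ltr | exact: measurable_fun_eqr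
    | apply: measurable_fun_eqr | apply: measurable_funD | exact: measurable_cst]).

Lemma measurable_lower_family : measurable (lower_family R).
Proof. by rewrite lower_familyE; apply: measurable_bool_set; measurable_family. Qed.

Lemma measurable_upper_family : measurable (upper_family R).
Proof. by rewrite upper_familyE; apply: measurable_bool_set; measurable_family. Qed.

Lemma measurable_total_family : measurable (total_family R).
Proof. by rewrite total_familyE; apply: measurable_bool_set; measurable_family. Qed.

Lemma measurable_nondegenerate_family : measurable (nondegenerate_family R).
Proof. by rewrite nondegenerate_familyE; apply: measurable_bool_set; measurable_family. Qed.

Lemma measurable_degenerate_family : measurable (degenerate_family R).
Proof. by rewrite degenerate_familyE; apply: measurable_bool_set; measurable_family. Qed.

Lemma lower_family_proper x : lower_family R x -> proper_param x.
Proof.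
rewrite lower_familyE; case: x => -[] [a b] //=; rewrite ?orbF => /andP[h /eqP->].
  by split=> //; rewrite ltr_wpDl.
by move/eqP: h => ->; split=> //; rewrite addr0.
Qed.

Lemma upper_family_proper x : upper_family R x -> proper_param x.
Proof.
rewrite upper_familyE; case: x => -[] [a b] //=; rewrite ?orbF => /andP[h /eqP->].
  by split=> //; rewrite ltr_wpDr.
by move/eqP: h => ->; split=> //; rewrite add0r.
Qed.

Lemma total_family_proper x : total_family R x -> proper_param x.
Proof.
have half : 2^-1 + 2^-1 = 1 :> R by rewrite [RHS]splitr mul1r.
rewrite total_familyE; case: x => -[] [a b] /=; rewrite ?orbF => /andP[h /eqP e].
- by rewrite -e; split; rewrite ?ltW // addr_gt0.
- by move/eqP: h => ->; rewrite e; split; rewrite ?invr_ge0.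
- by move/eqP: h => ->; rewrite e; split; rewrite ?invr_ge0.
Qed.

Lemma nondegenerate_family_proper x : nondegenerate_family R x -> proper_param x.
Proof.
rewrite nondegenerate_familyE; case: x => -[] [a b] //= /andP[a0 b0].
by split; rewrite ?ltW // addr_gt0.
Qed.

Lemma degenerate_family_proper x : degenerate_family R x -> proper_param x.
Proof.
rewrite degenerate_familyE; case: x => -[] [a b] /=; rewrite ?orbF.
- move=> /orP[/andP[h /eqP ->]|/andP[/eqP -> h]].
    by split; rewrite ?addr0 // ltW.
  by split; rewrite ?add0r // ltW.
- by move=> /orP[/andP[/eqP-> /eqP->]|/andP[/eqP-> /eqP->]]; split; rewrite ?addr0 ?add0r.
by move=> /and3P[a0 b0 /eqP ab]; split.
Qed.

(** * Degeneracy is visible on three entries *)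

Section Degeneracy.
Variables (x : record_param R) (Q : probability coherent_perm R).
Hypothesis QxQ : record_distribution x Q.

Lemma perm_law_record n (s : 'S_n) :
  perm_law Q s = (\prod_(0 <= j < n) rank_prob x j.+1 (perm_rank s j))%:E.
Proof.
rewrite -(record_cylinder_prob QxQ) -cylinder_probE; congr (Q _).
by apply/seteqP; split=> pi /perm_at_eq.
Qed.

Lemma perm_law_ranks v n : valid_ranks v ->
  perm_law Q (coherent_of_ranks v n) = (\prod_(0 <= j < n) rank_prob x j.+1 (v j))%:E.
Proof. by move=> vv; rewrite perm_law_cylinder // (record_cylinder_prob QxQ). Qed.

Lemma nondegenerate_familyP : nondegenerate_family R x -> ~ degenerate Q.
Proof.
move=> nx [n [s]]; rewrite perm_law_record => /eqP; rewrite eqe; apply/negP.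
rewrite gt_eqF //; apply: prodr_gt0 => j _; rewrite /perm_rank.
have := rank_at_bounds (perm_nat s) j; move: (rank_at _ j) => r.
case: j => [|j] vr; first by rewrite rank_prob0; have -> : r = 1%N by lia.
rewrite rank_probE //; move: nx; rewrite nondegenerate_familyE.
case: (x) => -[] [a b] //= /andP[a0 b0]; rewrite divr_gt0 //.
  by case: rank_type => [[]|].
by rewrite ltr_pwDl // addr_gt0.
Qed.

(** Some rank is impossible early on: one of the two at position 1, or, in the infinite regime, the
    middle rank at position 2. Completing it by ranks 1 gives the permutation. *)
Lemma degenerate_family3 : degenerate_family R x -> exists s : 'S_3, perm_law Q s = 0%E.
Proof.
move=> dx.
have key j r : (0 < j < 3)%N -> (0 < r <= j.+1)%N -> type_prob x j (rank_type j r) = 0 ->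
    exists s : 'S_3, perm_law Q s = 0%E.
  move=> /andP[j0 j3] vr e; pose v k := if k == j then r else 1%N.
  have vv : valid_ranks v by move=> k; rewrite /v; case: eqP => [->|].
  exists (coherent_of_ranks v 3); rewrite perm_law_ranks //; congr EFin.
  apply/eqP; rewrite prodf_seq_eq0; apply/hasP; exists j; rewrite ?mem_index_iota //=.
  by rewrite /v eqxx rank_probE // e.
move: dx; rewrite degenerate_familyE; case: (x) key => -[] [a b] key /=; rewrite ?orbF.
- move=> /orP[/andP[h /eqP b0]|/andP[/eqP a0 h]].
    by apply: (key 1%N 2%N) => //=; rewrite b0 mul0r.
  by apply: (key 1%N 1%N) => //=; rewrite a0 mul0r.
- move=> /orP[/andP[/eqP a1 /eqP b0]|/andP[/eqP a0 /eqP b1]].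
    by apply: (key 1%N 2%N).
  by apply: (key 1%N 1%N).
by move=> _; apply: (key 2%N 2%N).
Qed.

End Degeneracy.

(** The choice of [z] when the family contains at most the two extreme members of the zero regime:
    the observed second rank selects one of them. *)
Definition second_rank_sign (pi : coherent_perm) : R * R :=
  ((initial_rank pi 1 == 1%N)%:R, (initial_rank pi 1 == 2%N)%:R).

(** The choice of [z] when the two kinds of records are symmetric, so that the second rank is
    fair. *)
Definition half_pair (pi : coherent_perm) : R * R := (2^-1, 2^-1).

Lemma second_rank pi : (initial_rank pi 1 == 2)%N = ~~ (initial_rank pi 1 == 1)%N.
Proof. by have := valid_initial_rank pi 1%N; case: eqP; case: eqP => //; lia. Qed.

Lemma second_rank_sign_ok pi : [/\ 0 <= (second_rank_sign pi).1, 0 <= (second_rank_sign pi).2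
  & (second_rank_sign pi).1 + (second_rank_sign pi).2 = 1].
Proof. by rewrite /= second_rank; case: eqP; split; rewrite ?addr0 ?add0r. Qed.

Lemma half_pair_ok pi : [/\ 0 <= (half_pair pi).1, 0 <= (half_pair pi).2
  & (half_pair pi).1 + (half_pair pi).2 = 1].
Proof. by split; rewrite /= ?invr_ge0 // [RHS]splitr mul1r. Qed.

Lemma measurable_second_rank_sign1 :
  measurable_fun [set: coherent_perm] (fun pi => (second_rank_sign pi).1).
Proof. by case: (rank_eq_bmeas R 1 1). Qed.

Lemma measurable_second_rank_sign2 :
  measurable_fun [set: coherent_perm] (fun pi => (second_rank_sign pi).2).
Proof. by case: (rank_eq_bmeas R 1 2). Qed.

(** * The mixtures in the four cases *)

Section Mixtures.
Variable (P : probability coherent_perm R).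
Hypothesis exch : type_exchangeable P.

(** As [z] consists of the indicators of the second rank, the replacement required by
    [record_stat_law] is an identity. Under an extreme member the second rank is almost surely
    constant, so [z] recovers the parameter. *)
Lemma second_rank_mixture D : measurable D -> (forall x, D x -> proper_param x) ->
  (forall x, D x -> x.1 = Zero -> x = (Zero, (1, 0)) \/ x = (Zero, (0, 1))) ->
  {ae P, forall pi, D (record_stat second_rank_sign pi)} -> unique_mixture P D.
Proof.
move=> mD Dp DZ PD.
apply: (@mixture_of_statistic R P D (record_stat second_rank_sign)) => //.
- exact: measurable_record_stat measurable_second_rank_sign1 measurable_second_rank_sign2.
- exact: record_stat_proper second_rank_sign_ok.
- apply: (record_stat_law second_rank_sign_ok measurable_second_rank_sign1
    measurable_second_rank_sign2 exch) => r phi vr _.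
  congr Ex; apply/funext => pi; congr (_ * _ * _).
  by case: r vr => [|[|[|]]].
- move=> x Q Dx QxQ; have px := Dp x Dx.
  apply: (record_stat_identifies px QxQ) => x0; have [_ law] := QxQ.
  have ae1 r : Q [set pi | initial_rank pi 1 = r] = 0%E -> {ae Q, forall pi, (initial_rank pi 1 == r)%N = false}.
    move=> Q0; exists [set pi | initial_rank pi 1 = r]; split=> //.
      exact: (measurable_initial_rank 1 [set r]).
    by move=> pi /=; case: eqP.
  have [xE|xE] := DZ x Dx x0.
    have /ae1 : Q [set pi | initial_rank pi 1 = 2%N] = 0%E by rewrite law xE.
    apply: filterS => pi e; rewrite /second_rank_sign e xE.
    by move: e; rewrite second_rank => /negbFE ->.
  have /ae1 : Q [set pi | initial_rank pi 1 = 1%N] = 0%E by rewrite law xE.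
  by apply: filterS => pi e; rewrite /second_rank_sign second_rank e xE.
Qed.

(** The indicator of the event is not a test function, so one subtracts: the second rank is fair
    against every test function, and off the event its ratio is 1/2 since the two record frequencies
    agree. *)
Lemma symmetric_zero_rank r phi : type_symmetric P (Some true) (Some false) ->
  (0 < r <= 2)%N -> test_fun phi ->
  Ex P (fun pi => (initial_rank pi 1 == r)%:R * (rank_norm 1 (lfreq pi) == 0)%:R * phi (lfreq pi)) =
  Ex P (fun pi => 2^-1 * (rank_norm 1 (lfreq pi) == 0)%:R * phi (lfreq pi)).
Proof.
move=> sym vr tphi; have bphi := test_fun_bmeas tphi.
have bI s := rank_eq_bmeas R 1 s; have b0 := bmeas_norm1_eq0 R; have b1 := bmeas_norm1_neq0 R.
have e12 := Ex_symmetric exch (i := 1%N) (r := 1%N) (s := 2%N) sym isT isT isT erefl erefl tphi.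
have sumE : Ex P (fun pi => (initial_rank pi 1 == 1%N)%:R * phi (lfreq pi)) +
   Ex P (fun pi => (initial_rank pi 1 == 2%N)%:R * phi (lfreq pi)) = Ex P (fun pi => phi (lfreq pi)).
  rewrite -ExD; [|exact: bmeasM|exact: bmeasM].
  congr Ex; apply/funext => pi; rewrite second_rank.
  by case: eqP; rewrite /= ?mul1r ?mul0r ?addr0 ?add0r.
have half : Ex P (fun pi => (initial_rank pi 1 == r)%:R * phi (lfreq pi))
    = Ex P (fun pi => 2^-1 * phi (lfreq pi)).
  rewrite ExZ // -sumE; case: r vr => [|[|[|]]] // _; rewrite ?e12; lra.
have rest : Ex P (fun pi => (initial_rank pi 1 == r)%:R * ((rank_norm 1 (lfreq pi) != 0)%:R * phi (lfreq pi)))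
   = Ex P (fun pi => 2^-1 * ((rank_norm 1 (lfreq pi) != 0)%:R * phi (lfreq pi))).
  rewrite Ex_peel1 //; apply: Ex_ae.
  - by apply: bmeasM => //; exact: rank_ratio1_bmeas.
  - by apply: bmeasZ; exact: bmeasM.
  apply: filterS (limit_freq_symmetric exch sym) => pi e.
  rewrite mulrA; congr (_ * _); rewrite /rank_ratio rank_norm1 -e.
  have -> : lfreq pi (rank_type 1 r) = lfreq pi (Some true).
    by have [[] ->] := rank_type1 vr.
  have [->|l0] := eqVneq (lfreq pi (Some true)) 0; first by rewrite addr0 eqxx mul0r mulr0.
  have -> : lfreq pi (Some true) + lfreq pi (Some true) != 0.
    by rewrite -mulr2n mulrn_eq0.
  by set l := lfreq pi _ in l0 *; rewrite mulr1 (_ : l + l = l * 2) ?invfM ?mulrA ?divff ?mul1r //; ring.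
have split_ s : bmeas s -> Ex P (fun pi => s pi * (rank_norm 1 (lfreq pi) == 0)%:R * phi (lfreq pi)) =
   Ex P (fun pi => s pi * phi (lfreq pi))
   - Ex P (fun pi => s pi * ((rank_norm 1 (lfreq pi) != 0)%:R * phi (lfreq pi))).
  move=> bs; rewrite -ExB; [|exact: bmeasM|by do 2 apply: bmeasM => //].
  by congr Ex; apply/funext => pi; case: (rank_norm _ _ == 0); rewrite /=; ring.
by rewrite !split_ //; [rewrite half rest|exact: bmeas_cst].
Qed.

Lemma symmetric_mixture : type_symmetric P (Some true) (Some false) ->
  unique_mixture P (total_family R).
Proof.
move=> sym.
apply: (@mixture_of_statistic R P _ (record_stat half_pair)).
- exact: measurable_total_family.
- exact: total_family_proper.
- by apply: measurable_record_stat; exact: (measurable_cst (2^-1 : R)).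
- exact: record_stat_proper half_pair_ok.
- apply: filterS (limit_freq_symmetric exch sym) => pi e.
  have st := limit_freq_simplex R pi; have t0 c := in_simplex_ge0 c st.
  have tot := in_simplex_total st.
  rewrite total_familyE /record_stat rank_norm1 -e; case: eqP => [_|/eqP l0] /=; first by rewrite eqxx.
  case: eqP => [m0|/eqP m0] /=.
    rewrite m0 addr0 -e in tot; have -> : lfreq pi (Some true) = 2^-1 by lra.
    by rewrite eqxx.
  rewrite orbF eqxx andbT divr_gt0 // lt_neqAle t0 andbT eq_sym //.
  by apply: contraNneq l0 => ->; rewrite addr0.
- apply: (record_stat_law half_pair_ok (measurable_cst (2^-1 : R)) (measurable_cst (2^-1 : R)) exch) => r phi vr tphi.
  rewrite symmetric_zero_rank //; congr Ex; apply/funext => pi.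
  by case: ifP.
- move=> x Q Dx QxQ; apply: (record_stat_identifies (total_family_proper Dx) QxQ).
  move=> x0; apply: aeW => pi; move: Dx x0; rewrite total_familyE.
  by case: (x) => -[] [a b] //= /andP[/eqP -> /eqP ->].
Qed.

(** Upper records and the third type have equal frequencies, whose ratio is the second parameter 1.
    If both vanish only lower records remain; the zero regime would make all three frequencies
    vanish. *)
Lemma lower_mixture : type_symmetric P (Some false) None -> unique_mixture P (lower_family R).
Proof.
move=> sym; apply: second_rank_mixture.
- exact: measurable_lower_family.
- exact: lower_family_proper.
- by move=> x; rewrite lower_familyE; case: x => -[] [a b].
apply: filterS (limit_freq_symmetric exch sym) => pi e.
have st := limit_freq_simplex R pi; have t0 c := in_simplex_ge0 c st.
have tot := in_simplex_total st; rewrite e in tot.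
rewrite lower_familyE /record_stat rank_norm1 e; case: eqP => [n0|n0] /=.
  by have := t0 (Some true); have := t0 None; lra.
case: eqP => [m0|/eqP m0] /=.
  by rewrite m0 !addr0 in tot *; rewrite tot !eqxx.
by rewrite divff // eqxx divr_ge0.
Qed.

Lemma upper_mixture : type_symmetric P (Some true) None -> unique_mixture P (upper_family R).
Proof.
move=> sym; apply: second_rank_mixture.
- exact: measurable_upper_family.
- exact: upper_family_proper.
- by move=> x; rewrite upper_familyE; case: x => -[] [a b].
apply: filterS (limit_freq_symmetric exch sym) => pi e.
have st := limit_freq_simplex R pi; have t0 c := in_simplex_ge0 c st.
have tot := in_simplex_total st; rewrite e in tot.
rewrite upper_familyE /record_stat rank_norm1 e; case: eqP => [n0|n0] /=.
  by have := t0 (Some false); have := t0 None; lra.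
case: eqP => [m0|/eqP m0] /=.
  by rewrite m0 addr0 add0r in tot *; rewrite tot !eqxx.
by rewrite divff // eqxx divr_ge0.
Qed.

(** The two families exhaust the proper parameters except in the zero regime, where the statistic
    takes only the two extreme values. *)
Lemma pair_mixture : unique_mixture P (nondegenerate_family R `|` degenerate_family R).
Proof.
apply: second_rank_mixture.
- by apply: measurableU; [exact: measurable_nondegenerate_family|exact: measurable_degenerate_family].
- by move=> x [/nondegenerate_family_proper|/degenerate_family_proper].
- rewrite nondegenerate_familyE degenerate_familyE => -[[] [a b]] //= [] //; rewrite ?orbF //.
  by move=> /orP[/andP[/eqP -> /eqP ->]|/andP[/eqP -> /eqP ->]] _; [left|right].
apply: aeW => pi; have := record_stat_proper second_rank_sign_ok pi.
have : (record_stat second_rank_sign pi).1 = Zero ->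
    (record_stat second_rank_sign pi).2 = second_rank_sign pi.
  by rewrite /record_stat; case: eqP => // _; case: eqP.
rewrite nondegenerate_familyE degenerate_familyE.
case: (record_stat _ _) => -[] [a b] /= zE [a0 b0 ab].
- move: a0 b0 ab; rewrite !le_eqVlt => /predU1P[<-|a0] /predU1P[<-|b0] ab.
  + by rewrite addr0 ltxx in ab.
  + by right; rewrite /= eqxx b0 orbT.
  + by right; rewrite /= eqxx a0.
  + by left; rewrite /= a0 b0.
- right; have := zE erefl; rewrite /second_rank_sign second_rank => -[-> ->].
  by case: (initial_rank pi 1 == 1)%N; rewrite /= !eqxx ?orbT.
- by right; rewrite /= a0 b0 ab eqxx.
Qed.

End Mixtures.

(** Positivity is asked of almost every member: half of P^(1,1) plus half of P^(1,0) charges all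
    permutations of three entries and still gives mass 1/2 to a degenerate member. Since each
    degenerate parameter has a law, it violates the condition and lies in the exceptional null
    set. *)
Lemma degenerate_not_charged (P : probability coherent_perm R) mu :
  mixing_measure P (nondegenerate_family R `|` degenerate_family R) mu ->
  {ae mu, forall x, forall Q, record_distribution x Q -> positive_law3 Q} ->
  mu (degenerate_family R) = 0%E.
Proof.
move=> _ [N [mN N0 sub]].
apply: (subset_measure0 measurable_degenerate_family mN _ N0) => x dx; apply: sub => /= H.
have [Q QxQ] := record_distribution_exists (degenerate_family_proper dx).
have [s s0] := degenerate_family3 QxQ dx.
by have := H Q QxQ s; rewrite s0 ltxx.
Qed.

End Families.

Unset Implicit Arguments.

Theorem proposition6 (R : realType) (P : probability coherent_perm R) :
  (conditionally_uniform P proper_lower_records ->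
     unique_mixture P (lower_family R)) /\
  (conditionally_uniform P proper_upper_records ->
     unique_mixture P (upper_family R)) /\
  (conditionally_uniform P
     (fun n (s : 'S_n) =>
        (proper_lower_records s + proper_upper_records s)%N) ->
     unique_mixture P (total_family R)) /\
  (conditionally_uniform P
     (fun n (s : 'S_n) =>
        (proper_lower_records s, proper_upper_records s)) ->
     unique_mixture P (nondegenerate_family R `|` degenerate_family R) /\
     (forall x Q, record_distribution x Q ->
        (nondegenerate_family R x -> ~ degenerate Q) /\
        (degenerate_family R x -> degenerate Q)) /\
     (forall mu,
        mixing_measure P (nondegenerate_family R `|` degenerate_family R) mu ->
        {ae mu, forall x, forall Q, record_distribution x Q -> positive_law3 Q} ->
        mu (degenerate_family R) = 0%E)).
Proof.
split; [|split; [|split]] => unif.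
- have exch : type_exchangeable P by apply: (uniform_exchangeable unif) => n s t ->.
  apply: (lower_mixture exch); apply: (uniform_symmetric unif) => N i r s w i0 iN vr vs tr ts vw.
  by rewrite !lower_of_ranks ?lower_count_upd1 ?tr ?ts //; exact: upd1_valid.
- have exch : type_exchangeable P by apply: (uniform_exchangeable unif) => n s t _ ->.
  apply: (upper_mixture exch); apply: (uniform_symmetric unif) => N i r s w i0 iN vr vs tr ts vw.
  by rewrite !upper_of_ranks ?upper_count_upd1 ?tr ?ts //; exact: upd1_valid.
- have exch : type_exchangeable P by apply: (uniform_exchangeable unif) => n s t -> ->.
  apply: (symmetric_mixture exch); apply: (uniform_symmetric unif) => N i r s w i0 iN vr vs tr ts vw.
  have vrw : valid_ranks (upd1 i r w) by exact: upd1_valid.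
  have vsw : valid_ranks (upd1 i s w) by exact: upd1_valid.
  (* Turning a lower record into an upper one moves a unit from one count to the other. *)
  rewrite !lower_of_ranks // !upper_of_ranks // !lower_count_upd1 // !upper_count_upd1 // tr ts.
  by rewrite !add0n [RHS]addnCA addnA.
have exch : type_exchangeable P by apply: (uniform_exchangeable unif) => n s t -> ->.
split; [exact: pair_mixture|split=> [x Q QxQ|]]; last exact: degenerate_not_charged.
split; first exact: (nondegenerate_familyP QxQ).
by move=> /(degenerate_family3 QxQ)[s s0]; exists 3%N, s.
Qed.
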